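(* Let $A$ be a nonzero C$^*$-algebra. Then $A$ is commutative and pseudocompact if and only if $A$ is commutative, unital, of real rank zero, and every element of $A$ can be approximately normed by a minimal projection $p$ with $pAp=\mathbb{C}p$; that is, for every $x\in A$ and $\varepsilon>0$ there is a minimal projection $p\in A$ with $pAp=\mathbb{C}p$ and $\big|\,\|x\|-\|xp\|\,\big|<\varepsilon$. Moreover the following conditions form a set of axioms for the class of commutative pseudocompact C$^*$-algebras (i.e. $A$ is commutative and pseudocompact if and only if all of them hold): (1) $\sup_{\|x\|,\|y\|\le 1}\|xy-yx\|=0$; (2) $\inf_{\|e\|\le 1}\sup_{\|x\|\le 1}\|ex-x\|=0$; (3) $\varphi_{\mathrm{rr0}}^A=0$; (4) $\displaystyle\sup_{\|x\|\le 1}\ \inf_{p}\ \sup_{\|y\|\le 1}\ \inf_{|\lambda|\le 1}\Big(\|pyp-\lambda p\|+\big|\,\|x\|-\|xp\|\,\big|\Big)=0$, where $x,y$ range over the closed unit ball of $A$, $p$ over the projections of $A$, and $\lambda$ over complex numbers.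
   Context: $M_n$ denotes the C$^*$-algebra of complex $n\times n$ matrices, $n\ge 1$. Finite-dimensional C$^*$-algebras are, up to isomorphism, the (nonempty) finite direct sums of matrix algebras $M_n$. Continuous logic for C$^*$-algebras: atomic formulae are norms $\|P(x_1,\dots,x_k)\|$ of $*$-polynomials with complex coefficients (a constant $I$ for the identity may be used when the algebras are unital); formulae are built from these by applying continuous real-valued functions to finitely many formulae and by taking $\sup$ or $\inf$ of a variable over the closed unit ball. A sentence is a formula without free variables; $\varphi^A\in\mathbb{R}$ is its value in $A$. $A\equiv B$ (elementarily equivalent) if $\varphi^A=\varphi^B$ for every sentence $\varphi$. For an ultrafilter $\mathcal{U}$ on a set $I$, the ultraproduct $\prod_{\mathcal{U}}A_i$ is the C$^*$-algebra of bounded families $(a_i)_{i\in I}$ modulo those with $\lim_{\mathcal{U}}\|a_i\|=0$. A C$^*$-algebra is pseudocompact if it is elementarily equivalent to an ultraproduct of finite-dimensional C$^*$-algebras. A C$^*$-algebra has real rank zero if its self-adjoint elements with finite spectrum are dense in its self-adjoint elements. $\varphi_{\mathrm{rr0}}$ denotes a sentence axiomatizing real rank zero (such a sentence is known to exist): $\varphi_{\mathrm{rr0}}^A=0$ if and only if $A$ has real rank zero. A minimal projection is a nonzero projection with no nonzero proper subprojection. For $x=0$ the approximate norming condition just asks that a minimal projection with $pAp=\mathbb{C}p$ exists. *)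

(* Defs.v *)
From HB Require Import structures.
From mathcomp Require Import all_boot all_order all_algebra.
From mathcomp Require Import all_classical all_reals all_analysis.
From mathcomp Require Import complex.
Set Implicit Arguments.
Unset Strict Implicit.
Unset Printing Implicit Defensive.
Import Order.TTheory GRing.Theory Num.Theory.
Import numFieldNormedType.Exports.
Local Open Scope classical_set_scope.
Local Open Scope complex_scope.
Local Open Scope ring_scope.

(* A C*-algebra, not assumed unital, over the complex numbers R[i]. *)
HB.mixin Record CompleteNormedModule_isCStarAlgebra (R : realType) A
    & CompleteNormedModule R[i] A := {
  cmul : A -> A -> A ;
  cstar : A -> A ;
  cmulA : associative cmul ;
  cmulDl : left_distributive cmul +%R ;
  cmulDr : right_distributive cmul +%R ;
  cmulZl : forall (l : R[i]) x y, cmul (l *: x) y = l *: cmul x y ;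
  cmulZr : forall (l : R[i]) x y, cmul x (l *: y) = l *: cmul x y ;
  cstarK : involutive cstar ;
  cstarD : {morph cstar : x y / x + y} ;
  cstarZ : forall (l : R[i]) x, cstar (l *: x) = l^* *: cstar x ;
  cstarM : forall x y, cstar (cmul x y) = cmul (cstar y) (cstar x) ;
  normc_cmul : forall x y, `|cmul x y| <= `|x| * `|y| ;
  normc_cstar_cmul : forall x, `|cmul (cstar x) x| = `|x| ^+ 2 }.

#[short(type="cstarAlgType")]
HB.structure Definition CStarAlgebra (R : realType) :=
  {A of CompleteNormedModule_isCStarAlgebra R A & CompleteNormedModule R[i] A}.

(* Norms of modules over R[i] take their (real, nonnegative) values in R[i];
   cnorm is the same norm, valued in R. *)
Definition cnorm (R : realType) (V : normedZmodType R[i]) (x : V) : R :=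
  complex.Re `|x|.

Section CNorm.
Context {R : realType}.

Lemma cnormE (V : normedZmodType R[i]) (x : V) : `|x| = (cnorm x)%:C.
Proof. by rewrite /cnorm RRe_real// normr_real. Qed.

Lemma cnorm_ge0 (V : normedZmodType R[i]) (x : V) : 0 <= cnorm x.
Proof. by rewrite -lecR -cnormE; exact: normr_ge0. Qed.

Lemma cnormD (V : normedZmodType R[i]) (x y : V) :
  cnorm (x + y) <= cnorm x + cnorm y.
Proof. by rewrite -lecR rmorphD/= -!cnormE ler_normD. Qed.

Lemma cnormN (V : normedZmodType R[i]) (x : V) : cnorm (- x) = cnorm x.
Proof. by rewrite /cnorm normrN. Qed.

Lemma cnormB (V : normedZmodType R[i]) (x y : V) : cnorm (x - y) = cnorm (y - x).
Proof. by rewrite -cnormN opprB. Qed.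

Lemma cnorm0 (V : normedZmodType R[i]) : cnorm (0 : V) = 0.
Proof. by rewrite /cnorm normr0. Qed.

Lemma cnorm_triangle (V : normedZmodType R[i]) (x y z : V) :
  cnorm (x - z) <= cnorm (x - y) + cnorm (y - z).
Proof. by rewrite (le_trans _ (cnormD _ _))// addrA subrK. Qed.

Lemma cnorm_subl (V : normedZmodType R[i]) (x y : V) :
  cnorm x <= cnorm (x - y) + cnorm y.
Proof. by rewrite (le_trans _ (cnormD _ _))// subrK. Qed.

Lemma cnormZ (V : normedModType R[i]) (l : R[i]) (x : V) :
  cnorm (l *: x) = cnorm l * cnorm x.
Proof. by apply: complexI; rewrite rmorphM/= -!cnormE normrZ. Qed.

Lemma cnormM (A : cstarAlgType R) (x y : A) :
  cnorm (cmul x y) <= cnorm x * cnorm y.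
Proof. by rewrite -lecR rmorphM/= -!cnormE normc_cmul. Qed.

Lemma cnorm_cstar_cmul (A : cstarAlgType R) (x : A) :
  cnorm (cmul (cstar x) x) = cnorm x ^+ 2.
Proof. by apply: complexI; rewrite rmorphXn/= -!cnormE normc_cstar_cmul. Qed.

Lemma cmul0x (A : cstarAlgType R) (x : A) : cmul 0 x = 0.
Proof. by rewrite -[X in cmul X _](scale0r 0) cmulZl scale0r. Qed.

Lemma cmulx0 (A : cstarAlgType R) (x : A) : cmul x 0 = 0.
Proof. by rewrite -[X in cmul _ X](scale0r 0) cmulZr scale0r. Qed.

Lemma cstar0 (A : cstarAlgType R) : cstar (0 : A) = 0.
Proof. by rewrite -[X in cstar X](scale0r 0) cstarZ rmorph0 scale0r. Qed.

Lemma cstarN (A : cstarAlgType R) (x : A) : cstar (- x) = - cstar x.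
Proof. by apply/eqP; rewrite -addr_eq0 -cstarD addNr cstar0. Qed.

Lemma cstarB (A : cstarAlgType R) (x y : A) : cstar (x - y) = cstar x - cstar y.
Proof. by rewrite cstarD cstarN. Qed.

Lemma cnorm_cstar_le (A : cstarAlgType R) (x : A) : cnorm x <= cnorm (cstar x).
Proof.
have [x0|x0] := leP (cnorm x) 0; first exact: le_trans x0 (cnorm_ge0 _).
by rewrite -(ler_pM2r x0) -expr2 -cnorm_cstar_cmul cnormM.
Qed.

Lemma cnorm_cstar (A : cstarAlgType R) (x : A) : cnorm (cstar x) = cnorm x.
Proof.
by apply/eqP; rewrite eq_le cnorm_cstar_le -{2}[x]cstarK cnorm_cstar_le.
Qed.

End CNorm.

Section GeometricConvergence.
Context {R : realType}.

Lemma geometric_small (K e : R) : 0 < e -> exists n, K * 2%:R^-1 ^+ n < e.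
Proof.
move=> e0; exists (Num.bound (K / e)).
rewrite exprVn ltr_pdivrMr ?exprn_gt0// mulrC -ltr_pdivrMr//.
exact: upper_nthrootP.
Qed.

Lemma geometric_cvg (V : completeNormedModType R[i]) (s : nat -> V) (K : R) :
  (forall n, cnorm (s n.+1 - s n) <= K * 2%:R^-1 ^+ n) ->
  exists l, forall n, cnorm (l - s n) <= K *+ 2 * 2%:R^-1 ^+ n.
Proof.
move=> sK.
have K0 : 0 <= K by rewrite (le_trans (cnorm_ge0 (s 1%N - s 0%N)))// (le_trans (sK _))// expr0 mulr1.
have dist n k : cnorm (s (n + k)%N - s n) <=
    K *+ 2 * 2%:R^-1 ^+ n - K *+ 2 * 2%:R^-1 ^+ (n + k).
  elim: k => [|k ih]; first by rewrite addn0 !subrr cnorm0.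
  rewrite addnS (le_trans (cnorm_triangle _ (s (n + k)%N) _))//.
  rewrite (le_trans (lerD (sK _) ih))// addrCA lerD2l exprS mulrA.
  by rewrite -[K *+ 2]mulr_natr mulfK ?pnatr_eq0// mulr_natr mulr2n mulrDl opprD addNKr.
have dist' n m : (n <= m)%N -> cnorm (s m - s n) <= K *+ 2 * 2%:R^-1 ^+ n.
  move=> /subnKC <-; rewrite (le_trans (dist _ _))// gerBl.
  by rewrite mulr_ge0 ?mulrn_wge0// exprn_ge0.
have cs : cvg (s @ \oo).
  apply: cauchy_cvg; apply: cauchy_exP => e e0.
  have [n nK] : exists n, K *+ 2 * 2%:R^-1 ^+ n < complex.Re e.
    by apply: geometric_small; move: e0; rewrite ltcE => /andP[].
  exists (s n); exists n => // m /= nm.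
  rewrite -ball_normE /= cnormE cnormB.
  rewrite -(RRe_real (gtr0_real e0)) ltcR.
  exact: le_lt_trans (dist' _ _ nm) nK.
exists (lim (s @ \oo)) => n; apply/ler_addgt0Pr => e e0.
have /cvgrPdist_lt/(_ e%:C) := cs.
rewrite ltcR => /(_ e0) [N _ Ns].
apply: (le_trans (cnorm_triangle _ (s (n + N)%N) _)).
rewrite addrC lerD ?dist' ?leq_addr//.
by have := Ns (n + N)%N (leq_addl _ _); rewrite /= cnormE ltcR => /ltW.
Qed.

End GeometricConvergence.

Section BoundedFamilies.
Context {R : realType} {I : Type} (A : I -> cstarAlgType R).

Record bounded_family := BoundedFamily {
  family_val :> forall i, A i ;
  family_bounded : exists M : R, forall i, cnorm (family_val i) <= M }.

Lemma bounded_familyP (a b : bounded_family) :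
  (forall i, a i = b i) -> a = b.
Proof.
case: a b => [a aM] [b bM] /= ab.
have {}ab : a = b by apply/functional_extensionality_dep.
by subst b; congr BoundedFamily; exact: Prop_irrelevance.
Qed.

HB.instance Definition _ := gen_eqMixin bounded_family.
HB.instance Definition _ := gen_choiceMixin bounded_family.

Implicit Types a b : bounded_family.

Fact bfam0_subproof : exists M : R, forall i, cnorm (0 : A i) <= M.
Proof. by exists 0 => i; rewrite cnorm0. Qed.
Definition bfam0 := BoundedFamily bfam0_subproof.

Fact bfamN_subproof a : exists M : R, forall i, cnorm (- a i) <= M.
Proof. by have [M aM] := family_bounded a; exists M => i; rewrite cnormN. Qed.
Definition bfamN a := BoundedFamily (bfamN_subproof a).

Fact bfamD_subproof a b : exists M : R, forall i, cnorm (a i + b i) <= M.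
Proof.
have [[M aM] [N bN]] := (family_bounded a, family_bounded b).
by exists (M + N) => i; rewrite (le_trans (cnormD _ _))// lerD.
Qed.
Definition bfamD a b := BoundedFamily (bfamD_subproof a b).

Fact bfamZ_subproof (l : R[i]) a : exists M : R, forall i, cnorm (l *: a i) <= M.
Proof.
have [M aM] := family_bounded a.
exists (cnorm l * M) => i; rewrite cnormZ.
by apply: ler_wpM2l; [exact: cnorm_ge0|exact: aM].
Qed.
Definition bfamZ l a := BoundedFamily (bfamZ_subproof l a).

Fact bfamM_subproof a b : exists M : R, forall i, cnorm (cmul (a i) (b i)) <= M.
Proof.
have [[M aM] [N bN]] := (family_bounded a, family_bounded b).
exists (M * N) => i; apply: (le_trans (cnormM _ _)).
by apply: ler_pM; rewrite ?cnorm_ge0 ?aM ?bN.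
Qed.
Definition bfamM a b := BoundedFamily (bfamM_subproof a b).

Fact bfamS_subproof a : exists M : R, forall i, cnorm (cstar (a i)) <= M.
Proof. by have [M aM] := family_bounded a; exists M => i; rewrite cnorm_cstar. Qed.
Definition bfamS a := BoundedFamily (bfamS_subproof a).

Fact bfamDA : associative bfamD.
Proof. by move=> a b c; apply: bounded_familyP => i /=; rewrite addrA. Qed.
Fact bfamDC : commutative bfamD.
Proof. by move=> a b; apply: bounded_familyP => i /=; rewrite addrC. Qed.
Fact bfam0D : left_id bfam0 bfamD.
Proof. by move=> a; apply: bounded_familyP => i /=; rewrite add0r. Qed.
Fact bfamND : left_inverse bfam0 bfamN bfamD.
Proof. by move=> a; apply: bounded_familyP => i /=; rewrite addNr. Qed.

HB.instance Definition _ :=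
  GRing.isZmodule.Build bounded_family bfamDA bfamDC bfam0D bfamND.

End BoundedFamilies.

Record ultrafilter (I : Type) := Ultrafilter {
  ultrafilter_set :> set_system I ;
  ultrafilterP : UltraFilter ultrafilter_set }.

#[global] Instance ultrafilter_ultra I (U : ultrafilter I) : UltraFilter U :=
  ultrafilterP U.
#[global] Instance ultrafilter_proper I (U : ultrafilter I) : ProperFilter U :=
  @ultra_proper _ _ (ultrafilterP U).

Section Ultraproduct.
Context {R : realType} {I : Type} (U : ultrafilter I) (A : I -> cstarAlgType R).
Implicit Types a b c : bounded_family A.

Definition null_family : {pred bounded_family A} :=
  fun a => `[< cnorm (a i) @[i --> ultrafilter_set U] --> (0 : R) >].

Lemma null_familyP a :
  reflect (cnorm (a i) @[i --> ultrafilter_set U] --> (0 : R)) (a \in null_family).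
Proof. exact: asboolP. Qed.

Fact null_family_zmod_closed : zmod_closed null_family.
Proof.
split=> [|a b /null_familyP a0 /null_familyP b0]; apply/null_familyP.
  under eq_fun do rewrite /= cnorm0.
  exact: cvg_cst.
apply: (@squeeze_cvgr _ _ _ _ (cst 0) (fun i => cnorm (a i) + cnorm (b i))).
- apply: nearW => i /=; rewrite cnorm_ge0/=.
  by rewrite (le_trans (cnormD _ _))// cnormN.
- exact: cvg_cst.
- by rewrite -[X in _ --> X](addr0 0); exact: cvgD.
Qed.

HB.instance Definition _ :=
  GRing.isZmodClosed.Build (bounded_family A) null_family
    null_family_zmod_closed.

Definition ultraproduct := Quotient.quot null_family.


HB.instance Definition _ := GRing.Zmodule.on ultraproduct.

Definition ultra_pi a : ultraproduct := (\pi_ultraproduct a)%qT.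
Local Notation upi := ultra_pi.

Lemma upi_eq a b : reflect (upi a = upi b) (a - b \in null_family).
Proof. by rewrite Quotient.idealrBE; exact: eqP. Qed.

Lemma upi_repr (x : ultraproduct) : upi (repr x) = x.
Proof. exact: reprK. Qed.

Lemma upi0 : upi 0 = 0.
Proof. by rewrite /ultra_pi !piE. Qed.
Lemma upiD a b : upi (a + b) = upi a + upi b.
Proof. by rewrite /ultra_pi !piE. Qed.
Lemma upiN a : upi (- a) = - upi a.
Proof. by rewrite /ultra_pi !piE. Qed.
Lemma upiB a b : upi (a - b) = upi a - upi b.
Proof. by rewrite upiD upiN. Qed.

Lemma null_family_le (K : R) a b : (forall i, cnorm (a i) <= K * cnorm (b i)) ->
  b \in null_family -> a \in null_family.
Proof.
move=> ab /null_familyP b0; apply/null_familyP.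
apply: (@squeeze_cvgr _ _ _ _ (cst 0) (fun i => K * cnorm (b i))).
- by apply: nearW => i /=; rewrite cnorm_ge0/=.
- exact: cvg_cst.
- by rewrite -[X in _ --> X](mulr0 K); apply: cvgM => //; exact: cvg_cst.
Qed.

Lemma bfam_normP a : exists2 M : R, 0 <= M & forall i, cnorm (a i) <= M.
Proof.
have [M aM] := family_bounded a; exists `|M| => // i.
exact: le_trans (aM i) (ler_norm _).
Qed.

Definition ultra_scale (l : R[i]) (x : ultraproduct) : ultraproduct :=
  upi (bfamZ l (repr x)).
Definition ultra_mul (x y : ultraproduct) : ultraproduct :=
  upi (bfamM (repr x) (repr y)).
Definition ultra_star (x : ultraproduct) : ultraproduct :=
  upi (bfamS (repr x)).

Lemma repr_upi a : repr (upi a) - a \in null_family.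
Proof. by apply/upi_eq; rewrite upi_repr. Qed.

Lemma upiZ l a : ultra_scale l (upi a) = upi (bfamZ l a).
Proof.
apply/upi_eq; apply: null_family_le (repr_upi a) => i /=.
by rewrite -scalerBr cnormZ.
Qed.

Lemma upiS a : ultra_star (upi a) = upi (bfamS a).
Proof.
apply/upi_eq; apply: (@null_family_le 1) (repr_upi a) => i /=.
by rewrite -cstarB cnorm_cstar mul1r.
Qed.

Fact upiMl a b c : upi a = upi b -> upi (bfamM a c) = upi (bfamM b c).
Proof.
move=> /upi_eq ab; apply/upi_eq.
have [M M0 cM] := bfam_normP c.
apply: (@null_family_le M) ab => i /=.
rewrite -[X in _ - X]/(cmul (b i) (c i)) -scaleN1r -cmulZl -cmulDl scaleN1r.
rewrite (le_trans (cnormM _ _))// mulrC; apply: ler_wpM2r => //.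
exact: cnorm_ge0.
Qed.

Fact upiMr a b c : upi a = upi b -> upi (bfamM c a) = upi (bfamM c b).
Proof.
move=> /upi_eq ab; apply/upi_eq.
have [M M0 cM] := bfam_normP c.
apply: (@null_family_le M) ab => i /=.
rewrite -[X in _ - X]/(cmul (c i) (b i)) -scaleN1r -cmulZr -cmulDr scaleN1r.
rewrite (le_trans (cnormM _ _))//; apply: ler_wpM2r => //.
exact: cnorm_ge0.
Qed.

Lemma upiM a b : ultra_mul (upi a) (upi b) = upi (bfamM a b).
Proof.
rewrite /ultra_mul (@upiMl _ a) ?upi_repr//.
by rewrite (@upiMr _ b) ?upi_repr.
Qed.

Definition unorm a : R := lim (cnorm (a i) @[i --> ultrafilter_set U]).

Lemma unorm_cvg a : cnorm (a i) @[i --> ultrafilter_set U] --> unorm a.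
Proof.
suff [p ap] : exists p : R, cnorm (a i) @[i --> ultrafilter_set U] --> p.
  by rewrite /unorm (cvg_lim _ ap).
have [M M0 aM] := bfam_normP a.
have /(_ (cnorm (a i) @[i --> ultrafilter_set U])) := @segment_compact R 0 M.
case=> [|p [_ clp]].
  by apply: nearW => i /=; rewrite in_itv/= cnorm_ge0 aM.
exists p => B pB.
have [//|UB] := in_ultra_setVsetC ((fun i => cnorm (a i)) @^-1` B)
  (ultrafilterP U).
by have [r [nBr Br]] := clp (~` B) B UB pB.
Qed.

Lemma unorm_unique a (l : R) :
  cnorm (a i) @[i --> ultrafilter_set U] --> l -> unorm a = l.
Proof. by move=> al; apply: cvg_lim. Qed.

Lemma unorm_le a (f : I -> R) (l : R) : (forall i, cnorm (a i) <= f i) ->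
  f @ ultrafilter_set U --> l -> unorm a <= l.
Proof.
move=> af fl; rewrite leNgt; apply/negP => la.
have [m lm ma] : exists2 m, l < m & m < unorm a.
  by exists ((l + unorm a) / 2%:R); rewrite midf_lt.
suff /filter_ex[i []] : \forall i \near ultrafilter_set U,
    f i < m /\ m < cnorm (a i).
  by move=> fim mai; have := lt_trans (le_lt_trans (af i) fim) mai; rewrite ltxx.
apply: filterI; first exact: (cvgr_lt _ fl).
exact: (cvgr_gt _ (@unorm_cvg a)).
Qed.

Lemma unorm_eq a b : upi a = upi b -> unorm a = unorm b.
Proof.
suff H c d : upi c = upi d -> unorm c <= unorm d.
  by move=> ab; apply/eqP; rewrite eq_le !H.
move=> /upi_eq/null_familyP cd.
apply: (@unorm_le _ (fun i => cnorm ((c - d) i) + cnorm (d i))) => [i|].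
  exact: cnorm_subl.
by rewrite -[X in _ --> X]add0r; apply: cvgD => //; exact: unorm_cvg.
Qed.

Lemma unorm0 a : unorm a = 0 -> a \in null_family.
Proof. by move=> a0; apply/null_familyP; rewrite -a0; exact: unorm_cvg. Qed.

Definition ultra_norm (x : ultraproduct) : R := unorm (repr x).

Lemma ultra_normE a : ultra_norm (upi a) = unorm a.
Proof. by apply: unorm_eq; rewrite upi_repr. Qed.

Lemma ultra_ind (P : ultraproduct -> Prop) : (forall a, P (upi a)) -> forall x, P x.
Proof. by move=> H x; rewrite -[x]upi_repr; exact: H. Qed.

Fact ultra_scaleA l m x : ultra_scale l (ultra_scale m x) = ultra_scale (l * m) x.
Proof.
elim/ultra_ind: x => a; rewrite !upiZ; congr upi.
by apply: bounded_familyP => i /=; rewrite scalerA.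
Qed.
Fact ultra_scale1 : left_id 1 ultra_scale.
Proof.
elim/ultra_ind => a; rewrite !upiZ; congr upi.
by apply: bounded_familyP => i /=; rewrite scale1r.
Qed.
Fact ultra_scaleDr : right_distributive ultra_scale +%R.
Proof.
move=> l; elim/ultra_ind => a; elim/ultra_ind => b.
rewrite -upiD !upiZ -upiD; congr upi.
by apply: bounded_familyP => i /=; rewrite scalerDr.
Qed.
Fact ultra_scaleDl x : {morph ultra_scale^~ x : l m / l + m}.
Proof.
elim/ultra_ind: x => a l m; rewrite !upiZ -upiD; congr upi.
by apply: bounded_familyP => i /=; rewrite scalerDl.
Qed.

HB.instance Definition _ := GRing.Zmodule_isLmodule.Build R[i] ultraproduct
  ultra_scaleA ultra_scale1 ultra_scaleDr ultra_scaleDl.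

Lemma upiZE (l : R[i]) a : upi (bfamZ l a) = l *: upi a.
Proof. by rewrite -upiZ. Qed.

Fact ultra_normD x y :
  (ultra_norm (x + y))%:C <= (ultra_norm x)%:C + (ultra_norm y)%:C.
Proof.
elim/ultra_ind: x => a; elim/ultra_ind: y => b.
rewrite -upiD !ultra_normE -rmorphD/= lecR.
apply: (@unorm_le _ (fun i => cnorm (a i) + cnorm (b i))) => [i|].
  exact: cnormD.
by apply: cvgD; exact: unorm_cvg.
Qed.

Fact ultra_normZ (l : R[i]) (x : ultraproduct) :
  (ultra_norm (l *: x))%:C = `|l| * (ultra_norm x)%:C.
Proof.
elim/ultra_ind: x => a; rewrite -upiZE !ultra_normE cnormE -rmorphM/=.
congr (_%:C); apply: unorm_unique => /=.
under eq_fun do rewrite cnormZ.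
by apply: cvgM; [exact: cvg_cst|exact: unorm_cvg].
Qed.

Fact ultra_norm0_eq0 (x : ultraproduct) : (ultra_norm x)%:C = 0 -> x = 0.
Proof.
elim/ultra_ind: x => a /complexI; rewrite ultra_normE => /unorm0 a0.
by rewrite -upi0; apply/upi_eq; rewrite subr0.
Qed.

HB.instance Definition _ := Lmodule_isNormed.Build R[i] ultraproduct
  ultra_normD ultra_normZ ultra_norm0_eq0.

Lemma cnorm_upi a : cnorm (upi a : ultraproduct) = unorm a.
Proof. by rewrite -ultra_normE. Qed.

Lemma ultra_lift (x : ultraproduct) (M : R) : cnorm x < M ->
  exists2 a, upi a = x & forall i, cnorm (a i) <= M.
Proof.
elim/ultra_ind: x => a; rewrite cnorm_upi => aM.
have M0 : 0 <= M by rewrite (le_trans _ (ltW aM))// -cnorm_upi cnorm_ge0.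
pose f i : A i := if cnorm (a i) <= M then a i else 0.
have fM i : cnorm (f i) <= M by rewrite /f; case: ifP => //; rewrite cnorm0.
have bf : exists N : R, forall i, cnorm (f i) <= N by exists M.
exists (BoundedFamily bf) => //; apply/upi_eq/null_familyP.
apply: cvg_near_cst.
have : \forall i \near ultrafilter_set U, cnorm (a i) < M.
  exact: (cvgr_lt _ (@unorm_cvg a)).
by apply: filterS => i /ltW aiM /=; rewrite /f aiM subrr cnorm0.
Qed.

Lemma ultra_cauchy_cvg (F : set_system ultraproduct) :
  ProperFilter F -> cauchy F -> cvg F.
Proof.
move=> FF /cauchyP Fc.
have half_gt0 n : 0 < (2%:R^-1 ^+ n)%:C :> R[i] by rewrite ltcR exprn_gt0.
have /choice[x xF] n := Fc _ (half_gt0 n).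
have xx n : cnorm (x n.+1 - x n) < 2%:R * 2%:R^-1 ^+ n.
  have /filter_ex[y []] : F (ball (x n.+1) (2%:R^-1 ^+ n.+1)%:C `&`
     ball (x n) (2%:R^-1 ^+ n)%:C) by apply: filterI.
  rewrite -ball_normE /= !cnormE !ltcR => y1; rewrite cnormB => y2.
  rewrite (le_lt_trans (cnorm_triangle _ y _))//.
  rewrite mulr_natl mulr2n ltrD//; apply: lt_le_trans y1 _.
  by rewrite exprS ger_pMl ?exprn_gt0// invf_le1 ?ler1n.
have /choice[d dP] n : exists d : bounded_family A, upi d = x n.+1 - x n /\
    forall i, cnorm (d i) <= 2%:R * 2%:R^-1 ^+ n.
  by have [d] := ultra_lift (xx n); exists d.
pose s := fix s n : bounded_family A :=
  if n is m.+1 then s m + d m else repr (x 0%N).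
have sx n : upi (s n) = x n.
  elim: n => [|n ih] /=; first exact: upi_repr.
  by rewrite upiD ih (dP n).1 addrC subrK.
have lP i : {l : A i | forall n, cnorm (l - s n i) <= 2%:R *+ 2 * 2%:R^-1 ^+ n}.
  apply: cid; apply: (@geometric_cvg _ _ (fun n => s n i)) => n /=.
  by rewrite addrAC subrr add0r (dP n).2.
have [M M0 sM] := bfam_normP (s 0%N).
have lb : exists M : R, forall i, cnorm (sval (lP i)) <= M.
  exists (2%:R *+ 2 + M) => i; rewrite (le_trans (cnorm_subl _ (s 0%N i)))//.
  by rewrite lerD// (le_trans (svalP (lP i) 0%N))// expr0 mulr1.
pose L := BoundedFamily lb.
have Lx n : cnorm (upi L - x n) <= 2%:R *+ 2 * 2%:R^-1 ^+ n.
  rewrite -sx -upiB cnorm_upi.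
  apply: (@unorm_le _ (cst (2%:R *+ 2 * 2%:R^-1 ^+ n))).
    by move=> i; exact: (svalP (lP i) n).
  exact: cvg_cst.
apply/cvg_ex; exists (upi L : ultraproduct); apply/fcvgrPdist_lt => e e0.
have [n nK] : exists n, (2%:R *+ 2 + 1) * 2%:R^-1 ^+ n < complex.Re e.
  by apply: geometric_small; move: e0; rewrite ltcE => /andP[].
apply: filterS (xF n) => y; rewrite -ball_normE /= !cnormE ltcR => xy.
rewrite -(RRe_real (gtr0_real e0)) ltcR (le_lt_trans (cnorm_triangle _ (x n) _))//.
by apply: le_lt_trans nK; rewrite mulrDl mul1r lerD// ltW.
Qed.

HB.instance Definition _ :=
  Uniform_isComplete.Build ultraproduct ultra_cauchy_cvg.


Implicit Types x y z : ultraproduct.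

Fact ultra_mulA : associative ultra_mul.
Proof.
elim/ultra_ind => a; elim/ultra_ind => b; elim/ultra_ind => c.
rewrite !upiM; congr upi; apply: bounded_familyP => i /=; exact: cmulA.
Qed.
Fact ultra_mulDl : left_distributive ultra_mul +%R.
Proof.
elim/ultra_ind => a; elim/ultra_ind => b; elim/ultra_ind => c.
rewrite -upiD !upiM -upiD; congr upi.
by apply: bounded_familyP => i /=; exact: cmulDl.
Qed.
Fact ultra_mulDr : right_distributive ultra_mul +%R.
Proof.
elim/ultra_ind => a; elim/ultra_ind => b; elim/ultra_ind => c.
rewrite -upiD !upiM -upiD; congr upi.
by apply: bounded_familyP => i /=; exact: cmulDr.
Qed.
Fact ultra_mulZl (l : R[i]) x y : ultra_mul (l *: x) y = l *: ultra_mul x y.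
Proof.
elim/ultra_ind: x => a; elim/ultra_ind: y => b.
rewrite -upiZE !upiM -upiZE; congr upi.
by apply: bounded_familyP => i /=; exact: cmulZl.
Qed.
Fact ultra_mulZr (l : R[i]) x y : ultra_mul x (l *: y) = l *: ultra_mul x y.
Proof.
elim/ultra_ind: x => a; elim/ultra_ind: y => b.
rewrite -upiZE !upiM -upiZE; congr upi.
by apply: bounded_familyP => i /=; exact: cmulZr.
Qed.
Fact ultra_starK : involutive ultra_star.
Proof.
elim/ultra_ind => a; rewrite !upiS; congr upi.
by apply: bounded_familyP => i /=; exact: cstarK.
Qed.
Fact ultra_starD : {morph ultra_star : x y / x + y}.
Proof.
elim/ultra_ind => a; elim/ultra_ind => b; rewrite -upiD !upiS -upiD; congr upi.
by apply: bounded_familyP => i /=; exact: cstarD.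
Qed.
Fact ultra_starZ (l : R[i]) x : ultra_star (l *: x) = l^* *: ultra_star x.
Proof.
elim/ultra_ind: x => a; rewrite -upiZE !upiS -upiZE; congr upi.
by apply: bounded_familyP => i /=; exact: cstarZ.
Qed.
Fact ultra_starM x y :
  ultra_star (ultra_mul x y) = ultra_mul (ultra_star y) (ultra_star x).
Proof.
elim/ultra_ind: x => a; elim/ultra_ind: y => b.
rewrite !(upiM, upiS); congr upi.
by apply: bounded_familyP => i /=; exact: cstarM.
Qed.
Fact ultra_normM x y : `|ultra_mul x y| <= `|x| * `|y|.
Proof.
elim/ultra_ind: x => a; elim/ultra_ind: y => b.
rewrite upiM !cnormE -rmorphM/= lecR !cnorm_upi.
apply: (@unorm_le _ (fun i => cnorm (a i) * cnorm (b i))) => [i|].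
  exact: cnormM.
by apply: cvgM; exact: unorm_cvg.
Qed.
Fact ultra_cstar_norm x : `|ultra_mul (ultra_star x) x| = `|x| ^+ 2.
Proof.
elim/ultra_ind: x => a.
rewrite upiS upiM !cnormE -rmorphXn/= !cnorm_upi; congr (_%:C).
apply: unorm_unique => /=; under eq_fun do rewrite cnorm_cstar_cmul expr2.
by rewrite expr2; apply: cvgM; exact: unorm_cvg.
Qed.

HB.instance Definition _ :=
  CompleteNormedModule_isCStarAlgebra.Build R ultraproduct
    ultra_mulA ultra_mulDl ultra_mulDr ultra_mulZl ultra_mulZr
    ultra_starK ultra_starD ultra_starZ ultra_starM ultra_normM
    ultra_cstar_norm.

End Ultraproduct.

Section CStarNotions.
Context {R : realType} (A : cstarAlgType R).
Implicit Types a e p q x y : A.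

Definition nonzero_algebra : Prop := exists a, a != 0.

Definition finite_dimensional : Prop :=
  exists (n : nat) (b : 'I_n -> A),
    forall x, exists c : 'I_n -> R[i], x = \sum_(i < n) c i *: b i.

Definition unit_ball : set A := [set x | cnorm x <= 1].

Definition is_unit e : Prop := forall x, cmul e x = x /\ cmul x e = x.

Definition unital : Prop := exists e, is_unit e.

Definition self_adjoint a : Prop := cstar a = a.

(* Multiplication of the unitization A (+) C, with unit (0, 1). *)
Definition unitization_mul (u v : A * R[i]) : A * R[i] :=
  (cmul u.1 v.1 + v.2 *: u.1 + u.2 *: v.1, u.2 * v.2).

(* The spectrum is computed in A if A is unital, in the unitization of A
   otherwise. *)
Definition spectrum a : set R[i] :=
  [set l | (exists2 e, is_unit e &
              ~ exists b, cmul (a - l *: e) b = e /\ cmul b (a - l *: e) = e)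
        \/ (~ unital /\
              ~ exists u, unitization_mul (a, - l) u = (0, 1) /\
                          unitization_mul u (a, - l) = (0, 1))].

Definition real_rank_zero : Prop :=
  [set a | self_adjoint a] `<=`
    closure [set a | self_adjoint a /\ finite_set (spectrum a)].

Definition is_projection p : Prop := cstar p = p /\ cmul p p = p.

Definition subprojection q p : Prop :=
  [/\ is_projection q, cmul p q = q & cmul q p = q].

Definition minimal_projection p : Prop :=
  [/\ is_projection p, p != 0 &
      forall q, subprojection q p -> q = 0 \/ q = p].

Definition scalar_corner p : Prop :=
  [set cmul (cmul p y) p | y in [set: A]] = [set l *: p | l in [set: R[i]]].

Definition normed_by_minimal_projections : Prop :=
  forall x (eps : R), 0 < eps ->
    exists p, [/\ minimal_projection p, scalar_corner p &
                  `| cnorm x - cnorm (cmul x p) | < eps].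

(* The suprema and infima below are those of [reals]: each set is nonempty and
   bounded, so no default value intervenes. *)
Definition axiom_commutative : Prop :=
  sup [set cnorm (cmul x y - cmul y x) | x in unit_ball & y in unit_ball] = 0.

Definition axiom_unital : Prop :=
  inf [set sup [set cnorm (cmul e x - x) | x in unit_ball]
      | e in unit_ball] = 0.

Definition axiom_normed_by_minimal_projections : Prop :=
  sup [set
    inf [set
      sup [set
        inf [set cnorm (cmul (cmul p y) p - l *: p)
                 + `| cnorm x - cnorm (cmul x p) |
            | l in [set l : R[i] | cnorm l <= 1]]
      | y in unit_ball]
    | p in [set p | is_projection p]]
  | x in unit_ball] = 0.

End CStarNotions.

Section ContinuousLogic.
Context {R : realType}.

(* Expressions for the *-polynomials without constant term in n variables:
   the algebras need not be unital, so the language has no constant for the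
   identity. *)
Inductive star_poly (n : nat) : Type :=
| PVar of 'I_n
| PZero
| PAdd of star_poly n & star_poly n
| PMul of star_poly n & star_poly n
| PScale of R[i] & star_poly n
| PStar of star_poly n.

(* Formulae with free variables among n given ones; under a quantifier the
   bound variable has index ord0, and the others are shifted by one. *)
Inductive formula (n : nat) : Type :=
| FNorm of star_poly n
| FConn (m : nat) (f : 'rV[R]_m -> R) of continuous f & ('I_m -> formula n)
| FSup of formula n.+1
| FInf of formula n.+1.

Definition sentence : Type := formula 0.

Fixpoint star_poly_eval (A : cstarAlgType R) n (P : star_poly n)
    (v : 'I_n -> A) : A :=
  match P with
  | PVar i => v i
  | PZero => 0
  | PAdd P Q => star_poly_eval P v + star_poly_eval Q v
  | PMul P Q => cmul (star_poly_eval P v) (star_poly_eval Q v)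
  | PScale l P => l *: star_poly_eval P v
  | PStar P => cstar (star_poly_eval P v)
  end.

Definition env_cons (T : Type) n (x : T) (v : 'I_n -> T) : 'I_n.+1 -> T :=
  fun i => if unlift ord0 i is Some j then v j else x.

Fixpoint formula_eval (A : cstarAlgType R) n (phi : formula n)
    (v : 'I_n -> A) : R :=
  match phi with
  | FNorm P => cnorm (star_poly_eval P v)
  | FConn m f _ psi => f (\row_(i < m) formula_eval (psi i) v)
  | FSup psi => sup [set formula_eval psi (env_cons x v) | x in @unit_ball R A]
  | FInf psi => inf [set formula_eval psi (env_cons x v) | x in @unit_ball R A]
  end.

Definition sentence_value (A : cstarAlgType R) (phi : sentence) : R :=
  formula_eval phi (fun _ : 'I_0 => (0 : A)).

Definition elementarily_equivalent (A B : cstarAlgType R) : Prop :=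
  forall phi : sentence, sentence_value A phi = sentence_value B phi.

Definition pseudocompact (A : cstarAlgType R) : Prop :=
  exists (I : Type) (U : ultrafilter I) (F : I -> cstarAlgType R),
    (forall i, nonzero_algebra (F i) /\ finite_dimensional (F i)) /\
    elementarily_equivalent A (ultraproduct U F).

Definition axiomatizes_real_rank_zero (phi : sentence) : Prop :=
  forall A : cstarAlgType R, sentence_value A phi = 0 <-> real_rank_zero A.

End ContinuousLogic.

Arguments sentence : clear implicits.

(* Main.v *)
Require Import Defs.
From HB Require Import structures.
From mathcomp Require Import all_boot all_order all_algebra.
From mathcomp Require Import all_classical all_reals all_analysis.
From mathcomp Require Import complex.
From mathcomp Require Import ring lra.
Set Implicit Arguments.
Unset Strict Implicit.
Unset Printing Implicit Defensive.
Import Order.TTheory GRing.Theory Num.Theory.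
Import numFieldNormedType.Exports.
Local Open Scope classical_set_scope.
Local Open Scope complex_scope.
Local Open Scope ring_scope.

(** A commutative unital C*-algebra of real rank zero is, up to small errors, the
span of its projections, so that everything first-order about it is carried by
its Boolean algebra of projections.  If every element is approximately normed by
a minimal projection, every nonzero projection has a minimal one below it
([atomic_of_normed]): the Boolean algebra is atomic.  Atomic Boolean algebras are
pseudofinite, and the algebras with finite Boolean algebra of projections are
the C^n, which is where pseudocompactness comes from.

From the axioms to pseudocompactness.  Call two projections N-similar if they
dominate the same number of minimal projections, numbers being compared up to N
only.  [game_elimination] is a back-and-forth argument, by induction on formulae:
for each formula and error there is N such that the value of the formula at
combinations of the members of a partition of unity is determined, up to the
error, by the coefficients and the N-similarity classes of the members.  Moving
one quantifier inside amounts to choosing a new element; up to a small error it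
takes its values in a fixed finite net of the unit disc ([net_approximation]),
so that it only refines each member of the partition into a fixed number of
pieces, and such refinements can be copied on the other side
([similar_family]).  For a sentence this leaves the unit alone: the algebra A
agrees, up to the error, with any C^n whose unit is N-similar to that of A.
Choosing such an n for each N and passing to an ultraproduct over N gives an
ultraproduct of the C^n elementarily equivalent to A
([atomic_model_pseudocompact]), by the theorem of Los ([los]).

From pseudocompactness to the axioms.  If the commutative algebra A is
elementarily equivalent to an ultraproduct of finite-dimensional algebras, almost
all of these have small commutators.  A square-zero element y of norm one has
||[y^*, y]|| >= 1, and a projection p together with an element x not commuting with p
produces such a y, namely px(1 - p) or (1 - p)xp, normalized; hence almost all factors are
commutative, and thus spanned by orthogonal projections
([finite_dimensional_commutative_diagonal]).  In such algebras three explicit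
sentences have value at most 0, hence also in A ([pseudocompact_transfer]).  They
say that there is a unit, that self-adjoint elements can be halved with the help
of two projections ([rr_sentence]), and that elements are normed by projections
which behave as minimal ones ([atom_sentence]).  In A they give approximate
projections, which are close to true ones by Newton's method
([projection_near_almost_idempotent]).

The link between real rank zero and projections rests on an elementary fact: a
self-adjoint h of norm one in a commutative unital algebra has 1 or -1 in its
spectrum ([self_adjoint_sphere_not_invertible]).  It replaces the spectral radius
formula, and shows that a self-adjoint element of finite spectrum is annihilated
by a polynomial, hence is a combination of projections. *)

(** * Norms, adjoints and projections *)

Section Norms.
Context {R : realType}.

Lemma cnorm_eq0 (V : normedZmodType R[i]) (x : V) : cnorm x = 0 -> x = 0.
Proof. by move=> x0; apply/eqP; rewrite -normr_eq0 cnormE x0. Qed.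

Lemma cnorm_gt0 (V : normedZmodType R[i]) (x : V) : (0 < cnorm x) = (x != 0).
Proof. by rewrite -ltcR -cnormE normr_gt0. Qed.

Lemma cnorm_real (r : R) : cnorm (r%:C : R[i]) = `|r|.
Proof. by rewrite /cnorm normc_def /= expr0n/= addr0 sqrtr_sqr. Qed.

Lemma cnormMC (x y : R[i]) : cnorm (x * y) = cnorm x * cnorm y.
Proof. by apply: complexI; rewrite rmorphM/= -!cnormE normrM. Qed.

Lemma cnorm_sum (V : normedZmodType R[i]) (I : Type) (s : seq I) (P : pred I) (f : I -> V) :
  cnorm (\sum_(i <- s | P i) f i) <= \sum_(i <- s | P i) cnorm (f i).
Proof.
elim/big_ind2: _ => [|x a y b xa yb|//]; first by rewrite cnorm0.
exact: le_trans (cnormD _ _) (lerD xa yb).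
Qed.

Section CStar.
Variable A : cstarAlgType R.
Implicit Types x y : A.

Lemma cmulBl x y z : cmul (x - y) z = cmul x z - cmul y z :> A.
Proof. by rewrite cmulDl -[in LHS]scaleN1r cmulZl scaleN1r. Qed.

Lemma cmulBr x y z : cmul z (x - y) = cmul z x - cmul z y :> A.
Proof. by rewrite cmulDr -[in LHS]scaleN1r cmulZr scaleN1r. Qed.

Lemma cmul_suml (I : Type) (s : seq I) (P : pred I) (f : I -> A) x :
  cmul (\sum_(i <- s | P i) f i) x = \sum_(i <- s | P i) cmul (f i) x.
Proof. by elim/big_rec2: _ => [|i u v _ <-]; rewrite ?cmul0x ?cmulDl. Qed.

Lemma cmul_sumr (I : Type) (s : seq I) (P : pred I) (f : I -> A) x :
  cmul x (\sum_(i <- s | P i) f i) = \sum_(i <- s | P i) cmul x (f i).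
Proof. by elim/big_rec2: _ => [|i u v _ <-]; rewrite ?cmulx0 ?cmulDr. Qed.

Lemma cstar_sum (I : Type) (s : seq I) (P : pred I) (f : I -> A) :
  cstar (\sum_(i <- s | P i) f i) = \sum_(i <- s | P i) cstar (f i).
Proof. by elim/big_rec2: _ => [|i u v _ <-]; rewrite ?cstar0 ?cstarD. Qed.

Lemma cnorm_self_adjoint_sqr x : cstar x = x -> cnorm (cmul x x) = cnorm x ^+ 2.
Proof. by move=> xs; rewrite -cnorm_cstar_cmul xs. Qed.

Lemma cnorm_normal_sqr x :
  cmul (cstar x) x = cmul x (cstar x) -> cnorm (cmul x x) = cnorm x ^+ 2.
Proof.
move=> xn; apply: (@pexpIrn R 2); rewrite ?nnegrE ?cnorm_ge0 ?exprn_ge0 ?cnorm_ge0//.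
rewrite -(cnorm_cstar_cmul (cmul x x)) -[in RHS]cnorm_cstar_cmul cstarM.
rewrite -cnorm_self_adjoint_sqr; last by rewrite cstarM cstarK.
by congr cnorm; rewrite -!cmulA; congr cmul; rewrite !cmulA xn.
Qed.

Lemma cnorm_projection (p : A) : is_projection p -> p != 0 -> cnorm p = 1.
Proof.
move=> [ps pp] p0; have := cnorm_self_adjoint_sqr ps; rewrite pp => /eqP.
rewrite expr2 -subr_eq0 -{1}[cnorm p]mul1r -mulrBl mulf_eq0 subr_eq0 eq_sym => /orP[/eqP//|].
by move=> /eqP/cnorm_eq0 pz; rewrite pz eqxx in p0.
Qed.

Lemma cnorm_projection_le1 (p : A) : is_projection p -> cnorm p <= 1.
Proof.
move=> pp; have [->|/(cnorm_projection pp) ->//] := eqVneq p 0.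
by rewrite cnorm0.
Qed.

End CStar.
End Norms.

(** * Commutative unital algebras as rings *)

Section CommutativeUnital.
Context {R : realType}.

Record comm_unital (A : cstarAlgType R) := CommUnital {
  cu_one : A;
  cu_is_unit : is_unit cu_one;
  cu_comm : commutative (@cmul R A);
  cu_neq0 : cu_one != 0 }.

(** Copy of the algebra carrying the ring and algebra structures, which exist only
when a unit and commutativity are given; the tactic ring and the evaluation of
polynomials then apply. *)
Definition cring (A : cstarAlgType R) (H : comm_unital A) : Type := A.

Section Ring.
Context (A : cstarAlgType R) (H : comm_unital A).
HB.instance Definition _ := CStarAlgebra.on (cring H).
Fact cring_mul1 : left_id (cu_one H) (@cmul R A).
Proof. by move=> x; exact: (cu_is_unit H x).1. Qed.
HB.instance Definition _ := GRing.Zmodule_isComNzRing.Build (cring H)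
  (@cmulA R A) (cu_comm H) cring_mul1 (@cmulDl R A) (cu_neq0 H).
Fact cring_scaleAl (l : R[i]) (x y : cring H) : l *: (x * y) = (l *: x) * y.
Proof. by rewrite -[RHS]/(cmul (l *: (x : A)) y) cmulZl. Qed.
HB.instance Definition _ := GRing.Lmodule_isLalgebra.Build R[i] (cring H) cring_scaleAl.
Fact cring_scaleAr (l : R[i]) (x y : cring H) : l *: (x * y) = x * (l *: y).
Proof. by rewrite -[RHS]/(cmul (x : A) (l *: (y : A))) cmulZr. Qed.
HB.instance Definition _ := GRing.Lalgebra_isAlgebra.Build R[i] (cring H) cring_scaleAr.

Implicit Types x y h k : cring H.

Lemma cringE x y : cmul (x : A) y = x * y.
Proof. by []. Qed.

Lemma cring_normM x y : cnorm (x * y) <= cnorm x * cnorm y.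
Proof. exact: (@cnormM _ A). Qed.

Lemma cring_starM x y : cstar (x * y) = cstar x * cstar y :> cring H.
Proof. by rewrite mulrC; exact: (@cstarM _ A). Qed.

Lemma cring_star1 : cstar (1 : cring H) = 1.
Proof.
have E : cstar (cstar (1 : cring H) * 1 : cring H) = cstar (1 : cring H) * 1 by rewrite cring_starM cstarK mulrC.
by rewrite !mulr1 cstarK in E.
Qed.

Lemma cring_norm_sqr x : cnorm (x ^+ 2) = cnorm x ^+ 2.
Proof.
rewrite [x ^+ 2]expr2 -cringE; apply: cnorm_normal_sqr; exact: (cu_comm H).
Qed.

Lemma cring_norm1 : cnorm (1 : cring H) = 1.
Proof.
by apply: (@cnorm_projection _ A); [split; [exact: cring_star1|exact: (mulr1 (1 : cring H))]|exact: (cu_neq0 H)].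
Qed.

Lemma cring_normX x n : cnorm x <= 1 -> cnorm (x ^+ n) <= 1.
Proof.
move=> x1; elim: n => [|n ih]; first by rewrite expr0 cring_norm1.
rewrite exprS (le_trans (cring_normM _ _))//.
by rewrite -[leRHS](mulr1 1) ler_pM// cnorm_ge0.
Qed.

Lemma cu_one_projection : is_projection (cu_one H).
Proof. by split; [exact: cring_star1|exact: (mulr1 (1 : cring H))]. Qed.

Lemma cring_norm_natM n x : cnorm (n%:R * x) = n%:R * cnorm x.
Proof.
have -> : (n%:R : cring H) * x = (n%:R : R)%:C *: x by rewrite rmorph_nat scaler_nat mulr_natl.
by rewrite cnormZ cnorm_real ger0_norm.
Qed.

(** A substitute for positivity: h^2 + k^2 is u^* u for u = h + ik, and h is the real
part of u, so that ||h|| <= ||u||. *)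
Lemma cnorm_sum_squares h k : cstar h = h -> cstar k = k ->
  cnorm h ^+ 2 <= cnorm (h ^+ 2 + k ^+ 2).
Proof.
move=> hs ks; pose J : cring H := ('i%C : R[i])%:A.
have J2 : J ^+ 2 = -1.
  by rewrite /J expr2 -scalerAl mul1r scalerA -expr2 sqr_i scaleN1r.
have Js : cstar J = - J.
  rewrite /J cstarZ cring_star1 -scaleNr; congr (_ *: _).
  by apply/eqP; rewrite eq_complex /= oppr0 !eqxx.
pose u := h + J * k.
have us : cstar u = h - J * k by rewrite /u cstarD cring_starM Js hs ks mulNr.
have -> : h ^+ 2 + k ^+ 2 = cstar u * u.
  rewrite us /u (_ : _ * _ = h ^+ 2 - J ^+ 2 * k ^+ 2); last by ring.
  by rewrite J2; ring.
rewrite (@cnorm_cstar_cmul _ A) ler_pXn2r ?nnegrE ?cnorm_ge0//.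
have hE : h *+ 2 = u + cstar u by rewrite us /u; ring.
have := cnormD u (cstar u); rewrite -hE cnorm_cstar -mulr_natl -mulr2n.
rewrite -(mulr_natl (cnorm u)).
have -> : (2%:R : cring H) * h = (2%:R : R)%:C *: h by rewrite rmorph_nat scaler_nat mulr_natl.
by rewrite cnormZ cnorm_real ger0_norm// ler_pM2l.
Qed.

End Ring.
End CommutativeUnital.

(** * A spectral point of maximal modulus *)

Section NonInvertible.
Context {R : realType} (A : cstarAlgType R) (H : comm_unital A).
Implicit Types h g : cring H.

Lemma self_adjointX h n : cstar h = h -> cstar (h ^+ n) = h ^+ n.
Proof.
move=> hs; elim: n => [|n ih]; first by rewrite expr0 cring_star1.
by rewrite exprS cring_starM hs ih.
Qed.

(** Put c = h^2 and s_n = 1 + c + ... + c^(n-1), so that (1 - c) s_n = 1 - c^n is bounded.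
If 1 - c were invertible, s_n would be bounded too.  But s_n has norm at least n
for n a power of 2: writing s_2n = s_n (1 + c^n) and
(1 + c^n)^2 = (1 - c^n)^2 + (2 h^n)^2, the bound on sums of squares gives
||s_2n h^m|| >= 2 ||s_n h^(m+n)||, starting from ||h^m|| = 1. *)
Lemma self_adjoint_sphere_not_invertible h g :
  cstar h = h -> cnorm h = 1 -> g * (1 - h ^+ 2) != 1.
Proof.
move=> hs h1; apply/eqP => gh.
have hX n : cnorm (h ^+ n) = 1.
  have h2 k : cnorm (h ^+ (2 ^ k)) = 1.
    elim: k => [|k ih]; first by rewrite expr1.
    by rewrite expnS mulnC exprM cring_norm_sqr ih expr1n.
  apply/le_anti; rewrite cring_normX ?h1//=.
  have [k nk] : exists k, (n <= 2 ^ k)%N by exists n; exact/ltnW/ltn_expl.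
  rewrite -(h2 k) -(subnK nk) exprD (le_trans (cring_normM _ _))//.
  by rewrite -[leRHS]mul1r ler_wpM2r ?cnorm_ge0// cring_normX ?h1.
(* t k is the geometric sum of the powers of h^2 below 2^k. *)
pose t := fix t k : cring H := if k is m.+1 then t m * (1 + (h ^+ 2) ^+ (2 ^ m)) else 1.
have ts k : cstar (t k) = t k.
  elim: k => [|k ih] /=; first exact: cring_star1.
  by rewrite cring_starM ih cstarD cring_star1 -exprM self_adjointX.
have tE k : (1 - h ^+ 2) * t k = 1 - (h ^+ 2) ^+ (2 ^ k).
  elim: k => [|k ih] /=; first by rewrite mulr1 expr1.
  by rewrite mulrA ih expnS mulnC exprM; ring.
have tn k m : (2 ^ k)%:R <= cnorm (t k * h ^+ m).
  elim: k m => [|k ih] m /=; first by rewrite mul1r hX.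
  set b := h ^+ (2 ^ k); set a := t k * h ^+ m.
  have -> : t k * (1 + (h ^+ 2) ^+ (2 ^ k)) * h ^+ m = a * (1 + b ^+ 2).
    by rewrite /a /b -!exprM mulnC; ring.
  have as_ : cstar a = a by rewrite /a cring_starM ts self_adjointX.
  have bs : cstar b = b by rewrite /b self_adjointX.
  rewrite -(@ler_pXn2r _ 2) ?nnegrE ?cnorm_ge0// -cring_norm_sqr.
  rewrite (_ : (a * (1 + b ^+ 2)) ^+ 2 = (2%:R * (a * b)) ^+ 2 + (a * (1 - b ^+ 2)) ^+ 2); last by ring.
  apply: le_trans (@cnorm_sum_squares _ _ H _ _ _ _).
  - rewrite ler_pXn2r ?nnegrE ?cnorm_ge0// cring_norm_natM expnS natrM ler_pM2l//.
    by rewrite /a /b -mulrA -exprD ih.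
  - by rewrite mulr_natl mulr2n cstarD cring_starM as_ bs.
  - by rewrite cring_starM as_ cstarB cring_star1 expr2 cring_starM bs.
have tg k : cnorm (t k) <= 2%:R * cnorm g.
  have -> : t k = g * (1 - (h ^+ 2) ^+ (2 ^ k)) by rewrite -tE mulrA gh mul1r.
  rewrite (le_trans (cring_normM _ _))// mulrC ler_wpM2r ?cnorm_ge0//.
  rewrite (le_trans (cnormD _ _))// cnormN cring_norm1 -exprM hX.
  by rewrite -mulr2n.
have := upper_nthrootP (leqnn (Num.bound (2%:R * cnorm g))).
set k := Num.bound _; have := le_trans (tn k 0%N) _; rewrite expr0 mulr1 => /(_ _ (tg k)).
by rewrite natrX => /le_lt_trans/[apply]; rewrite ltxx.
Qed.

Lemma self_adjoint_spectral_radius h g :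
  cstar h = h -> h != 0 -> g * (((cnorm h) ^+ 2)%:C%:A - h ^+ 2) != 1.
Proof.
move=> hs h0; have n0 : 0 < cnorm h by rewrite cnorm_gt0.
set r := (cnorm h)%:C; have r0 : r != 0.
  by apply/eqP => /complexI e; rewrite e ltxx in n0.
pose k : cring H := r^-1 *: h.
have hk : h = r *: k by rewrite /k scalerA divff// scale1r.
have ks : cstar k = k by rewrite /k cstarZ hs fmorphV; congr (_^-1 *: _); exact: conjc_real.
move: k hk ks => k hk ks.
have k1 : cnorm k = 1.
  apply: (mulfI (lt0r_neq0 n0)); rewrite mulr1 -[RHS]/(cnorm (h : A)) -[in RHS]/(h : cring H).
  by rewrite [in RHS]hk cnormZ cnorm_real ger0_norm ?cnorm_ge0.
apply: contra (self_adjoint_sphere_not_invertible (r ^+ 2 *: g) ks k1) => gh.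
have h2 : h ^+ 2 = r ^+ 2 *: k ^+ 2 by rewrite {1}hk exprZn.
rewrite -scalerAl scalerAr scalerBr -h2 -[r ^+ 2](rmorphXn (real_complex R)) //.
Qed.
End NonInvertible.

(** * Polynomials in a self-adjoint element *)

Lemma ler_expn2 (n : nat) : (n <= 2 ^ n - 1)%N.
Proof. by rewrite leq_subRL ?expn_gt0// add1n ltn_expl. Qed.

Lemma cstar_cmul_eq0 (R : realType) (A : cstarAlgType R) (x : A) :
  cmul (cstar x) x = 0 -> x = 0.
Proof.
move=> xx; apply: cnorm_eq0; apply/eqP.
by rewrite -sqrf_eq0 -cnorm_cstar_cmul xx cnorm0.
Qed.

(** With q = p^* p one finds (p - q)^* (p - q) = 0, by commuting p with its adjoint. *)
Lemma normal_idempotent_projection (R : realType) (A : cstarAlgType R) (p : A) :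
  cmul p p = p -> cmul (cstar p) p = cmul p (cstar p) -> is_projection p.
Proof.
move=> pp pn; set q := cmul (cstar p) p.
have ss : cmul (cstar p) (cstar p) = cstar p by rewrite -cstarM pp.
have qs : cstar q = q by rewrite /q cstarM cstarK.
have sq : cmul (cstar p) q = q by rewrite /q cmulA ss.
have qp : cmul q p = q by rewrite /q -cmulA pp.
have qq : cmul q q = q by rewrite {1}/q pn -cmulA sq /q cmulA -pn -cmulA pp.
have pq : p = q.
  apply/eqP; rewrite -subr_eq0; apply/eqP/cstar_cmul_eq0.
  by rewrite cstarB qs cmulBl !cmulBr -/q sq qp qq !subrr.
by split=> //; rewrite pq.
Qed.

Section PolynomialCalculus.
Context {R : realType} (A : cstarAlgType R) (a : A).
Implicit Types p q g : {poly R[i]}.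

(** The value at a of the polynomial 'X * q: without constant term, it makes sense
although the algebra need not be unital. *)
Definition poly_ev q : A := \sum_(k < size q) q`_k *: iter k (cmul a) a.
Local Notation ev := poly_ev.

Lemma poly_evE n q : (size q <= n)%N -> ev q = \sum_(k < n) q`_k *: iter k (cmul a) a.
Proof.
move=> qn; rewrite /ev (big_ord_widen n (fun k => q`_k *: iter k (cmul a) a) qn) big_mkcond/=.
by apply: eq_bigr => k _; case: ltnP => // /leq_sizeP/(_ _ (leqnn _)) ->; rewrite scale0r.
Qed.

Lemma poly_evD p q : ev (p + q) = ev p + ev q.
Proof.
have pn := leq_maxl (size p) (size q); have qn := leq_maxr (size p) (size q).
rewrite (poly_evE (leq_trans (size_polyD p q) (leqnn _))) (poly_evE pn) (poly_evE qn) -big_split/=.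
by apply: eq_bigr => k _; rewrite coefD scalerDl.
Qed.

Lemma poly_evZ c q : ev (c *: q) = c *: ev q.
Proof.
rewrite (poly_evE (size_scale_leq c q)) scaler_sumr.
by apply: eq_bigr => k _; rewrite coefZ scalerA.
Qed.

Lemma poly_evC c : ev c%:P = c *: a.
Proof. by rewrite (poly_evE (size_polyC_leq1 c)) big_ord1/= coefC. Qed.

Lemma poly_ev1 : ev 1 = a.
Proof. by rewrite poly_evC scale1r. Qed.

Lemma poly_ev0 : ev 0 = 0.
Proof. by rewrite poly_evC scale0r. Qed.

Lemma poly_evB p q : ev (p - q) = ev p - ev q.
Proof. by rewrite poly_evD -scaleN1r poly_evZ scaleN1r. Qed.

Lemma poly_ev_sum (I : Type) (s : seq I) (P : pred I) (f : I -> {poly R[i]}) :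
  ev (\sum_(i <- s | P i) f i) = \sum_(i <- s | P i) ev (f i).
Proof. by elim/big_rec2: _ => [|i u v _ <-]; rewrite ?poly_ev0 ?poly_evD. Qed.

Lemma poly_evX q : ev (q * 'X) = cmul a (ev q).
Proof.
have sq : (size (q * 'X)%R <= (size q).+1)%N.
  by rewrite (leq_trans (size_polyMleq _ _))// size_polyX addn2.
rewrite (poly_evE sq) big_ord_recl/= coefMX/= scale0r add0r /ev cmul_sumr.
by apply: eq_bigr => k _; rewrite coefMX/= cmulZr.
Qed.

Lemma poly_evM p q : cmul (ev p) (ev q) = ev (p * q * 'X).
Proof.
elim/poly_ind: p => [|p c ih]; first by rewrite poly_ev0 cmul0x !mul0r poly_ev0.
rewrite poly_evD poly_evX poly_evC cmulDl -cmulA ih cmulZl -!poly_evX -poly_evZ -poly_evD.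
by congr ev; rewrite -mul_polyC; ring.
Qed.

Lemma poly_ev_comm p q : cmul (ev p) (ev q) = cmul (ev q) (ev p).
Proof. by rewrite !poly_evM [p * q]mulrC. Qed.

Lemma poly_ev_ideal q g : ev q = 0 -> ev (g * q) = 0.
Proof.
move=> q0; elim/poly_ind: g => [|g c ih]; first by rewrite mul0r poly_ev0.
by rewrite mulrDl mulrAC poly_evD poly_evX ih cmulx0 mul_polyC poly_evZ q0 scaler0 addr0.
Qed.

Lemma poly_ev_dvdp q g : q %| g -> ev q = 0 -> ev g = 0.
Proof. by move=> /dvdpP[h ->]; exact: poly_ev_ideal. Qed.

Hypothesis a_self_adjoint : cstar a = a.

Lemma poly_ev_star q : cstar (ev q) = ev (map_poly Num.conj q).
Proof.
elim/poly_ind: q => [|q c ih]; first by rewrite rmorph0 poly_ev0 cstar0.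
rewrite rmorphD rmorphM/= map_polyX map_polyC/= !poly_evD !poly_evX !poly_evC.
rewrite cstarD cstarM ih cstarZ a_self_adjoint; congr (_ + _).
by rewrite -[X in cmul _ X]poly_ev1 poly_ev_comm poly_ev1.
Qed.

Lemma poly_ev_normal q : cmul (cstar (ev q)) (ev q) = cmul (ev q) (cstar (ev q)).
Proof. by rewrite poly_ev_star poly_ev_comm. Qed.

(** The powers of a normal element have the expected norms along exponents 2^n, so
a nilpotent value is zero.  The exponent of 'X is one less than that of w, as the
evaluation supplies the remaining factor. *)
Lemma poly_ev_radical q w n : q %| 'X ^+ (2 ^ n - 1) * w ^+ (2 ^ n) ->
  ev q = 0 -> ev w = 0.
Proof.
move=> qw q0; apply: cnorm_eq0; apply/eqP.
have <- : (cnorm (ev w) ^+ (2 ^ n) == 0) = (cnorm (ev w) == 0) by rewrite expf_eq0 expn_gt0.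
suff [e <-] : ev ('X ^+ (2 ^ n - 1) * w ^+ (2 ^ n)) = iter n (fun x => cmul x x) (ev w) /\
    cnorm (iter n (fun x => cmul x x) (ev w)) = cnorm (ev w) ^+ (2 ^ n).
  by rewrite -e (poly_ev_dvdp qw q0) cnorm0.
elim: n {qw} => [|n [ih1 ih2]]; first by rewrite expr0 mul1r expr1.
rewrite iterS -ih1; split; last first.
  by rewrite (cnorm_normal_sqr (poly_ev_normal _)) ih1 ih2 -exprM mulnC -expnS.
rewrite poly_evM; congr ev.
rewrite (_ : 2 ^ n.+1 - 1 = (2 ^ n - 1) + (2 ^ n - 1) + 1)%N; last first.
  have := expn_gt0 2 n; rewrite /= expnS mul2n -addnn; case: (2 ^ n)%N => // m _.
  by rewrite !subn1/= addn1 addnS.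
by rewrite !exprD expr1 expnS mul2n -addnn exprD; ring.
Qed.

Lemma prod_XsubC_dvd_exp (s : seq R[i]) q :
  (forall z, z \in s -> ('X - z%:P) %| q) -> \prod_(z <- s) ('X - z%:P) %| q ^+ size s.
Proof.
elim: s => [|z s ih] sq; first by rewrite big_nil dvd1p.
rewrite big_cons exprS dvdp_mul ?sq ?mem_head// ih// => y ys.
by rewrite sq// inE ys orbT.
Qed.

(** The spectral theorem for algebraic elements.  By [poly_ev_radical] the annihilator
of a contains the product of the ('X - z) over the distinct nonzero roots z, and
the projections are the values at a of the Lagrange interpolation polynomials of
these roots.  The root 0 is left out because it contributes nothing to a, and so
that one can divide by the roots. *)
Lemma self_adjoint_algebraic_diagonal q : q != 0 -> ev q = 0 ->
  exists (T : seq R[i]) (p : R[i] -> A),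
    [/\ uniq T, {in T, forall l, is_projection (p l)},
        {in T &, forall l m, l != m -> cmul (p l) (p m) = 0} &
        a = \sum_(l <- T) l *: p l].
Proof.
move=> q0 evq.
have [rs qE] := closed_field_poly_normal q.
have ev_rs : ev (\prod_(z <- rs) ('X - z%:P)) = 0.
  apply: poly_ev_dvdp evq; rewrite [X in X %| _]qE dvdpZl ?lead_coef_eq0//.
pose T := [seq z <- undup rs | z != 0].
pose w := \prod_(z <- T) ('X - z%:P).
have Tuniq : uniq T by rewrite filter_uniq// undup_uniq.
have T0 z : z \in T -> z != 0 by rewrite mem_filter => /andP[].
have evw : ev w = 0.
  apply: (@poly_ev_radical _ w (size rs)) ev_rs.
  apply: (@dvdp_trans _ (('X * w) ^+ size rs)).
    apply: prod_XsubC_dvd_exp => z zrs.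
    have [->|z0] := eqVneq z 0; first by rewrite subr0 dvdp_mulr.
    by rewrite dvdp_mull// dvdp_XsubCl root_prod_XsubC mem_filter z0 mem_undup.
  rewrite exprMn dvdp_mul// dvdp_exp2l//; first exact: ler_expn2.
  by rewrite ltnW// ltn_expl.
have [T_nil|T_cons] := eqVneq T [::].
  exists [::], (fun=> 0); split=> //.
  by rewrite big_nil -poly_ev1 -[RHS]evw /w T_nil big_nil.
pose V (l : R[i]) : {poly R[i]} := \prod_(z <- T | z != l) ('X - z%:P).
have wV l : l \in T -> w = ('X - l%:P) * V l by move=> lT; rewrite /w (bigD1_seq l).
have Vl l : (V l).[l] != 0.
  by rewrite horner_prod prodf_seq_neq0; apply/allP => z _; apply/implyP => zl; rewrite !hornerE subr_eq0 eq_sym.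
have Vm l m : m \in T -> m != l -> (V l).[m] = 0.
  move=> mT ml; apply/eqP; rewrite horner_prod prodf_seq_eq0; apply/hasP; exists m => //.
  by rewrite ml !hornerE subrr/=.
pose L (l : R[i]) : {poly R[i]} := (V l).[l]^-1 *: V l.
have Ll l : (L l).[l] = 1 by rewrite hornerZ mulVf.
have Lm l m : m \in T -> m != l -> (L l).[m] = 0 by move=> mT ml; rewrite hornerZ (Vm _ _ mT ml) ?mulr0 ?scaler0.
have sumL : \sum_(l <- T) L l = 1.
  apply/eqP; rewrite -subr_eq0; apply/eqP.
  apply: (@roots_geq_poly_eq0 _ _ T) => //.
    apply/allP => m mT; rewrite /root !hornerE horner_sum (bigD1_seq m)//= Ll.
    rewrite big_seq_cond big1 ?addr0 ?subrr// => l /andP[lT lm].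
    by rewrite Lm// eq_sym.
  apply: (leq_trans (size_polyD _ _)); rewrite size_polyN size_poly1 geq_max.
  rewrite lt0n size_eq0 T_cons andbT; apply: (leq_trans (size_sum _ _ _)).
  apply/bigmax_leqP_seq => l lT _; apply: (leq_trans (size_scale_leq _ _)).
  rewrite /V -big_filter size_prod_XsubC size_filter -(count_predC (pred1 l)) -addn1 addnC leq_add2r.
  by rewrite -has_count has_pred1.
have evgL l g : l \in T -> ev (g * L l) = g.[l] *: ev (L l).
  move=> lT; have /factor_theorem[h gh] : root (g - (g.[l])%:P) l by rewrite /root !hornerE subrr.
  apply/eqP; rewrite -subr_eq0 -poly_evZ -poly_evB -mul_polyC -mulrBl gh; apply/eqP.
  rewrite -mulrA /L -scalerAr -wV// -scalerAr poly_evZ.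
  by rewrite poly_ev_ideal// scaler0.
have evLL l m : m \in T -> cmul (ev (L l)) (ev (L m)) = ((L l).[m] * m) *: ev (L m).
  by move=> mT; rewrite poly_evM mulrAC evgL// hornerM hornerX.
exists T, (fun l => ev (l^-1 *: L l)); split=> //.
- move=> l lT; apply: normal_idempotent_projection; last exact: poly_ev_normal.
  by rewrite /= (poly_evZ l^-1) cmulZl cmulZr evLL// Ll mul1r (scalerA l^-1 l) mulVf ?scale1r// T0.
- move=> l m lT mT lm; rewrite (poly_evZ l^-1) (poly_evZ m^-1) cmulZl cmulZr evLL// (Lm _ _ mT) 1?eq_sym//.
  by rewrite mul0r scale0r !scaler0.
- rewrite -{1}poly_ev1 -sumL poly_ev_sum big_seq [RHS]big_seq.
  by apply: eq_bigr => l lT; rewrite (poly_evZ l^-1) (scalerA l l^-1) mulfV ?scale1r// T0.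
Qed.
End PolynomialCalculus.

(** * Combinations of orthogonal projections *)

Lemma le_of_expr_bound (R : realType) (r C : R) : 0 <= r ->
  (forall n, r ^+ (2 ^ n) <= C) -> r <= 1.
Proof.
move=> r0 rC; rewrite leNgt; apply/negP => r1.
have rn n : n%:R * (r - 1) <= r ^+ n.
  elim: n => [|n ih]; first by rewrite mul0r expr0 ler01.
  have rn1 : 1 <= r ^+ n by rewrite exprn_ege1// ltW.
  have := ler_wpM2r (_ : 0 <= r - 1) rn1; rewrite subr_ge0 ltW// => /(_ isT).
  rewrite exprS -natr1; nra.
pose n := Num.bound (C / (r - 1)).
have := le_trans (rn (2 ^ n)%N) (rC n); rewrite -ler_pdivlMr ?subr_gt0// natrX.
have := upper_nthrootP (leqnn n); rewrite -/n => /le_lt_trans => h /h.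
by rewrite ltxx.
Qed.

Section ProjectionFamilies.
Context {R : realType} (A : cstarAlgType R).

Definition orthogonal_projections (J : finType) (e : J -> A) : Prop :=
  (forall j, is_projection (e j)) /\ (forall j k, j != k -> cmul (e j) (e k) = 0).

Definition partition_of_unity (J : finType) (e : J -> A) : Prop :=
  orthogonal_projections e /\ is_unit (\sum_j e j).

Section OneFamily.
Context (J : finType) (e : J -> A).
Hypothesis eo : orthogonal_projections e.

Definition combination (w : J -> R[i]) : A := \sum_j w j *: e j.

Lemma combination_mul_proj w j : cmul (combination w) (e j) = w j *: e j.
Proof.
rewrite /combination cmul_suml (bigD1 j)//= cmulZl (eo.1 j).2 big1 ?addr0// => k kj.
by rewrite cmulZl eo.2// scaler0.
Qed.

Lemma combinationM w v :
  cmul (combination w) (combination v) = combination (fun j => w j * v j).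
Proof.
rewrite {2}/combination cmul_sumr; apply: eq_bigr => j _.
by rewrite cmulZr combination_mul_proj scalerA mulrC.
Qed.

Lemma combinationD w v : combination w + combination v = combination (fun j => w j + v j).
Proof. by rewrite -big_split; apply: eq_bigr => j _; rewrite scalerDl. Qed.

Lemma combinationZ c w : c *: combination w = combination (fun j => c * w j).
Proof. by rewrite scaler_sumr; apply: eq_bigr => j _; rewrite scalerA. Qed.

Lemma combinationB w v : combination w - combination v = combination (fun j => w j - v j).
Proof. by rewrite -sumrB; apply: eq_bigr => j _; rewrite scalerBl. Qed.

Lemma combination_star w : cstar (combination w) = combination (fun j => Num.conj (w j)).
Proof. by rewrite cstar_sum; apply: eq_bigr => j _; rewrite cstarZ (eo.1 j).1. Qed.

Lemma eq_combination w v : (forall j, e j != 0 -> w j = v j) -> combination w = combination v.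
Proof.
move=> wv; apply: eq_bigr => j _.
by have [->|/wv ->//] := eqVneq (e j) 0; rewrite !scaler0.
Qed.

Lemma cnorm_combination_ge w j : e j != 0 -> cnorm (w j) <= cnorm (combination w).
Proof.
move=> ej; have e1 := cnorm_projection (eo.1 j) ej.
have := cnormM (combination w) (e j).
by rewrite combination_mul_proj cnormZ e1 !mulr1.
Qed.

(** Squaring w^* w repeatedly turns the crude bound #|J| M into #|J| M^(2^n) for the
norm to the power 2^n, and the factor #|J| disappears in the limit. *)
Lemma cnorm_combination_le w (M : R) : 0 <= M ->
  (forall j, e j != 0 -> cnorm (w j) <= M) -> cnorm (combination w) <= M.
Proof.
move=> M0 wM.
have key n : forall v (N : R), 0 <= N -> (forall j, e j != 0 -> cnorm (v j) <= N) ->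
    cnorm (combination v) ^+ (2 ^ n) <= #|J|%:R * N ^+ (2 ^ n).
  elim: n => [|n ih] v N N0 vN.
    rewrite !expr1; apply: (le_trans (cnorm_sum _ _ _)).
    rewrite mulr_natl -sumr_const; apply: ler_sum => j _.
    rewrite cnormZ; have [->|ej] := eqVneq (e j) 0; first by rewrite cnorm0 mulr0.
    by rewrite (cnorm_projection (eo.1 j) ej) mulr1 vN.
  rewrite expnS !exprM -cnorm_cstar_cmul combination_star combinationM.
  apply: ih => [|j ej]; first by rewrite exprn_ge0.
  rewrite cnormMC expr2 ler_pM ?cnorm_ge0 ?vN//.
  by rewrite /cnorm norm_conjC vN.
have [M1|M1] := eqVneq M 0.
  have := key 0%N w M M0 wM; rewrite M1 !expr1 mulr0.
  by [].
have {M0 M1} M0 : 0 < M by rewrite lt_neqAle eq_sym M1.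
rewrite -(ler_pM2r (_ : 0 < M^-1)) ?invr_gt0// mulfV ?gt_eqF//.
apply: (@le_of_expr_bound _ _ #|J|%:R).
  by rewrite mulr_ge0 ?cnorm_ge0// invr_ge0 ltW.
move=> n; rewrite exprMn exprVn ler_pdivrMr ?exprn_gt0//.
by apply: key => //; exact: ltW.
Qed.

End OneFamily.

Lemma is_unit_unique (e f : A) : is_unit e -> is_unit f -> e = f.
Proof. by move=> eu fu; rewrite -(eu f).1 (fu e).2. Qed.

Section Commutative.
Hypothesis cA : commutative (@cmul R A).

Lemma projectionM (p q : A) : is_projection p -> is_projection q -> is_projection (cmul p q).
Proof.
move=> [ps pp] [qs qq]; split; first by rewrite cstarM ps qs cA.
by rewrite -cmulA (cA q) -cmulA qq cmulA pp.
Qed.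

Lemma projectionB (p q : A) : is_projection p -> is_projection q -> cmul p q = q ->
  is_projection (p - q).
Proof.
move=> [ps pp] [qs qq] pq; split; first by rewrite cstarB ps qs.
by rewrite cmulBl !cmulBr (cA q p) pq pp qq subrr subr0.
Qed.

Lemma projectionD (p q : A) : is_projection p -> is_projection q -> cmul p q = 0 ->
  is_projection (p + q).
Proof.
move=> [ps pp] [qs qq] pq; split; first by rewrite cstarD ps qs.
by rewrite cmulDl !cmulDr (cA q p) pq pp qq addr0 add0r.
Qed.

Lemma projection_sum (J : finType) (e : J -> A) (P : pred J) :
  orthogonal_projections e -> is_projection (\sum_(j | P j) e j).
Proof.
move=> eo; have -> : \sum_(j | P j) e j = combination e (fun j => (P j)%:R).
  by rewrite /combination big_mkcond; apply: eq_bigr => j _; case: ifP; rewrite ?scale1r ?scale0r.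
split.
  by rewrite (combination_star eo); apply: eq_combination => j _; rewrite rmorph_nat.
by rewrite (combinationM eo); apply: eq_combination => j _; case: (P j); rewrite ?mulr1 ?mulr0.
Qed.

Lemma coarsen_partition (J K : finType) (e : J -> A) (f : J -> K) :
  partition_of_unity e -> partition_of_unity (fun k => \sum_(j | f j == k) e j).
Proof.
move=> [eo eu]; split; last first.
  by move: eu; rewrite (partition_big f predT).
split=> [k|k l kl]; first exact: projection_sum.
rewrite cmul_suml big1// => j /eqP jk; rewrite cmul_sumr big1// => i /eqP il.
by rewrite eo.2//; apply: contra kl => /eqP ji; rewrite -jk -il ji.
Qed.

Lemma combination_coarsen (J K : finType) (e : J -> A) (f : J -> K) (d : K -> R[i]) :
  combination (fun k => \sum_(j | f j == k) e j) d = combination e (fun j => d (f j)).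
Proof.
rewrite /combination [RHS](partition_big f predT)//=; apply: eq_bigr => k _.
by rewrite scaler_sumr; apply: eq_bigr => j /eqP ->.
Qed.

Section Product.
Context (J K : finType) (e : J -> A) (f : K -> A).
Hypotheses (ep : partition_of_unity e) (fp : partition_of_unity f).
Let ef (jk : J * K) := cmul (e jk.1) (f jk.2).

Lemma combination_product_l w : combination ef (fun jk => w jk.1) = combination e w.
Proof.
rewrite /combination -(pair_bigA _ (fun j k => w j *: cmul (e j) (f k)))/=.
apply: eq_bigr => j _; rewrite -scaler_sumr -cmul_sumr.
by rewrite (fp.2 _).2.
Qed.

Lemma combination_product_r w : combination ef (fun jk => w jk.2) = combination f w.
Proof.
rewrite /combination -(pair_bigA _ (fun j k => w k *: cmul (e j) (f k)))/= exchange_big/=.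
apply: eq_bigr => j _; rewrite -scaler_sumr -cmul_suml.
by rewrite (ep.2 _).1.
Qed.

Lemma product_partition : partition_of_unity ef.
Proof.
split; last first.
  have E (I : finType) (g : I -> A) : \sum_i g i = combination g (fun=> 1).
    by apply: eq_bigr => i _; rewrite scale1r.
  by have := ep.2; rewrite !E -combination_product_l.
split=> [jk|[j k] [j' k']]; first by apply: projectionM; [exact: ep.1.1|exact: fp.1.1].
rewrite /ef/= -cmulA (cmulA (f k)) (cA (f k)) -cmulA cmulA => jk.
have [jj|jj] := eqVneq j j'; last by rewrite ep.1.2// cmul0x.
by rewrite fp.1.2 ?cmulx0//; apply: contra jk => /eqP ->; rewrite jj.
Qed.

End Product.
End Commutative.
End ProjectionFamilies.

(** * Elements of finite spectrum *)

Section Spectrum.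
Context {R : realType} (A : cstarAlgType R) (H : comm_unital A).

Lemma cring_unital : unital A.
Proof. by exists (cu_one H); exact: cu_is_unit. Qed.

Lemma not_spectrumP (a : cring H) (l : R[i]) :
  ~ @spectrum R A a l <-> exists b, (a - l%:A) * b = 1.
Proof.
split=> [nsp|[b ab]].
  apply: contrapT => nb; apply: nsp; left; exists (cu_one H); first exact: cu_is_unit.
  by move=> [b [ab _]]; apply: nb; exists b.
move=> [[e eu nb]|[nu _]]; last exact: nu cring_unital.
rewrite (is_unit_unique eu (cu_is_unit H)) in nb; apply: nb; exists b; split=> //.
by rewrite cu_comm.
Qed.

Lemma poly_ev_horner (a : cring H) q : poly_ev (a : A) q = horner_alg a (q * 'X).
Proof.
elim/poly_ind: q => [|q c ih]; first by rewrite poly_ev0 mul0r rmorph0.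
rewrite poly_evD poly_evX poly_evC ih mulrDl !rmorphD/= !rmorphM/=.
by rewrite horner_algX horner_algC mulr_algl; congr (_ + _); exact: (mulrC a (horner_alg a q * a)).
Qed.

Lemma horner_alg_XsubC (a : cring H) z : horner_alg a ('X - z%:P) = a - z%:A.
Proof. by rewrite rmorphB/= horner_algX horner_algC. Qed.

(** Let w be the product of the ('X - z) over the spectrum, b its value at a, and
c = b^* b.  If b were nonzero, ||c||^2 - c^2 would not be invertible.  It is the value
at a of a polynomial P taking the value ||c||^2 on the spectrum.  The roots of P are
thus outside the spectrum, so that all linear factors of P are invertible at a. *)
Lemma finite_spectrum_algebraic (a : cring H) :
  cstar a = a -> finite_set (@spectrum R A a) ->
  exists2 q : {poly R[i]}, q != 0 & poly_ev (a : A) q = 0.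
Proof.
move=> as_ /finite_seqP[S sE].
pose w : {poly R[i]} := \prod_(z <- S) ('X - z%:P).
have w0 : w != 0 by rewrite monic_neq0// monic_prod_XsubC.
exists w => //; apply: contrapT => /eqP b0.
set b := poly_ev (a : A) w in b0.
pose c : cring H := cmul (cstar b) b.
have c0 : c != 0 by apply: contra b0 => /eqP/cstar_cmul_eq0 ->.
have cs : cstar c = c by rewrite /c cstarM cstarK.
pose wc := map_poly Num.conj w * w * 'X : {poly R[i]}.
have cE : c = horner_alg a (wc * 'X).
  by rewrite -poly_ev_horner /c /b (@poly_ev_star _ A a as_) poly_evM.
pose k := ((cnorm c) ^+ 2)%:C.
have k0 : k != 0.
  by apply/eqP => /complexI/eqP; rewrite sqrf_eq0 gt_eqF// cnorm_gt0.
pose P := k%:P - (wc * 'X) ^+ 2.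
have PE : horner_alg a P = k%:A - c ^+ 2.
  by rewrite /P rmorphB/= horner_algC rmorphXn/= -cE.
have PS z : z \in S -> P.[z] = k.
  move=> zS; rewrite /P /wc !hornerE.
  have /eqP -> : w.[z] == 0 by rewrite -[_ == 0]/(root w z) root_prod_XsubC.
  by rewrite !(mulr0, mul0r) expr0n/= subr0.
have [rs PrsE] := closed_field_poly_normal P.
have P0 : P != 0.
  apply/eqP => P0; have := congr1 (horner^~ 0) P0; rewrite /P !hornerE ?mulr0 expr0n/= subr0.
  by move/eqP; rewrite (negPf k0).
have inv z : z \in rs -> exists g, (a - z%:A) * g = 1.
  move=> zrs; apply/not_spectrumP; rewrite sE/= => zS.
  have : root P z by rewrite PrsE rootZ ?lead_coef_eq0// root_prod_XsubC.
  by rewrite /root PS// (negPf k0).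
have [g gE] : exists g, g * horner_alg a P = 1.
  have [g gE] : exists g, horner_alg a (\prod_(z <- rs) ('X - z%:P)) * g = 1.
    elim: rs {PrsE} inv => [|z rs ih] inv; first by exists 1; rewrite big_nil rmorph1 mul1r.
    have [|g gE] := ih; first by move=> y yrs; apply: inv; rewrite inE yrs orbT.
    have [h hE] := inv z (mem_head _ _).
    exists (h * g); rewrite big_cons rmorphM/= horner_alg_XsubC mulrACA.
    by rewrite hE mul1r.
  exists ((lead_coef P)^-1 *: g); rewrite {2}PrsE -mul_polyC rmorphM/= horner_algC mulr_algl -scalerAr -scalerAl mulrC gE.
  by rewrite scalerA (mulVf, divff) ?scale1r ?lead_coef_eq0.
by have := self_adjoint_spectral_radius g cs c0; rewrite -PE gE eqxx.
Qed.

Lemma algebraic_finite_spectrum (a : cring H) (s : seq R[i]) :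
  \prod_(z <- s) (a - z%:A) = 0 -> finite_set (@spectrum R A a).
Proof.
move=> as0; apply: (@sub_finite_set _ _ [set` s]); last exact: finite_seq.
move=> l; apply: contraPP => /= ls; apply/not_spectrumP.
pose P : {poly R[i]} := \prod_(z <- s) ('X - z%:P).
have Pl : P.[l] != 0 by rewrite -[_ == 0]/(root P l) root_prod_XsubC; exact/negP.
have /factor_theorem[g gE] : root (P - (P.[l])%:P) l by rewrite /root !hornerE subrr.
exists (- (P.[l])^-1 *: horner_alg a g).
have Pa : horner_alg a P = 0.
  by rewrite rmorph_prod/=; under eq_bigr do rewrite horner_alg_XsubC.
have := congr1 (horner_alg a) gE.
rewrite rmorphB/= Pa horner_algC sub0r rmorphM/= horner_alg_XsubC => E.
rewrite -scalerAr mulrC -E scaleNr scalerN opprK scalerA mulVf//.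
exact: scale1r.
Qed.

(** Adding l *: p to b shifts the annihilating roots by l on the range of p and keeps
them on the range of 1 - p. *)
Lemma projection_combination_algebraic (r : seq (R[i] * cring H)) :
  (forall lp, lp \in r -> lp.2 ^+ 2 = lp.2) ->
  exists s : seq R[i], \prod_(z <- s) (\sum_(lp <- r) lp.1 *: lp.2 - z%:A) = 0.
Proof.
elim: r => [|[l p] r ih] rp.
  by exists [:: 0]; rewrite big_nil big_seq1 scale0r subrr.
have [|s sE] := ih; first by move=> lp lpr; apply: rp; rewrite inE lpr orbT.
have pp : p ^+ 2 = p by apply: (rp (l, p)); rewrite mem_head.
exists (s ++ [seq l + z | z <- s]); rewrite big_cat/= big_map/=.
set b := \sum_(_ <- r) _ in sE.
rewrite big_cons/= -/b; set u := \prod_(_ <- _) _; set v := \prod_(_ <- _) _.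
have u0 : (1 - p) * u = 0.
  transitivity ((1 - p) * \prod_(z <- s) (b - z%:A)); last by rewrite sE mulr0.
  rewrite /u; elim: s {sE u v} => [|z s ihs]; first by rewrite !big_nil.
  rewrite !big_cons mulrCA ihs [RHS]mulrCA.
  transitivity ((1 - p) * (l *: p + b - z%:A) * \prod_(z <- s) (b - z%:A)).
    by rewrite mulrCA mulrA.
  rewrite [RHS]mulrA -[RHS]mulrA [RHS]mulrCA mulrA; congr (_ * _).
  rewrite -(mulr_algl l p) (_ : _ * _ = (1 - p) * (b - z%:A) - l%:A * (p ^+ 2 - p)); last by ring.
  by rewrite pp subrr mulr0 subr0.
have v0 : p * v = 0.
  transitivity (p * \prod_(z <- s) (b - z%:A)); last by rewrite sE mulr0.
  rewrite /v; elim: s {sE u v u0} => [|z s ihs]; first by rewrite !big_nil.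
  rewrite !big_cons mulrCA ihs [RHS]mulrCA.
  transitivity (p * (l *: p + b - (l + z)%:A) * \prod_(z <- s) (b - z%:A)).
    by rewrite mulrCA mulrA.
  rewrite [RHS]mulrCA mulrA; congr (_ * _).
  rewrite -(mulr_algl l p) scalerDl (_ : _ * _ = p * (b - z%:A) + l%:A * (p ^+ 2 - p)); last by ring.
  by rewrite pp subrr mulr0 addr0.
have -> : u * v = (1 - p) * u * v + u * (p * v) by ring.
by rewrite u0 v0 mulr0 mul0r addr0.
Qed.

End Spectrum.

(** * The algebras of diagonal matrices *)

Section DiagonalAlgebra.
Context {R : realType} (n : nat).

(** The algebra C^n with the supremum norm. *)
Definition diag_alg := {ffun 'I_n -> R[i]^o}.
HB.instance Definition _ := GRing.Lmodule.on diag_alg.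

Implicit Types x y z : diag_alg.

Definition diag_norm x : R := \big[Num.max/0]_(i < n) cnorm (x i : R[i]).

Lemma diag_norm_ge x i : cnorm (x i : R[i]) <= diag_norm x.
Proof. exact: (le_bigmax _ (fun i => cnorm (x i : R[i]))). Qed.

Lemma diag_norm_le x (M : R) : 0 <= M -> (forall i, cnorm (x i : R[i]) <= M) -> diag_norm x <= M.
Proof. by move=> M0 xM; apply: bigmax_le. Qed.

Lemma diag_norm_ge0 x : 0 <= diag_norm x.
Proof. exact: bigmax_ge_id. Qed.

Fact diag_normD x y : (diag_norm (x + y))%:C <= (diag_norm x)%:C + (diag_norm y)%:C :> R[i].
Proof.
rewrite -rmorphD/= lecR; apply: diag_norm_le => [|i]; first by rewrite addr_ge0 ?diag_norm_ge0.
by rewrite ffunE (le_trans (cnormD (x i : R[i]) (y i)))// lerD ?diag_norm_ge.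
Qed.

Fact diag_normZ (l : R[i]) x : (diag_norm (l *: x))%:C = `|l| * (diag_norm x)%:C.
Proof.
rewrite cnormE -rmorphM/=; congr (_%:C); rewrite /diag_norm big_endo ?mulr0//; last first.
  by move=> u v; rewrite maxr_pMr ?cnorm_ge0.
by apply: eq_bigr => i _; rewrite ffunE cnormMC.
Qed.

Fact diag_norm0_eq0 x : (diag_norm x)%:C = 0 :> R[i] -> x = 0.
Proof.
move=> /complexI x0; apply/ffunP => i; rewrite ffunE; apply: cnorm_eq0.
by apply/le_anti; rewrite cnorm_ge0 -x0 diag_norm_ge.
Qed.

HB.instance Definition _ := Lmodule_isNormed.Build R[i] diag_alg
  diag_normD diag_normZ diag_norm0_eq0.

Lemma cnorm_diag x : cnorm x = diag_norm x.
Proof. by []. Qed.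

Lemma complex_norm_le (z : R[i]) : cnorm z <= `|complex.Re z| + `|complex.Im z|.
Proof.
rewrite {1}(complexE z) (le_trans (cnormD _ _))// cnormMC !cnorm_real.
by rewrite [cnorm 'i%C]/cnorm normc_def/= expr0n expr1n add0r sqrtr1 mul1r.
Qed.

Lemma normr_Re_le (z : R[i]) : `|complex.Re z| <= cnorm z.
Proof.
rewrite /cnorm normc_def/= -sqrtr_sqr ler_wsqrtr// lerDl sqr_ge0//.
Qed.

Lemma normr_Im_le (z : R[i]) : `|complex.Im z| <= cnorm z.
Proof.
rewrite /cnorm normc_def/= -sqrtr_sqr ler_wsqrtr// lerDr sqr_ge0//.
Qed.

Lemma diag_cauchy_cvg (F : set_system diag_alg) : ProperFilter F -> cauchy F -> cvg F.
Proof.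
move=> FF /cauchyP Fc.
have coord (f : diag_alg -> R) : (forall x y, `|f x - f y| <= cnorm (x - y)) ->
    cvg (f @ F).
  move=> fl; apply: cauchy_cvg; apply: cauchy_exP => e e0.
  have [|x xF] := Fc e%:C; first by rewrite ltcR.
  exists (f x); suff : F (f @^-1` ball (f x) e) by [].
  apply: filterS xF => y; rewrite -!ball_normE /= !cnormE ltcR.
  exact: le_lt_trans (fl _ _).
have re i : cvg ((fun x : diag_alg => complex.Re (x i)) @ F).
  apply: coord => x y; rewrite cnorm_diag.
  apply: le_trans (diag_norm_ge _ i); rewrite !ffunE.
  by have := normr_Re_le (x i - y i : R[i]); rewrite [complex.Re (_ - _)]raddfB.
have im i : cvg ((fun x : diag_alg => complex.Im (x i)) @ F).
  apply: coord => x y; rewrite cnorm_diag.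
  apply: le_trans (diag_norm_ge _ i); rewrite !ffunE.
  by have := normr_Im_le (x i - y i : R[i]); rewrite [complex.Im (_ - _)]raddfB.
pose L : diag_alg := [ffun i => lim ((fun x : diag_alg => complex.Re (x i)) @ F)
   +i* lim ((fun x : diag_alg => complex.Im (x i)) @ F)].
apply/cvg_ex; exists L; apply/fcvgrPdist_lt => e e0.
have e'0 : 0 < complex.Re e by move: e0; rewrite ltcE => /andP[].
rewrite -(RRe_real (gtr0_real e0)); set d := complex.Re e in e'0 *.
have d4 : 0 < d / 4%:R by rewrite divr_gt0.
have near_i i : \forall x \near F, cnorm ((L - x) i : R[i]) <= d / 2%:R.
  have /cvgrPdist_lt/(_ _ d4) R1 := re i.
  have /cvgrPdist_lt/(_ _ d4) I1 := im i.
  apply: filterS2 R1 I1 => x /= R1 I1.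
  rewrite !ffunE (le_trans (complex_norm_le _))//.
  have -> : d / 2%:R = d / 4%:R + d / 4%:R by field.
  by apply: lerD; apply: ltW; [move: R1|move: I1]; case: (x i).
have : \forall x \near F, forall i, cnorm ((L - x) i : R[i]) <= d / 2%:R by apply: filter_forall => i; exact: near_i.
apply: filterS => x xL.
rewrite cnormE ltcR; apply: (@le_lt_trans _ _ (d / 2%:R)).
  by apply: diag_norm_le => //; rewrite divr_ge0// ltW.
by rewrite ltr_pdivrMr// ltr_pMr// ltr1n.
Qed.

HB.instance Definition _ := Uniform_isComplete.Build diag_alg diag_cauchy_cvg.

Definition diag_mul x y : diag_alg := [ffun i => (x i : R[i]) * y i].
Definition diag_star x : diag_alg := [ffun i => Num.conj (x i : R[i])].

Fact diag_mulA : associative diag_mul.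
Proof. by move=> x y z; apply/ffunP => i; rewrite !ffunE mulrA. Qed.
Fact diag_mulDl : left_distributive diag_mul +%R.
Proof. by move=> x y z; apply/ffunP => i; rewrite !ffunE mulrDl. Qed.
Fact diag_mulDr : right_distributive diag_mul +%R.
Proof. by move=> x y z; apply/ffunP => i; rewrite !ffunE mulrDr. Qed.
Fact diag_mulZl (l : R[i]) x y : diag_mul (l *: x) y = l *: diag_mul x y.
Proof. by apply/ffunP => i; rewrite !ffunE -mulrA. Qed.
Fact diag_mulZr (l : R[i]) x y : diag_mul x (l *: y) = l *: diag_mul x y.
Proof. by apply/ffunP => i; rewrite !ffunE mulrCA. Qed.
Fact diag_starK : involutive diag_star.
Proof. by move=> x; apply/ffunP => i; rewrite !ffunE conjCK. Qed.
Fact diag_starD : {morph diag_star : x y / x + y}.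
Proof. by move=> x y; apply/ffunP => i; rewrite !ffunE rmorphD. Qed.
Fact diag_starZ (l : R[i]) x : diag_star (l *: x) = l^* *: diag_star x.
Proof. by apply/ffunP => i; rewrite !ffunE rmorphM. Qed.
Fact diag_starM x y : diag_star (diag_mul x y) = diag_mul (diag_star y) (diag_star x).
Proof. by apply/ffunP => i; rewrite !ffunE rmorphM mulrC. Qed.
Fact diag_normM x y : `|diag_mul x y| <= `|x| * `|y|.
Proof.
rewrite !cnormE -rmorphM lecR; apply: diag_norm_le => [|i].
  by rewrite mulr_ge0 ?cnorm_ge0.
by rewrite ffunE cnormMC ler_pM ?cnorm_ge0 ?diag_norm_ge.
Qed.
Fact diag_cstar_norm x : `|diag_mul (diag_star x) x| = `|x| ^+ 2.
Proof.
have conjn (z : R[i]) : cnorm (Num.conj z) = cnorm z by rewrite /cnorm norm_conjC.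
rewrite !cnormE -rmorphXn; congr (_%:C); apply/le_anti/andP; split.
  apply: diag_norm_le => [|i]; first by rewrite exprn_ge0 ?cnorm_ge0.
  by rewrite !ffunE cnormMC conjn expr2 ler_pM ?cnorm_ge0 ?diag_norm_ge.
rewrite -[leRHS]sqr_sqrtr ?diag_norm_ge0// lerXn2r ?nnegrE ?sqrtr_ge0 ?cnorm_ge0//.
apply: diag_norm_le => [|i]; first exact: sqrtr_ge0.
rewrite -[leLHS]ger0_norm ?cnorm_ge0// -sqrtr_sqr ler_wsqrtr//.
have := diag_norm_ge (diag_mul (diag_star x) x) i.
by rewrite !ffunE cnormMC conjn expr2.
Qed.

HB.instance Definition _ := CompleteNormedModule_isCStarAlgebra.Build R diag_alg
    diag_mulA diag_mulDl diag_mulDr diag_mulZl diag_mulZr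
    diag_starK diag_starD diag_starZ diag_starM diag_normM diag_cstar_norm.

Definition diag_atom (j : 'I_n) : diag_alg := [ffun i => (i == j)%:R].

Lemma diag_atom_combination x : x = \sum_j (x j : R[i]) *: diag_atom j.
Proof.
apply/ffunP => i; rewrite sum_ffunE (bigD1 i)//= big1 ?addr0 => [|j ji].
  by rewrite !ffunE eqxx; exact/esym/mulr1.
by rewrite !ffunE eq_sym (negPf ji); exact: mulr0.
Qed.

Lemma diag_atom_orthogonal : @orthogonal_projections R diag_alg _ diag_atom.
Proof.
split=> [j|j k jk]; first split; apply/ffunP => i; rewrite !ffunE.
- by rewrite rmorph_nat.
- by case: eqP; rewrite ?mulr1 ?mulr0.
- by case: eqP => [->|_]; rewrite ?mul0r// (negPf jk) mulr0.
Qed.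

Lemma diag_atom_neq0 j : diag_atom j != 0.
Proof. by apply/eqP => /ffunP/(_ j); rewrite !ffunE eqxx => /eqP; rewrite oner_eq0. Qed.

End DiagonalAlgebra.
Arguments diag_alg : clear implicits.

(** Completeness of the complex numbers, read off from that of C^1. *)
Lemma complex_geometric_cvg (R : realType) (s : nat -> R[i]) (K : R) :
  (forall n, cnorm (s n.+1 - s n) <= K * 2%:R^-1 ^+ n) ->
  exists l, forall n, cnorm (l - s n) <= K *+ 2 * 2%:R^-1 ^+ n.
Proof.
move=> sK; pose t n : diag_alg R 1 := [ffun=> s n].
have tE (z : R[i]) : diag_norm ([ffun=> z] : diag_alg R 1) = cnorm z.
  apply/le_anti/andP; split.
    by apply: diag_norm_le => [|i]; rewrite ?cnorm_ge0// ffunE.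
  by have := diag_norm_ge ([ffun=> z] : diag_alg R 1) 0; rewrite ffunE.
have [|l lt] := @geometric_cvg _ (diag_alg R 1) t K.
  by move=> n; rewrite (le_trans _ (sK n))// -tE cnorm_diag (_ : t n.+1 - t n = [ffun=> s n.+1 - s n])//; apply/ffunP => i; rewrite !ffunE.
exists (l 0) => n; rewrite (le_trans _ (lt n))//.
by have := diag_norm_ge (l - t n) 0; rewrite !ffunE.
Qed.

(** * Real rank zero and approximation by projections *)

Section Approximation.
Context {R : realType}.

Definition approximable (A : cstarAlgType R) : Prop :=
  forall (x : A) (eps : R), 0 < eps ->
    exists (J : finType) (e : J -> A) (c : J -> R[i]),
      partition_of_unity e /\ cnorm (x - combination e c) <= eps.

Lemma cartesian_decomposition (A : cstarAlgType R) (x : A) :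
  exists u v, [/\ cstar u = u, cstar v = v & x = u + ('i%C : R[i]) *: v].
Proof.
pose h : R[i] := 2%:R^-1.
have h2 : h + h = 1 by rewrite /h; field.
have hr : Num.conj h = h by rewrite fmorphV rmorph_nat.
pose J0 : R[i] := 'i%C.
have JJ : J0 * J0 = -1 by rewrite -expr2 sqr_i.
have Jc : Num.conj J0 = - J0 by apply/eqP; rewrite eq_complex /= oppr0 !eqxx.
pose u := h *: (x + cstar x); pose v := (- J0 * h) *: (x - cstar x).
have us : cstar u = u by rewrite /u cstarZ hr cstarD cstarK addrC.
have vs : cstar v = v.
  by rewrite /v cstarZ rmorphM rmorphN/= hr Jc cstarB cstarK opprK mulNr scaleNr -scalerN opprB.
exists u, v; split=> //.
rewrite /u /v scalerA mulrA mulrN JJ opprK mul1r -scalerDr addrACA subrr addr0.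
by rewrite scalerDr -scalerDl h2 scale1r.
Qed.

Section Unital.
Context (A : cstarAlgType R) (H : comm_unital A).

(** The missing piece, indexed by None, receives the coefficient 0. *)
Lemma complete_partition (J : finType) (f : J -> A) : orthogonal_projections f ->
  exists e : option J -> A, partition_of_unity e /\
    forall w, combination f w = combination e (oapp w 0).
Proof.
move=> fo; pose s := \sum_j f j; pose u := cu_one H.
have sp : is_projection s by exact: projection_sum fo.
have up : is_projection u := cu_one_projection H.
have fs j : cmul (f j) s = f j.
  by rewrite cmul_sumr (bigD1 j)//= (fo.1 j).2 big1 ?addr0// => i ij; rewrite fo.2// eq_sym.
have fu j : cmul (f j) (u - s) = 0 by rewrite cmulBr fs (cu_is_unit H _).2 subrr.
have sumE (g : option J -> A) : \sum_j g j = g None + \sum_j g (Some j).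
  rewrite (bigD1 None)//=; congr (_ + _).
  rewrite (reindex_omap Some id)/=; last by case.
  by apply: eq_bigl => j; rewrite eqxx.
exists (fun oj => if oj is Some j then f j else u - s); split; [split; [split|]|].
- move=> [j|]; first exact: fo.1.
  by apply: projectionB => //; [exact: (cu_comm H)|exact: (cu_is_unit H _).1].
- move=> [j|] [k|]//= jk; rewrite ?fu//; first exact: fo.2.
  by rewrite (cu_comm H) fu.
- by rewrite sumE/= -/s subrK; exact: cu_is_unit.
- by move=> w; rewrite /combination sumE/= scale0r add0r.
Qed.

Lemma finite_spectrum_combination (a : A) : cstar a = a -> finite_set (spectrum a) ->
  exists (J : finType) (e : J -> A) (c : J -> R[i]), partition_of_unity e /\ a = combination e c.
Proof.
move=> as_ sa; have [q q0 aq] := @finite_spectrum_algebraic _ _ H a as_ sa.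
have [T [p [Tu pp po aE]]] := self_adjoint_algebraic_diagonal as_ q0 aq.
pose f (i : 'I_(size T)) := p (tnth (in_tuple T) i).
have fo : orthogonal_projections f.
  split=> [i|i j ij]; first by apply: pp; rewrite mem_tnth.
  apply: po; rewrite ?mem_tnth//; apply: contra ij => /eqP/tuple_uniqP -> //.
have [e [ep eE]] := complete_partition fo.
exists (option 'I_(size T)), e, (oapp (tnth (in_tuple T)) 0); split=> //.
by rewrite -eE aE big_tnth.
Qed.

(** Real and imaginary parts are approximated separately by combinations over two
partitions of unity, whose products form a common refinement. *)
Lemma real_rank_zero_approximable : real_rank_zero A -> approximable A.
Proof.
move=> rr x eps e0.
have e2 : 0 < eps / 2%:R by rewrite divr_gt0.
have sa (a : A) : cstar a = a -> exists (J : finType) (e : J -> A) (c : J -> R[i]),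
    partition_of_unity e /\ cnorm (a - combination e c) <= eps / 2%:R.
  move=> as_; have /(_ (ball a (eps / 2%:R)%:C)) := rr a as_.
  case=> [|b [[bs bf]]]; first by apply: nbhsx_ballx; rewrite ltcR.
  rewrite -ball_normE /= cnormE ltcR => ab.
  have [J [e [c [ep bE]]]] := finite_spectrum_combination bs bf.
  by exists J, e, c; rewrite -bE (ltW ab).
have [u [v [us vs xE]]] := cartesian_decomposition x.
have hn : cnorm ('i%C : R[i]) = 1 by rewrite /cnorm normc_def/= expr0n expr1n add0r sqrtr1.
have [J [e [a [ep ua]]]] := sa u us.
have [K [f [b [fp vb]]]] := sa v vs.
have cA := cu_comm H.
exists (prod J K), (fun jk => cmul (e jk.1) (f jk.2)), (fun jk => a jk.1 + 'i%C * b jk.2).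
split; first exact: product_partition.
rewrite -combinationD -combinationZ combination_product_l// combination_product_r//.
rewrite xE opprD addrACA -scalerBr (le_trans (cnormD _ _))// cnormZ hn mul1r.
by rewrite [leRHS](splitr eps) lerD.
Qed.

Lemma dense_combinations_real_rank_zero :
  (forall (a : A) (eps : R), cstar a = a -> 0 < eps -> exists r : seq (R * A),
     (forall lp, lp \in r -> is_projection lp.2) /\
     cnorm (a - \sum_(lp <- r) lp.1%:C *: lp.2) < eps) ->
  real_rank_zero A.
Proof.
move=> dense a /= as_ B /nbhs_ballP[e /= e0 aB].
have e'0 : 0 < complex.Re e by move: e0; rewrite ltcE => /andP[].
have [r [rp ra]] := dense a _ as_ e'0.
exists (\sum_(lp <- r) lp.1%:C *: lp.2); split; last first.
  by apply: aB; rewrite -ball_normE /= cnormE -(RRe_real (gtr0_real e0)) ltcR.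
split.
  rewrite /self_adjoint cstar_sum big_seq [RHS]big_seq; apply: eq_bigr => lp lpr.
  by rewrite cstarZ (rp _ lpr).1; congr (_ *: _); exact: conjc_real.
pose r' : seq (R[i] * cring H) := [seq (lp.1%:C, lp.2 : cring H) | lp <- r].
have [|s sE] := @projection_combination_algebraic _ _ H r'.
  by move=> _ /mapP[lp lpr ->]/=; rewrite expr2; exact: (rp _ lpr).2.
have := @algebraic_finite_spectrum _ _ H _ _ sE.
by rewrite /r' big_map.
Qed.

Lemma minimal_subprojection (p q : A) : minimal_projection p -> is_projection q ->
  cmul q p = 0 \/ cmul q p = p.
Proof.
move=> [pp p0 pm] qp; apply: pm; split.
- exact: projectionM (cu_comm H) _ _ qp pp.
- by rewrite (cu_comm H p) -cmulA pp.2.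
- by rewrite -cmulA pp.2.
Qed.

(** A projection times p is 0 or p, so combinations of projections are multiplied by p
into the line of p, and a line is closed. *)
Lemma minimal_projection_scalar_corner (p : A) : approximable A -> minimal_projection p ->
  scalar_corner p.
Proof.
move=> ap pm; have [pp p0 _] := pm; have pn := cnorm_projection pp p0.
have cornerE y : cmul (cmul p y) p = cmul y p.
  by rewrite (cu_comm H p) -cmulA pp.2.
have key y : exists l, cmul y p = l *: p.
  have hn n : 0 < 2%:R^-1 ^+ n :> R by rewrite exprn_gt0// invr_gt0.
  have zP n : exists z, cnorm (cmul y p - z *: p) <= 2%:R^-1 ^+ n.
    have [J [e [c [ep yc]]]] := ap y _ (hn n).
    have [z zE] : exists z, cmul (combination e c) p = z *: p.
      rewrite /combination cmul_suml.
      elim/big_rec: _ => [|j x _ [z ->]]; first by exists 0; rewrite scale0r.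
      rewrite cmulZl; have [->|->] := minimal_subprojection pm (ep.1.1 j).
        by exists z; rewrite scaler0 add0r.
      by exists (c j + z); rewrite scalerDl.
    exists z; rewrite -zE -cmulBl (le_trans (cnormM _ _))//.
    by rewrite pn mulr1.
  have [z zn] := choice zP.
  have [|l lz] := @complex_geometric_cvg R z 2%:R.
    move=> n; rewrite -[leLHS]mulr1 -[X in _ * X <= _]pn -cnormZ scalerBl.
    apply: (le_trans (cnorm_triangle _ (cmul y p) _)).
    rewrite cnormB (le_trans (lerD (zn n.+1) (zn n)))//.
    rewrite mulr_natl mulr2n lerD2r exprS ger_pMl ?exprn_gt0 ?invr_gt0//.
    have : (2%:R^-1 : R) <= 1 by rewrite invf_le1 ?ler1n ?ltr0n.
    exact.
  exists l; apply/eqP; rewrite -subr_eq0; apply/eqP/cnorm_eq0/le_anti.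
  rewrite cnorm_ge0 andbT; apply/ler_addgt0Pr => eps e0; rewrite add0r.
  have [n nK] := @geometric_small R (1 + 4%:R) _ e0.
  apply: le_trans (ltW nK); apply: (le_trans (cnorm_triangle _ (z n *: p) _)).
  rewrite mulrDl mul1r lerD// -scalerBl cnormZ pn mulr1 cnormB (le_trans (lz n))//.
  by rewrite -mulrnA.
apply/seteqP; split=> [_ [y _ <-]|_ [l _ <-]].
  by rewrite cornerE; have [l ->] := key y; exists l.
by exists (l *: p) => //; rewrite cornerE cmulZl pp.2.
Qed.

End Unital.

(** Rounding toward zero keeps the modulus from increasing, so that the grid points
used to approximate a point of the unit disc are in the disc as well. *)
Lemma truncation_grid n (t : R) : `|t| <= 1 -> exists bm : bool * 'I_n.+2,
  let g := (-1) ^+ bm.1 * (bm.2%:R / n.+1%:R) in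
  `|g| <= `|t| /\ `|t - g| <= n.+1%:R^-1.
Proof.
move=> t1; have n0 : 0 < n.+1%:R :> R by rewrite ltr0n.
have tn0 : 0 <= `|t| * n.+1%:R by rewrite mulr_ge0// ltW.
pose m := Num.truncn (`|t| * n.+1%:R).
have /andP[m1 m2] := Num.Theory.truncn_itv tn0; rewrite -/m in m1 m2.
have mn : (m < n.+2)%N.
  rewrite ltnS -(@ler_nat R) (le_trans m1)// -[leRHS]mul1r ler_wpM2r// ltW//.
have gt : m%:R / n.+1%:R <= `|t| by rewrite ler_pdivrMr.
have g0 : 0 <= m%:R / n.+1%:R :> R by rewrite divr_ge0// ltW.
have tg : `|t| - m%:R / n.+1%:R <= n.+1%:R^-1.
  rewrite lerBlDl -[X in _ + X]mul1r -mulrDl ler_pdivlMr// natr1; exact: ltW.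
exists (t < 0, Ordinal mn) => /=; split.
  by rewrite normrM normr_sign mul1r ger0_norm.
have -> : t - (-1) ^+ (t < 0)%R * (m%:R / n.+1%:R) = (-1) ^+ (t < 0)%R * (`|t| - m%:R / n.+1%:R).
  by rewrite mulrBr -{1}[t]mulr_sign_norm.
by rewrite normrM normr_sign mul1r ger0_norm// subr_ge0.
Qed.

Lemma unit_disc_net (d : R) : 0 < d -> exists (K : finType) (g : K -> R[i]),
  (forall k, cnorm (g k) <= 1) /\
  (forall z, cnorm z <= 1 -> exists k, cnorm (z - g k) <= d).
Proof.
move=> d0; pose n := Num.bound (2%:R / d).
pose gr (bm : bool * 'I_n.+2) : R := (-1) ^+ bm.1 * (bm.2%:R / n.+1%:R).
pose g0 (k : (bool * 'I_n.+2) * (bool * 'I_n.+2)) : R[i] := gr k.1 +i* gr k.2.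
exists ((bool * 'I_n.+2) * (bool * 'I_n.+2))%type, (fun k => if cnorm (g0 k) <= 1 then g0 k else 0).
split=> [k|z z1]; first by case: ifP => //; rewrite cnorm0 ler01.
have [k1 /= [a1 b1]] := truncation_grid n (le_trans (normr_Re_le z) z1).
have [k2 /= [a2 b2]] := truncation_grid n (le_trans (normr_Im_le z) z1).
exists (k1, k2); case: ifPn => [_|/negP[]]; last first.
  apply: le_trans z1; rewrite /cnorm !normc_def/= ler_wsqrtr// lerD//.
    by rewrite -[leLHS]real_normK ?num_real// -[leRHS]real_normK ?num_real// lerXn2r.
  by rewrite -[leLHS]real_normK ?num_real// -[leRHS]real_normK ?num_real// lerXn2r.
rewrite (le_trans (complex_norm_le _))//.
have -> : complex.Re (z - g0 (k1, k2)) = complex.Re z - gr k1 by case: (z).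
have -> : complex.Im (z - g0 (k1, k2)) = complex.Im z - gr k2 by case: (z).
apply: (le_trans (lerD b1 b2)).
have -> : n.+1%:R^-1 + n.+1%:R^-1 = 2%:R / n.+1%:R :> R by rewrite mulr_natl mulr2n.
rewrite ler_pdivrMr ?ltr0n// mulrC -ler_pdivrMr//.
apply: (le_trans (ltW (archi_boundP _))); first by rewrite divr_ge0// ltW.
by rewrite ler_nat.
Qed.

(** The partition is indexed by the net: its size depends on the precision only, and
not on x.  Coefficients of nonzero projections are at most 1 + d, hence at distance
at most d from the disc, and at most 2 d from the net. *)
Lemma net_approximation (A : cstarAlgType R) (K : finType) (g : K -> R[i]) (d : R) :
  commutative (@cmul R A) -> approximable A -> 0 < d ->
  (forall z, cnorm z <= 1 -> exists k, cnorm (z - g k) <= d) ->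
  forall x : A, cnorm x <= 1 -> exists2 e : K -> A, partition_of_unity e &
    cnorm (x - combination e g) <= 3%:R * d.
Proof.
move=> cA ap d0 net x x1.
have [J [f [c [fp xc]]]] := ap x d d0.
have zP j : exists k, f j != 0 -> cnorm (c j - g k) <= 2%:R * d.
  pose m := Num.max 1 (cnorm (c j)).
  have m1 : 1 <= m by rewrite le_max lexx.
  have m0 : 0 < m by exact: lt_le_trans m1.
  have cm : cnorm (m^-1%:C * c j) = cnorm (c j) / m.
    by rewrite cnormMC cnorm_real ger0_norm 1?mulrC// invr_ge0 ltW.
  have [|k kP] := net (m^-1%:C * c j).
    by rewrite cm ler_pdivrMr// mul1r le_max lexx orbT.
  exists k => fj; apply: (le_trans (cnorm_triangle _ (m^-1%:C * c j) _)).
  rewrite mulr_natl mulr2n lerD//.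
  have -> : c j - m^-1%:C * c j = (1 - m^-1)%:C * c j by rewrite rmorphB/= rmorph1 mulrBl mul1r.
  rewrite cnormMC cnorm_real ger0_norm; last by rewrite subr_ge0 invf_le1.
  have cj : cnorm (c j) <= 1 + d.
    apply: (le_trans (cnorm_combination_ge fp.1 c fj)).
    by rewrite (le_trans (cnorm_subl _ x))// cnormB addrC lerD.
  have : m <= 1 + d by rewrite ge_max cj lerDl ltW.
  have : cnorm (c j) <= m by rewrite le_max lexx orbT.
  move=> h1 h2; rewrite mulrBl mul1r.
  have := cnorm_ge0 (c j) => c0.
  rewrite lerBlDr -lerBlDl.
  have [cj1|cj1] := leP (cnorm (c j)) 1.
    have -> : m = 1 by apply/max_idPl.
    by rewrite invr1 mul1r lerBlDr lerDl ltW.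
  have -> : m = cnorm (c j) by apply/max_idPr/ltW.
  by rewrite mulVf ?gt_eqF ?(lt_trans _ cj1)// lerBlDr.
have [k kP] := choice zP.
exists (fun i => \sum_(j | k j == i) f j); first exact: coarsen_partition.
rewrite combination_coarsen (le_trans (cnorm_triangle _ (combination f c) _))//.
have -> : 3%:R * d = d + 2%:R * d by ring.
rewrite lerD// combinationB; apply: cnorm_combination_le => //; first exact: fp.1.
by rewrite mulr_ge0// ltW.
Qed.

End Approximation.

(** * Bounds and moduli of continuity of formulae *)

Section SupInf.
Context {R : realType}.

Lemma sup_image_le (T T' : Type) (D : set T) (E : set T') (f : T -> R) (g : T' -> R) (eps M : R) :
  D !=set0 -> (forall y, E y -> g y <= M) ->
  (forall x, D x -> exists2 y, E y & f x <= g y + eps) ->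
  sup [set f x | x in D] <= sup [set g y | y in E] + eps.
Proof.
move=> [x0 Dx0] gM fg; apply: ge_sup; first by exists (f x0), x0.
move=> _ [x Dx <-]; have [y Ey fgy] := fg x Dx.
rewrite (le_trans fgy)// lerD2r; apply: ub_le_sup; last by exists y.
by exists M => _ [z Ez <-]; exact: gM.
Qed.

Lemma sup_image_ge (T : Type) (D : set T) (f : T -> R) (M : R) x :
  (forall y, D y -> f y <= M) -> D x -> f x <= sup [set f x | x in D].
Proof.
move=> fM Dx; apply: ub_le_sup; last by exists x.
by exists M => _ [z Ez <-]; exact: fM.
Qed.

Lemma inf_image_opp (T : Type) (D : set T) (f : T -> R) :
  inf [set f x | x in D] = - sup [set - f x | x in D].
Proof.
rewrite /inf; congr (- sup _); apply/seteqP; split=> [_ [_ [x Dx <-] <-]|_ [x Dx <-]].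
  by exists x.
by exists (f x) => //; exists x.
Qed.

Lemma sup_image_norm_le (T : Type) (D : set T) (f : T -> R) (M : R) :
  D !=set0 -> (forall y, D y -> `|f y| <= M) -> `|sup [set f x | x in D]| <= M.
Proof.
move=> [x0 Dx0] fM; have fM' y : D y -> f y <= M by move=> /fM; apply: le_trans (ler_norm _).
rewrite ler_norml; apply/andP; split.
  apply: le_trans (sup_image_ge fM' Dx0).
  by have := fM _ Dx0; rewrite ler_norml => /andP[].
by apply: ge_sup => [|_ [x Dx <-]]; [exists (f x0), x0|exact: fM'].
Qed.

Lemma sup_image_dist (T T' : Type) (D : set T) (E : set T') (f : T -> R) (g : T' -> R) (eps M N : R) :
  D !=set0 -> E !=set0 -> (forall x, D x -> f x <= M) -> (forall y, E y -> g y <= N) ->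
  (forall x, D x -> exists2 y, E y & f x <= g y + eps) ->
  (forall y, E y -> exists2 x, D x & g y <= f x + eps) ->
  `|sup [set f x | x in D] - sup [set g y | y in E]| <= eps.
Proof.
move=> D0 E0 fM gN fg gf; rewrite ler_distlC.
by rewrite lerBlDr (sup_image_le E0 fM gf) (sup_image_le D0 gN fg).
Qed.

Lemma inf_image_dist (T T' : Type) (D : set T) (E : set T') (f : T -> R) (g : T' -> R) (eps M N : R) :
  D !=set0 -> E !=set0 -> (forall x, D x -> M <= f x) -> (forall y, E y -> N <= g y) ->
  (forall x, D x -> exists2 y, E y & g y <= f x + eps) ->
  (forall y, E y -> exists2 x, D x & f x <= g y + eps) ->
  `|inf [set f x | x in D] - inf [set g y | y in E]| <= eps.
Proof.
move=> D0 E0 fM gN fg gf; rewrite !inf_image_opp -opprD normrN.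
apply: (@sup_image_dist _ _ _ _ _ _ _ (- M) (- N)) => //.
- by move=> x /fM; rewrite lerN2.
- by move=> x /gN; rewrite lerN2.
- by move=> x /fg[y Ey h]; exists y => //; move: h; lra.
- by move=> x /gf[y Ey h]; exists y => //; move: h; lra.
Qed.

End SupInf.

Section FormulaRegularity.
Context {R : realType}.

(** Heine's theorem; only one of the two points is required to be in the box. *)
Lemma continuous_box_unif m (f : 'rV[R]_m -> R) (M eps : R) : continuous f -> 0 < eps ->
  exists2 d : R, 0 < d & forall u v : 'rV[R]_m, (forall i, `|u 0 i| <= M) ->
    (forall i, `|u 0 i - v 0 i| <= d) -> `|f u - f v| <= eps.
Proof.
move=> fc e0.
have cK : compact [set v : 'rV[R]_m | forall i, [set` `[- M, M]] (v ord0 i)].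
  by apply: (@rV_compact R m (fun=> [set` `[- M, M]])) => i; exact: segment_compact.
have e2 : 0 < eps / 2%:R by rewrite divr_gt0.
pose P (d : R) (u : 'rV[R]_m) := forall v : 'rV[R]_m,
  (forall i, `|u 0 i - v 0 i| <= d) -> `|f u - f v| <= eps.
have Pnear : \forall d \near 0^'+, [set v : 'rV[R]_m | forall i, [set` `[- M, M]] (v ord0 i)] `<=` P d.
  apply: (iffLR (compact_near_coveringP _)) cK _ _ _ _ _ => x _.
  have /nbhs_ballP[r /= r0 rf] : nbhs x [set y | `|f x - f y| < eps / 2%:R].
    by have /cvgrPdist_lt/(_ _ e2) := fc x.
  have r2 : 0 < r / 2%:R by rewrite divr_gt0.
  have rf' (y : 'rV[R]_m) : (forall i, `|x 0 i - y 0 i| < r) -> `|f x - f y| < eps / 2%:R.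
    move=> xy; apply: rf; split=> // i j; rewrite (ord1 i); exact: xy.
  exists (ball x (r / 2%:R), [set d | d < r / 2%:R]).
    by split=> /=; [apply: nbhsx_ballx|exact: nbhs_right_lt].
  move=> [x' d] /= [xx' dr] v x'v.
  have xx'i i : `|x 0 i - x' 0 i| < r / 2%:R by have [_ /(_ 0 i)] := xx'.
  rewrite (le_trans (ler_distD (f x) _ _))// [leRHS]splitr lerD//; apply: ltW.
    rewrite distrC; apply: rf' => i; apply: lt_trans (xx'i i) _.
    by rewrite ltr_pdivrMr// ltr_pMr// ltr1n.
  apply: rf' => i; apply: (le_lt_trans (ler_distD (x' 0 i) _ _)).
  by rewrite [ltRHS]splitr ltrD// (le_lt_trans (x'v i)).
have /filter_ex[d [d0 Pd]] : \forall d \near 0^'+, 0 < d /\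
    [set v : 'rV[R]_m | forall i, [set` `[- M, M]] (v ord0 i)] `<=` P d.
  by apply: filterI => //; exact: nbhs_right_gt.
exists d => // u v uM uv; apply: (Pd u) => // i /=.
by rewrite in_itv/= -ler_norml.
Qed.

Lemma continuous_box_bounded m (f : 'rV[R]_m -> R) (M : R) : continuous f ->
  exists2 N : R, 0 <= N & forall u : 'rV[R]_m, (forall i, `|u 0 i| <= M) -> `|f u| <= N.
Proof.
move=> fc.
have cK : compact [set v : 'rV[R]_m | forall i, [set` `[- M, M]] (v ord0 i)].
  by apply: (@rV_compact R m (fun=> [set` `[- M, M]])) => i; exact: segment_compact.
have : compact (f @` [set v : 'rV[R]_m | forall i, [set` `[- M, M]] (v ord0 i)]).
  by apply: continuous_compact cK; exact: continuous_subspaceT.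
move=> /compact_bounded/ex_strict_bound_gt0[N N0 NP].
exists N; first exact: ltW.
move=> u uM; apply/ltW/NP; exists u => // i /=.
by rewrite in_itv/= -ler_norml.
Qed.

Definition env_in_ball (A : cstarAlgType R) n (v : 'I_n -> A) : Prop :=
  forall i, cnorm (v i) <= 1.

Lemma env_cons0 (T : Type) n (x : T) (v : 'I_n -> T) : env_cons x v ord0 = x.
Proof. by rewrite /env_cons unlift_none. Qed.

Lemma env_consS (T : Type) n (x : T) (v : 'I_n -> T) j : env_cons x v (lift ord0 j) = v j.
Proof. by rewrite /env_cons liftK. Qed.

Lemma env_consP (T : Type) n (x : T) (v : 'I_n -> T) (P : 'I_n.+1 -> T -> Prop) :
  P ord0 x -> (forall j, P (lift ord0 j) (v j)) -> forall i, P i (env_cons x v i).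
Proof.
move=> Px Pv i; case: (unliftP ord0 i) => [j ->|->]; first by rewrite env_consS.
by rewrite env_cons0.
Qed.

Lemma unit_ball_nonempty (A : cstarAlgType R) : @unit_ball R A !=set0.
Proof. by exists 0; rewrite /unit_ball/= cnorm0. Qed.

Lemma star_poly_bounded n (P : star_poly n) : exists2 M : R, 0 <= M &
  forall (A : cstarAlgType R) (v : 'I_n -> A), env_in_ball v -> cnorm (star_poly_eval P v) <= M.
Proof.
elim: P => [i||P [M M0 PM] Q [N N0 QN]|P [M M0 PM] Q [N N0 QN]|l P [M M0 PM]|P [M M0 PM]].
- by exists 1 => // A v vb; exact: vb.
- by exists 0 => // A v vb /=; rewrite cnorm0.
- exists (M + N); first exact: addr_ge0.
  by move=> A v vb /=; rewrite (le_trans (cnormD _ _))// lerD ?PM ?QN.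
- exists (M * N); first exact: mulr_ge0.
  by move=> A v vb /=; rewrite (le_trans (cnormM _ _))// ler_pM ?cnorm_ge0 ?PM ?QN.
- exists (cnorm l * M); first by rewrite mulr_ge0// cnorm_ge0.
  by move=> A v vb /=; rewrite cnormZ ler_wpM2l ?cnorm_ge0 ?PM.
- by exists M => // A v vb /=; rewrite cnorm_cstar PM.
Qed.

Lemma star_poly_lipschitz n (P : star_poly n) : exists2 L : R, 0 <= L &
  forall (A : cstarAlgType R) (v w : 'I_n -> A) (d : R), env_in_ball v -> env_in_ball w ->
    0 <= d -> (forall i, cnorm (v i - w i) <= d) ->
    cnorm (star_poly_eval P v - star_poly_eval P w) <= L * d.
Proof.
elim: P => [i||P [M M0 PM] Q [N N0 QN]|P [M M0 PM] Q [N N0 QN]|l P [M M0 PM]|P [M M0 PM]].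
- by exists 1 => // A v w d _ _ _ vw; rewrite mul1r; exact: vw.
- by exists 0 => // A v w d _ _ _ _ /=; rewrite subrr cnorm0 mul0r.
- exists (M + N); first exact: addr_ge0.
  move=> A v w d vb wb d0 vw /=; rewrite opprD addrACA (le_trans (cnormD _ _))// mulrDl.
  by rewrite lerD ?PM ?QN.
- have [B B0 PB] := star_poly_bounded P; have [C C0 QC] := star_poly_bounded Q.
  exists (M * C + B * N); first by rewrite addr_ge0// mulr_ge0.
  move=> A v w d vb wb d0 vw /=.
  rewrite (le_trans (cnorm_triangle _ (cmul (star_poly_eval P w) (star_poly_eval Q v)) _))//.
  rewrite -cmulBl -cmulBr mulrDl lerD// (le_trans (cnormM _ _))//.
    by rewrite mulrAC ler_pM ?cnorm_ge0 ?PM ?QC.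
  by rewrite -mulrA ler_pM ?cnorm_ge0 ?PB ?QN.
- exists (cnorm l * M); first by rewrite mulr_ge0// cnorm_ge0.
  by move=> A v w d vb wb d0 vw /=; rewrite -scalerBr cnormZ -mulrA ler_wpM2l ?cnorm_ge0 ?PM.
- by exists M => // A v w d vb wb d0 vw /=; rewrite -cstarB cnorm_cstar PM.
Qed.

Lemma env_in_ball_cons (A : cstarAlgType R) k (v : 'I_k -> A) x :
  env_in_ball v -> unit_ball x -> env_in_ball (env_cons x v).
Proof. by move=> vb xb; apply: (env_consP (P := fun _ y => cnorm y <= 1)). Qed.

Lemma formula_bounded n (phi : formula n) : exists2 M : R, 0 <= M &
  forall (A : cstarAlgType R) (v : 'I_n -> A), env_in_ball v -> `|formula_eval phi v| <= M.
Proof.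
elim: phi => {n} [n P|n m f fc psi ih|n psi [M M0 psiM]|n psi [M M0 psiM]].
- have [M M0 PM] := star_poly_bounded P; exists M => // A v vb /=.
  by rewrite ger0_norm ?cnorm_ge0// PM.
- have [M psiM] := choice (fun i => let: ex_intro2 M M0 h := ih i in ex_intro (fun M => _ /\ _) M (conj M0 h)).
  pose B := \sum_i M i.
  have MB i : M i <= B by rewrite /B (bigD1 i)//= lerDl sumr_ge0// => j _; have [] := psiM j.
  have [N N0 fN] := continuous_box_bounded B fc.
  exists N => // A v vb /=; apply: fN => i; rewrite mxE.
  by apply: le_trans (MB i); have [_] := psiM i; exact.
- exists M => // A v vb /=; apply: sup_image_norm_le => [|x xb]; first exact: unit_ball_nonempty.
  by apply: psiM; exact: env_in_ball_cons.
- exists M => // A v vb /=; rewrite inf_image_opp normrN.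
  apply: sup_image_norm_le => [|x xb]; first exact: unit_ball_nonempty.
  by rewrite normrN; apply: psiM; exact: env_in_ball_cons.
Qed.

Lemma formula_upper_bound n (phi : formula n.+1) (A : cstarAlgType R) (v : 'I_n -> A) :
  env_in_ball v -> exists M : R, forall x, unit_ball x ->
    - M <= formula_eval phi (env_cons x v) <= M.
Proof.
move=> vb; have [M _ phiM] := formula_bounded phi; exists M => x xb.
by rewrite -ler_norml phiM//; exact: env_in_ball_cons.
Qed.

Lemma formula_quantifier_dist n (phi : formula n.+1) (A B : cstarAlgType R)
    (v : 'I_n -> A) (w : 'I_n -> B) (eps : R) : env_in_ball v -> env_in_ball w ->
  (forall x, unit_ball x -> exists2 y, unit_ball y &
    `|formula_eval phi (env_cons x v) - formula_eval phi (env_cons y w)| <= eps) ->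
  (forall y, unit_ball y -> exists2 x, unit_ball x &
    `|formula_eval phi (env_cons x v) - formula_eval phi (env_cons y w)| <= eps) ->
  `|formula_eval (FSup phi) v - formula_eval (FSup phi) w| <= eps /\
  `|formula_eval (FInf phi) v - formula_eval (FInf phi) w| <= eps.
Proof.
move=> vb wb vw wv.
have [M vM] := formula_upper_bound phi vb; have [N wN] := formula_upper_bound phi wb.
have A0 := unit_ball_nonempty A; have B0 := unit_ball_nonempty B.
split=> /=.
- apply: (@sup_image_dist _ _ _ _ _ _ _ _ M N) => //.
  + by move=> x /vM/andP[].
  + by move=> x /wN/andP[].
  + by move=> x /vw[y yb h]; exists y => //; move: h; rewrite ler_norml; lra.
  + by move=> x /wv[y yb h]; exists y => //; move: h; rewrite ler_norml; lra.
- apply: (@inf_image_dist _ _ _ _ _ _ _ _ (- M) (- N)) => //.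
  + by move=> x /vM/andP[].
  + by move=> x /wN/andP[].
  + by move=> x /vw[y yb h]; exists y => //; move: h; rewrite ler_norml; lra.
  + by move=> x /wv[y yb h]; exists y => //; move: h; rewrite ler_norml; lra.
Qed.

Lemma formula_connective_unif n m (f : 'rV[R]_m -> R) (psi : 'I_m -> formula n) (eps : R) :
  continuous f -> 0 < eps -> exists2 d : R, 0 < d &
  forall (A B : cstarAlgType R) (v : 'I_n -> A) (w : 'I_n -> B), env_in_ball v ->
    (forall i, `|formula_eval (psi i) v - formula_eval (psi i) w| <= d) ->
    `|f (\row_i formula_eval (psi i) v) - f (\row_i formula_eval (psi i) w)| <= eps.
Proof.
move=> fc e0.
have [M psiM] := choice (fun i => let: ex_intro2 M M0 h := formula_bounded (psi i) in
  ex_intro (fun M => _ /\ _) M (conj M0 h)).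
pose B := \sum_i M i.
have MB i : M i <= B by rewrite /B (bigD1 i)//= lerDl sumr_ge0// => j _; have [] := psiM j.
have [d d0 fd] := continuous_box_unif B fc e0.
exists d => // A A' v w vb vw; apply: fd => i; rewrite !mxE//.
by apply: le_trans (MB i); have [_] := psiM i; exact.
Qed.

Lemma cnorm_dist (V : normedZmodType R[i]) (x y : V) : `|cnorm x - cnorm y| <= cnorm (x - y).
Proof.
have := cnorm_subl x y; have := cnorm_subl y x.
by rewrite (cnormB y x) ler_norml; lra.
Qed.

Lemma min_positive m (d : 'I_m -> R) : (forall i, 0 < d i) -> exists2 e : R, 0 < e & forall i, e <= d i.
Proof.
move=> d0; exists (\big[Num.min/1]_i d i).
  by apply: lt_bigmin => //.
by move=> i; exact: bigmin_le_cond.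
Qed.

(** The modulus is the same for all algebras, which makes it usable when two algebras
are compared. *)
Lemma formula_unif_continuous n (phi : formula n) (eps : R) : 0 < eps ->
  exists2 d : R, 0 < d & forall (A : cstarAlgType R) (v w : 'I_n -> A),
    env_in_ball v -> env_in_ball w -> (forall i, cnorm (v i - w i) <= d) ->
    `|formula_eval phi v - formula_eval phi w| <= eps.
Proof.
have quant k (psi : formula k.+1) (A : cstarAlgType R) (v w : 'I_k -> A) (d e : R) :
    0 < d -> (forall (A : cstarAlgType R) (v w : 'I_k.+1 -> A),
    env_in_ball v -> env_in_ball w -> (forall i, cnorm (v i - w i) <= d) ->
    `|formula_eval psi v - formula_eval psi w| <= e) ->
    env_in_ball v -> env_in_ball w -> (forall i, cnorm (v i - w i) <= d) ->
    `|formula_eval (FSup psi) v - formula_eval (FSup psi) w| <= e /\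
    `|formula_eval (FInf psi) v - formula_eval (FInf psi) w| <= e.
  move=> d0 psid vb wb vw.
  have h x : unit_ball x -> `|formula_eval psi (env_cons x v) - formula_eval psi (env_cons x w)| <= e.
    move=> xb; apply: psid; try exact: env_in_ball_cons.
    move=> i; case: (unliftP ord0 i) => [j ->|->]; rewrite ?env_consS// !env_cons0 subrr cnorm0.
    exact: ltW.
  by apply: formula_quantifier_dist => // x xb; exists x => //; exact: h.
elim: phi eps => {n} [n P|n m f fc psi ih|n psi ih|n psi ih] eps e0.
- have [L L0 PL] := star_poly_lipschitz P.
  exists (eps / (L + 1)); first by rewrite divr_gt0// ltr_wpDl.
  move=> A v w vb wb vw /=.
  have h : cnorm (star_poly_eval P v - star_poly_eval P w) <= eps.
    apply: le_trans (PL _ _ _ _ vb wb _ vw) _.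
      by rewrite divr_ge0 ?addr_ge0// ltW.
    rewrite mulrCA ger_pMr// ler_pdivrMr ?mul1r ?lerDl// ltr_wpDl//.
  exact: le_trans (cnorm_dist _ _) h.
- have [d d0 fd] := formula_connective_unif psi fc e0.
  have [d' d'P] := choice (fun i => let: ex_intro2 M M0 h := ih i d d0 in
    ex_intro (fun M => _ /\ _) M (conj M0 h)).
  have [|c c0 cd] := @min_positive _ d'; first by move=> i; have [] := d'P i.
  exists c => // A v w vb wb vw /=; apply: fd => // i.
  have [_] := d'P i; apply=> // j; exact: le_trans (vw j) (cd i).
- have [d d0 psid] := ih eps e0; exists d => // A v w vb wb vw.
  by have [] := quant _ _ _ _ _ _ _ d0 psid vb wb vw.
- have [d d0 psid] := ih eps e0; exists d => // A v w vb wb vw.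
  by have [] := quant _ _ _ _ _ _ _ d0 psid vb wb vw.
Qed.

End FormulaRegularity.

(** * The theorem of Los *)

Section Los.
Context {R : realType} {I : Type} (U : ultrafilter I) (F : I -> cstarAlgType R).
Local Notation upi := (ultra_pi U).

Lemma ultra_pi_ball (a : bounded_family F) : (forall i, unit_ball (a i)) -> unit_ball (upi a : ultraproduct U F).
Proof.
move=> a1; rewrite /unit_ball/= cnorm_upi.
by apply: (@unorm_le _ _ _ _ _ (cst 1)) => //; exact: cvg_cst.
Qed.

(** A representative may leave the ball slightly; dividing it coordinatewise by
max 1 ||a i|| changes it by a null family. *)
Lemma ultra_lift_ball (x : ultraproduct U F) : unit_ball x ->
  exists2 b : bounded_family F, upi b = x & forall i, unit_ball (b i).
Proof.
rewrite -(upi_repr x); move: (repr x) => {x}a; rewrite /unit_ball/= cnorm_upi => a1.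
pose m i : R := Num.max 1 (cnorm (a i)).
have m1 i : 1 <= m i by rewrite le_max lexx.
have m0 i : 0 < m i by exact: lt_le_trans (m1 i).
have am i : cnorm (a i) <= m i by rewrite le_max lexx orbT.
pose f i : F i := (m i)^-1%:C *: a i.
have f1 i : cnorm (f i) <= 1.
  rewrite cnormZ cnorm_real ger0_norm; last by rewrite invr_ge0 ltW.
  by rewrite mulrC ler_pdivrMr ?m0 ?mul1r ?am.
have bf : exists M : R, forall i, cnorm (f i) <= M by exists 1.
exists (BoundedFamily bf) => //; apply/upi_eq/null_familyP/cvgr0Pnorm_le => e e0.
have : \forall i \near ultrafilter_set U, cnorm (a i) < 1 + e.
  apply: (cvgr_lt _ (@unorm_cvg _ _ U _ a)).
  by rewrite (le_lt_trans a1)// ltrDl.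
apply: filterS => i aie /=; rewrite ger0_norm ?cnorm_ge0//.
have -> : f i - a i = ((m i)^-1 - 1)%:C *: a i.
  by rewrite rmorphB/= rmorph1 scalerBl scale1r.
rewrite cnormZ cnorm_real distrC ger0_norm ?subr_ge0 ?invf_le1//.
rewrite (@le_trans _ _ (m i - 1))//.
  rewrite (le_trans (ler_wpM2l _ (am i)))// ?subr_ge0 ?invf_le1//.
  by rewrite mulrBl mul1r mulVf ?gt_eqF.
by rewrite lerBlDl ge_max lerDl ltW//= ltW.
Qed.

(** An element which is almost optimal in the ultraproduct lifts to almost optimal
coordinates, and almost optimal coordinates form an element of the ultraproduct. *)
Lemma ultraproduct_sup_cvg (G : forall i, F i -> R) (G' : ultraproduct U F -> R) (M : R) :
  (forall b : bounded_family F, (forall i, unit_ball (b i)) ->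
     G i (b i) @[i --> ultrafilter_set U] --> G' (upi b)) ->
  (forall i x, unit_ball x -> `|G i x| <= M) -> (forall x, unit_ball x -> `|G' x| <= M) ->
  sup [set G i x | x in @unit_ball R (F i)] @[i --> ultrafilter_set U]
    --> sup [set G' x | x in @unit_ball R (ultraproduct U F)].
Proof.
move=> GG' GM G'M; set s := sup _.
have GM' i y : unit_ball y -> G i y <= M by move=> /GM; apply: le_trans (ler_norm _).
have G'M' y : unit_ball y -> G' y <= M by move=> /G'M; apply: le_trans (ler_norm _).
apply/cvgrPdist_le => e e0; have e2 : 0 < e / 2%:R by rewrite divr_gt0.
have hasup (A : cstarAlgType R) (g : A -> R) : (forall y, unit_ball y -> g y <= M) ->
    has_sup [set g x | x in @unit_ball R A].
  move=> gM; split; first by have [x xb] := unit_ball_nonempty A; exists (g x), x.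
  by exists M => _ [x xb <-]; exact: gM.
have [_ [x xb <-] sx] := sup_adherent e2 (hasup _ _ G'M').
have [b bx bb] := ultra_lift_ball xb.
have cex i : exists c : F i, unit_ball c /\ sup [set G i x | x in @unit_ball R (F i)] - e / 2%:R < G i c.
  by have [_ [c cb <-] h] := sup_adherent e2 (hasup _ _ (GM' i)); exists c.
pose c i := sval (cid (cex i)).
have cP i : unit_ball (c i) /\ sup [set G i x | x in @unit_ball R (F i)] - e / 2%:R < G i (c i) := svalP (cid (cex i)).
have bc : exists N : R, forall i, cnorm (c i) <= N by exists 1 => i; exact: (cP i).1.
pose C := BoundedFamily bc.
have Cb i : unit_ball (C i) by exact: (cP i).1.
have e20 := e2.
have near1 := cvgr_gt _ (GG' b bb); have near2 := cvgr_lt _ (GG' C Cb).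
have {}near1 : \forall i \near ultrafilter_set U, s - e < G i (b i).
  apply: near1; rewrite bx; move: sx; rewrite -/s => sx; lra.
have {}near2 : \forall i \near ultrafilter_set U, G i (C i) < s + e / 2%:R.
  apply: near2; have : G' (upi C) <= s by apply: sup_image_ge G'M' _; exact: ultra_pi_ball.
  by lra.
apply: filterS2 near1 near2 => i h1 h2.
have h3 : G i (b i) <= sup [set G i x | x in @unit_ball R (F i)] by apply: sup_image_ge (bb i); exact: GM'.
have h4 := (cP i).2; rewrite /= in h2.
by rewrite ler_norml; lra.
Qed.

Lemma ultraproduct_inf_cvg (G : forall i, F i -> R) (G' : ultraproduct U F -> R) (M : R) :
  (forall b : bounded_family F, (forall i, unit_ball (b i)) ->
     G i (b i) @[i --> ultrafilter_set U] --> G' (upi b)) ->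
  (forall i x, unit_ball x -> `|G i x| <= M) -> (forall x, unit_ball x -> `|G' x| <= M) ->
  inf [set G i x | x in @unit_ball R (F i)] @[i --> ultrafilter_set U]
    --> inf [set G' x | x in @unit_ball R (ultraproduct U F)].
Proof.
move=> GG' GM G'M; rewrite inf_image_opp; under eq_fun do rewrite inf_image_opp.
apply: cvgN; apply: (@ultraproduct_sup_cvg (fun i x => - G i x) (fun x => - G' x) M).
- by move=> b bb; apply: cvgN; exact: GG'.
- by move=> i x /GM; rewrite normrN.
- by move=> x /G'M; rewrite normrN.
Qed.

Lemma ultra_star_poly n (P : star_poly n) (a : 'I_n -> bounded_family F) :
  exists2 b : bounded_family F, (forall i, b i = star_poly_eval P (fun j => a j i)) &
    star_poly_eval P (fun j => upi (a j) : ultraproduct U F) = upi b.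
Proof.
elim: P => [j||P [b bP bE] Q [c cP cE]|P [b bP bE] Q [c cP cE]|l P [b bP bE]|P [b bP bE]] /=.
- by exists (a j).
- by exists 0; rewrite ?upi0.
- by exists (b + c); rewrite ?upiD ?bE ?cE// => i; rewrite -bP -cP.
- by exists (bfamM b c); rewrite -?upiM ?bE ?cE// => i; rewrite -bP -cP.
- by exists (bfamZ l b); rewrite ?upiZE ?bE// => i; rewrite -bP.
- by exists (bfamS b); rewrite -?upiS ?bE// => i; rewrite -bP.
Qed.

Let los_env k (psi : formula k.+1) (a : 'I_k -> bounded_family F) (b : bounded_family F) :
    (forall a : 'I_k.+1 -> bounded_family F, (forall j i, unit_ball (a j i)) ->
      formula_eval psi (fun j => a j i) @[i --> ultrafilter_set U]
        --> formula_eval psi (fun j => upi (a j) : ultraproduct U F)) ->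
    (forall j i, unit_ball (a j i)) -> (forall i, unit_ball (b i)) ->
    formula_eval psi (env_cons (b i) (fun j => a j i)) @[i --> ultrafilter_set U]
      --> formula_eval psi (env_cons (upi b : ultraproduct U F) (fun j => upi (a j))).
Proof.
move=> ih ab bb; have := ih (env_cons b a).
  have -> : (fun j => upi (env_cons b a j) : ultraproduct U F) = env_cons (upi b) (fun j => upi (a j)).
    apply/funext => j; rewrite /env_cons; case: (unlift ord0 j) => //.
  have -> : (fun i => formula_eval psi (fun j => env_cons b a j i)) =
      (fun i => formula_eval psi (env_cons (b i) (fun j => a j i))).
    apply/funext => i; congr formula_eval; apply/funext => j; rewrite /env_cons; case: (unlift ord0 j) => //.
by apply; apply: (env_consP (P := fun _ (y : bounded_family F) => forall i, unit_ball (y i))).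
Qed.


Theorem los n (phi : formula n) (a : 'I_n -> bounded_family F) :
  (forall j i, unit_ball (a j i)) ->
  formula_eval phi (fun j => a j i) @[i --> ultrafilter_set U]
    --> formula_eval phi (fun j => upi (a j) : ultraproduct U F).
Proof.
elim: phi a => {n} [n P|n m f fc psi ih|n psi ih|n psi ih] a ab /=.
- have [b bP ->] := ultra_star_poly P a.
  rewrite cnorm_upi; under eq_fun do rewrite -bP.
  exact: unorm_cvg.
- pose g i := \row_(k < m) formula_eval (psi k) (fun j => a j i).
  apply: (@continuous_cvg _ _ _ _ _ g f); first exact: fc.
  apply/cvg_ballP => e e0; suff : \forall i \near ultrafilter_set U, forall k,
      ball (formula_eval (psi k) (fun j => upi (a j) : ultraproduct U F)) e
           (formula_eval (psi k) (fun j => a j i)).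
    by apply: filterS => i h; split=> // ? k; rewrite !mxE; exact: h.
  by apply: filter_forall => k; have /cvg_ballP/(_ _ e0) := ih k a ab.
- have [M _ psiM] := formula_bounded psi.
  apply: ultraproduct_sup_cvg => [b bb|i x xb|x xb].
  + exact: los_env.
  + by apply: psiM; apply: env_in_ball_cons => // j; exact: ab.
  + by apply: psiM; apply: env_in_ball_cons => // j; apply: ultra_pi_ball.
- have [M _ psiM] := formula_bounded psi.
  apply: ultraproduct_inf_cvg => [b bb|i x xb|x xb].
  + exact: los_env.
  + by apply: psiM; apply: env_in_ball_cons => // j; exact: ab.
  + by apply: psiM; apply: env_in_ball_cons => // j; apply: ultra_pi_ball.
Qed.
End Los.

(** * Counting minimal projections *)

Section Atoms.
Context {R : realType} (A : cstarAlgType R) (H : comm_unital A).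
Implicit Types (p q a b : A) (s : seq A).

Definition has_atoms p k : Prop := exists s, [/\ uniq s, size s = k &
  {in s, forall a, minimal_projection a /\ cmul p a = a}].

Lemma has_atoms_le p k l : (k <= l)%N -> has_atoms p l -> has_atoms p k.
Proof.
move=> kl [s [us ss sp]]; exists (take k s); split; first exact: take_uniq.
  by rewrite size_take ss; case: ltngtP kl => // <-.
by move=> a /mem_take; exact: sp.
Qed.

Lemma has_atoms0 p : has_atoms p 0.
Proof. by exists [::]. Qed.

Lemma minimal_projection_orthogonal a b : minimal_projection a -> minimal_projection b ->
  a != b -> cmul a b = 0.
Proof.
move=> am bm ab; have [_ _ _] := am.
have [//|h1] := minimal_subprojection H bm (let: And3 h _ _ := am in h).
have [h|h2] := minimal_subprojection H am (let: And3 h _ _ := bm in h).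
  by rewrite (cu_comm H).
by case/eqP: ab; rewrite -[LHS]h2 (cu_comm H) h1.
Qed.

Lemma has_atomsD p q k : is_projection p -> is_projection q -> cmul p q = 0 ->
  has_atoms (p + q) k <-> exists k1 k2, [/\ (k1 + k2)%N = k, has_atoms p k1 & has_atoms q k2].
Proof.
move=> pp qp pq; split=> [[s [us ss sp]]|[k1 [k2 [<- [s [us <- sp]] [t [ut <- tp]]]]]].
  exists (count (fun a => cmul p a == a) s), (count (predC (fun a => cmul p a == a)) s).
  split; first by rewrite count_predC.
    exists [seq a <- s | cmul p a == a]; rewrite filter_uniq// size_filter; split=> //.
    by move=> a; rewrite mem_filter => /andP[/eqP pa /sp[am _]].
  exists [seq a <- s | cmul p a != a]; rewrite filter_uniq// size_filter; split=> //.
  move=> a; rewrite mem_filter => /andP[/eqP pa /sp[am]]; split=> //.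
  by have [h|//] := minimal_subprojection H am pp; rewrite cmulDl h add0r in b.
exists (s ++ t); rewrite size_cat; split=> // [|a].
  rewrite cat_uniq us ut andbT; apply/hasPn => a /tp[[_ a0 _] qa]; apply/negP => /sp[_ pa].
  by move: a0; rewrite -pa -qa cmulA pq cmul0x eqxx.
rewrite mem_cat => /orP[/sp|/tp] [am ea]; split=> //; rewrite cmulDl ea.
  by rewrite -[in cmul q a]ea cmulA (cu_comm H q) pq cmul0x addr0.
by rewrite -[in cmul p a]ea cmulA pq cmul0x add0r.
Qed.

Lemma sum_atoms_projection s : uniq s -> {in s, forall a, minimal_projection a} ->
  is_projection (\sum_(a <- s) a) /\ forall b, minimal_projection b -> b \notin s ->
    cmul b (\sum_(a <- s) a) = 0.
Proof.
move=> us sm; split; last first.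
  move=> b bm bs; rewrite cmul_sumr big_seq big1// => a as_.
  apply: minimal_projection_orthogonal => //; first exact: sm.
  by apply: contraNneq bs => ->.
elim: s us sm => [_ _|a s ih /= /andP[as_ us] sm]; rewrite ?big_nil ?big_cons.
  by split; rewrite ?cstar0 ?cmul0x.
have am := sm a (mem_head _ _).
apply: (projectionD (cu_comm H)); first by have [] := am.
  by apply: ih => // b bs; apply: sm; rewrite inE bs orbT.
rewrite cmul_sumr big_seq big1// => b bs.
apply: minimal_projection_orthogonal => //; first by apply: sm; rewrite inE bs orbT.
by apply: contraNneq as_ => ->.
Qed.

Lemma has_atoms_minimal a k : minimal_projection a -> has_atoms a k <-> (k <= 1)%N.
Proof.
move=> am; split=> [[s [us <- sa]]|k1].
  rewrite -[1%N]/(size [:: a]); apply: uniq_leq_size => // b bs.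
  have [[bp b0 _] ab] := sa b bs; have [_ _ amin] := am.
  have [/eqP|->] := amin b (And3 bp ab (etrans (cu_comm H _ _) ab)); last exact: mem_head.
  by rewrite (negPf b0).
apply: has_atoms_le k1 _; exists [:: a]; split=> // b; rewrite inE => /eqP ->.
by split=> //; have [[]] := am.
Qed.

Lemma has_atoms_sum s k : uniq s -> {in s, forall a, minimal_projection a} ->
  has_atoms (\sum_(a <- s) a) k <-> (k <= size s)%N.
Proof.
elim: s k => [k _ _|a s ih k /= /andP[as_ us] sm].
  rewrite big_nil leqn0; split=> [[[|b s] [_ <- //]]|/eqP ->]; last exact: has_atoms0.
  by move=> /(_ b (mem_head _ _))[[_ b0 _]]; rewrite cmul0x => e; rewrite -e eqxx in b0.
have am := sm a (mem_head _ _); have ap : is_projection a by case: am.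
have sm' : {in s, forall b, minimal_projection b} by move=> b bs; apply: sm; rewrite inE bs orbT.
have [sp so] := sum_atoms_projection us sm'.
rewrite big_cons has_atomsD ?so//; split=> [[k1 [k2 [<- /(has_atoms_minimal _ am) h1 /(ih _ us sm') h2]]]|ks].
  by rewrite -add1n leq_add.
case: k ks => [_|k ks].
  by exists 0, 0; split=> //; exact: has_atoms0.
by exists 1, k; split=> //; [exact/has_atoms_minimal|exact/ih].
Qed.

Lemma sum_atoms_below p s : {in s, forall a, minimal_projection a /\ cmul p a = a} ->
  cmul p (\sum_(a <- s) a) = \sum_(a <- s) a.
Proof. by move=> sp; rewrite cmul_sumr big_seq [RHS]big_seq; apply: eq_bigr => a /sp[]. Qed.

(** When the number r of minimal projections below p is finite, those below q are
counted by cancelling r. *)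
Lemma has_atomsD_exact p q r k : is_projection p -> is_projection q -> cmul p q = 0 ->
  (forall l, has_atoms p l <-> (l <= r)%N) ->
  has_atoms (p + q) (r + k) <-> has_atoms q k.
Proof.
move=> pp qp pq pr; rewrite has_atomsD//; split=> [[k1 [k2 [e /pr h1 h2]]]|qk].
  by apply: has_atoms_le h2; rewrite -(leq_add2l r) -e leq_add2r.
by exists r, k; split=> //; apply/pr.
Qed.

Definition atomic_algebra : Prop := forall p, is_projection p -> p != 0 ->
  exists2 a, minimal_projection a & cmul p a = a.

Lemma has_atoms1 p : atomic_algebra -> is_projection p -> has_atoms p 1 <-> p != 0.
Proof.
move=> at_ pp; split=> [[[|a [|b s]] [_ // _ h]]|p0].
  have [[_ a0 _] pa] := h a (mem_head _ _).
  by apply: contraNneq a0 => p0; rewrite -pa p0 cmul0x.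
have [a am pa] := at_ p pp p0; exists [:: a]; split=> // b.
by rewrite inE => /eqP ->.
Qed.

End Atoms.

(** * Similar projections *)

Section Similarity.
Context {R : realType}.

(** The counts of minimal projections agree, a count above N being treated as
infinite. *)
Definition similar_projections (A B : cstarAlgType R) (N : nat) (p : A) (q : B) : Prop :=
  forall k, (k <= N)%N -> has_atoms p k <-> has_atoms q k.

Lemma similar_projections_sym (A B : cstarAlgType R) N (p : A) (q : B) :
  similar_projections N p q -> similar_projections N q p.
Proof. by move=> h k /h[]. Qed.

Lemma similar_projections_le (A B : cstarAlgType R) M N (p : A) (q : B) :
  (M <= N)%N -> similar_projections N p q -> similar_projections M p q.
Proof. by move=> MN h k kM; apply: h; exact: leq_trans kM MN. Qed.

Context (A B : cstarAlgType R) (UA : comm_unital A) (UB : comm_unital B).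

(** If p1 has at least N1 and p2 at least N2 minimal projections, any N1 of those below
q can be given to q1, the rest of q to q2.  If one of p1, p2 has fewer, its count is
known exactly; the corresponding part of q is made of that many minimal
projections, and the counts of the other parts match by cancellation. *)
Lemma similar_split N1 N2 (p1 p2 : A) (q : B) :
  is_projection p1 -> is_projection p2 -> cmul p1 p2 = 0 -> is_projection q ->
  similar_projections (N1 + N2) (p1 + p2) q ->
  exists q1 q2 : B, [/\ is_projection q1 /\ is_projection q2, cmul q1 q2 = 0, q1 + q2 = q,
    similar_projections N1 p1 q1 & similar_projections N2 p2 q2].
Proof.
move=> p1p p2p p12 qp sim.
have remove (s : seq B) : uniq s -> {in s, forall a, minimal_projection a /\ cmul q a = a} ->
    let q1 := \sum_(a <- s) a in
    [/\ is_projection q1, is_projection (q - q1) & cmul q1 (q - q1) = 0].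
  move=> us sq q1.
  have [q1p _] := sum_atoms_projection UB us (fun a as_ => (sq a as_).1).
  have qq1 := sum_atoms_below sq.
  split=> //; first exact: (projectionB (cu_comm UB)).
  by rewrite cmulBr (cu_comm UB) qq1 q1p.2 subrr.
have small M1 M2 (r1 r2 : A) : is_projection r1 -> is_projection r2 -> cmul r1 r2 = 0 ->
    similar_projections (M1 + M2) (r1 + r2) q -> ~ has_atoms r1 M1 ->
    exists q1 q2 : B, [/\ is_projection q1 /\ is_projection q2, cmul q1 q2 = 0, q1 + q2 = q,
    similar_projections M1 r1 q1 & similar_projections M2 r2 q2].
  move=> r1p r2p r12 rq nr1.
  have [r rP] : exists r, forall k, has_atoms r1 k <-> (k <= r)%N.
    have ex : exists k, `[< has_atoms r1 k >] by exists 0%N; apply/asboolP; exact: has_atoms0.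
    have bd k : `[< has_atoms r1 k >] -> (k <= M1)%N.
      move=> /asboolP h; rewrite leqNgt; apply/negP => /ltnW kM.
      by apply: nr1; exact: has_atoms_le kM h.
    case: (ex_maxnP ex bd) => r /asboolP rr rmax; exists r => k; split=> [h|kr].
      by apply: rmax; apply/asboolP.
    exact: has_atoms_le kr rr.
  have rM : (r < M1)%N by rewrite ltnNge; apply/negP => /rP.
  have [s [us ss sq]] : has_atoms q r.
    apply/rq; first by rewrite (leq_trans (ltnW rM))// leq_addr.
    apply/has_atomsD => //; exists r, 0%N; rewrite addn0; split=> //; last exact: has_atoms0.
    exact/rP.
  have [q1p q2p q12] := remove s us sq; set q1 := \sum_(a <- s) a in q1p q2p q12.
  have q1r k : has_atoms q1 k <-> (k <= r)%N.
    by rewrite -ss; apply: has_atoms_sum => // a /sq[].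
  exists q1, (q - q1); split=> //; first by rewrite addrC subrK.
    by move=> k _; rewrite rP q1r.
  move=> k kM; rewrite -(has_atomsD_exact UA k r1p r2p r12 rP).
  rewrite -(has_atomsD_exact UB k q1p q2p q12 q1r) (addrC q1) subrK.
  by apply: rq; rewrite leq_add// ltnW.
have [h1|nh1] := pselect (has_atoms p1 N1); last exact: small.
have [h2|nh2] := pselect (has_atoms p2 N2); last first.
  have [||q1 [q2 [[q1p q2p] q12 qE s1 s2]]] := small N2 N1 p2 p1 p2p p1p _ _ nh2.
  - by rewrite (cu_comm UA).
  - by rewrite addnC addrC.
  - by exists q2, q1; split=> //; [rewrite (cu_comm UB)|rewrite addrC].
have [s [us ss sq]] : has_atoms q (N1 + N2).
  by apply/sim => //; apply/has_atomsD => //; exists N1, N2.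
have sqt : {in take N1 s, forall a, minimal_projection a /\ cmul q a = a}.
  by move=> a /mem_take; exact: sq.
have [q1p q2p q12] := remove (take N1 s) (take_uniq _ us) sqt.
set q1 := \sum_(a <- _) a in q1p q2p q12.
have q1N : has_atoms q1 N1.
  apply/(has_atoms_sum UB); [exact: take_uniq|by move=> a /sqt[]|].
  by rewrite size_take ss; case: ltnP => //; rewrite leq_addr.
have q2N : has_atoms (q - q1) N2.
  exists (drop N1 s); split; first exact: drop_uniq.
    by rewrite size_drop ss addKn.
  move=> a ad; have [am qa] := sq a (mem_drop ad); split=> //.
  rewrite cmulBl qa (cu_comm UB q1).
  have [_ /(_ a am) ->] := sum_atoms_projection UB (take_uniq N1 us) (fun b bt => (sqt b bt).1).
    by rewrite subr0.
  have := us; rewrite -{1}(cat_take_drop N1 s) cat_uniq => /and3P[_ /hasPn/(_ a ad)].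
  by [].
exists q1, (q - q1); split=> //; first by rewrite addrC subrK.
  by move=> k kN; split=> _; [exact: has_atoms_le q1N|exact: has_atoms_le h1].
by move=> k kN; split=> _; [exact: has_atoms_le q2N|exact: has_atoms_le h2].
Qed.

(** Iteration of [similar_split].  The additional unit in the bound makes q vanish
when nothing is left to split. *)
Lemma similar_family (K : finType) (f : K -> A) (q : B) N : atomic_algebra B ->
  orthogonal_projections f -> is_projection q ->
  similar_projections (#|K| * N).+1 (\sum_k f k) q ->
  exists g : K -> B, [/\ orthogonal_projections g, \sum_k g k = q &
    forall k, similar_projections N (f k) (g k)].
Proof.
move=> atB [fp fo] qp0.
suff H (r : seq K) q' : uniq r -> is_projection q' ->
    similar_projections (size r * N).+1 (\sum_(k <- r) f k) q' ->
    exists g : K -> B, [/\ {in r, forall k, is_projection (g k)},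
      {in r &, forall k l, k != l -> cmul (g k) (g l) = 0},
      \sum_(k <- r) g k = q' & {in r, forall k, similar_projections N (f k) (g k)}].
  rewrite -big_enum/= cardT => /(H _ _ (enum_uniq _) qp0)[g [gp go gq gs]].
  exists g; rewrite -[\sum_k g k]big_enum/= gq; split=> //; last by move=> k; apply: gs; rewrite mem_enum.
  by split=> [k|k l]; [apply: gp|apply: go]; rewrite mem_enum.
elim: r q' => [|k r ih] q' /=; rewrite ?big_nil ?big_cons.
  move=> _ q'p /(_ 1%N isT)[_ h]; exists (fun=> 0); rewrite big_nil; split=> //.
  apply/esym/eqP/negP => /negP q'0.
  have /h[[|a [|b s]] [_ // _ {}h]] : has_atoms q' 1 by apply/has_atoms1.
  have [[_ a0 _]] := h a (mem_head _ _).
  by rewrite cmul0x => e; rewrite -e eqxx in a0.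
move=> /andP[kr ur] q'p.
have rp : is_projection (\sum_(l <- r) f l).
  by rewrite big_uniq//; apply: projection_sum.
have fkr : cmul (f k) (\sum_(l <- r) f l) = 0.
  rewrite cmul_sumr big_seq big1// => l lr; apply: fo; by apply: contraNneq kr => ->.
rewrite mulSn -addnS => /(similar_split (fp k) rp fkr q'p)[q1 [q2 [[q1p q2p] q12 qE s1 s2]]].
have [g [gp go gq gs]] := ih q2 ur q2p s2.
have gq2 l : l \in r -> cmul q2 (g l) = g l.
  move=> lr; rewrite -gq cmul_suml (bigD1_seq l)//= (gp l lr).2 big_seq_cond big1 ?addr0//.
  by move=> i /andP[ir il]; rewrite go.
have q1g l : l \in r -> cmul q1 (g l) = 0.
  by move=> lr; rewrite -(gq2 l lr) cmulA q12 cmul0x.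
exists (fun l => if l == k then q1 else g l); split.
- move=> l; rewrite inE; case: eqP => //= _; exact: gp.
- move=> l m; rewrite !inE; case: (eqVneq l k) => [->|lk] /=; case: (eqVneq m k) => [->|mk] //=.
  + by move=> _ mr _; exact: q1g.
  + by move=> lr _ _; rewrite (cu_comm UB) q1g.
  + exact: go.
- rewrite big_cons eqxx -qE -gq; congr (_ + _); rewrite big_seq [RHS]big_seq; apply: eq_bigr => l lr.
  by case: eqP => // lk; rewrite -lk lr in kr.
- move=> l; rewrite inE; case: eqP => [->|_] //=; exact: gs.
Qed.

End Similarity.

(** * The back-and-forth argument *)

Section Game.
Context {R : realType}.

Record atomic_model (A : cstarAlgType R) : Prop := AtomicModel {
  am_unital : exists _ : comm_unital A, True;
  am_approximable : approximable A;
  am_atomic : atomic_algebra A }.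

(** The coefficients of the value do not depend on the algebra: polynomials are
evaluated coordinatewise. *)
Lemma star_poly_combination n (P : star_poly n) (J : finType) (c : 'I_n -> J -> R[i]) :
  exists w : J -> R[i], forall (A : cstarAlgType R) (p : J -> A), orthogonal_projections p ->
    star_poly_eval P (fun i => combination p (c i)) = combination p w.
Proof.
elim: P => [i||P [w wP] Q [v vP]|P [w wP] Q [v vP]|l P [w wP]|P [w wP]] /=.
- by exists (c i).
- exists (fun=> 0) => A p _; rewrite /combination big1// => j _; exact: scale0r.
- by exists (fun j => w j + v j) => A p po; rewrite wP// vP// combinationD.
- by exists (fun j => w j * v j) => A p po; rewrite wP// vP// combinationM.
- by exists (fun j => l * w j) => A p po; rewrite wP// combinationZ.
- by exists (fun j => Num.conj (w j)) => A p po; rewrite wP// combination_star.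
Qed.

Lemma combination_unit_ball (A : cstarAlgType R) (J : finType) (p : J -> A) (c : J -> R[i]) :
  orthogonal_projections p -> (forall j, cnorm (c j) <= 1) -> unit_ball (combination p c).
Proof. by move=> po c1; apply: cnorm_combination_le. Qed.

(** Elements given by the same coefficients over two partitions of unity, with similar
members, cannot be told apart by phi up to eps. *)
Definition game_close n (phi : formula n) (N : nat) (eps : R) : Prop :=
  forall (A B : cstarAlgType R), atomic_model A -> atomic_model B ->
  forall (J : finType) (p : J -> A) (q : J -> B) (c : 'I_n -> J -> R[i]),
    partition_of_unity p -> partition_of_unity q ->
    (forall j, similar_projections N (p j) (q j)) -> (forall i j, cnorm (c i j) <= 1) ->
    `|formula_eval phi (fun i => combination p (c i))
      - formula_eval phi (fun i => combination q (c i))| <= eps.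

Lemma game_close_le n (phi : formula n) (M N : nat) (eps : R) : (M <= N)%N ->
  game_close phi M eps -> game_close phi N eps.
Proof.
move=> MN h A B mA mB J p q c pp qp pq c1; apply: h => // j.
exact: similar_projections_le MN (pq j).
Qed.

(** The element x is approximated by a combination, with coefficients in the net g,
over a partition e.  The pieces p j * e k are copied as pieces r j k of q j, and y is
the combination with the same coefficients.  Each member is cut into #|K| pieces,
which is what divides the similarity level. *)
Lemma game_respond n (psi : formula n.+1) (eps d : R) (K : finType) (g : K -> R[i]) (N : nat) :
  0 < d -> (forall k, cnorm (g k) <= 1) ->
  (forall z, cnorm z <= 1 -> exists k, cnorm (z - g k) <= d) ->
  (forall (A : cstarAlgType R) (v w : 'I_n.+1 -> A),
    env_in_ball v -> env_in_ball w -> (forall i, cnorm (v i - w i) <= 3%:R * d) ->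
    `|formula_eval psi v - formula_eval psi w| <= eps / 2%:R) ->
  game_close psi N (eps / 2%:R) ->
  forall (A B : cstarAlgType R), atomic_model A -> atomic_model B ->
  forall (J : finType) (p : J -> A) (q : J -> B) (c : 'I_n -> J -> R[i]),
    partition_of_unity p -> partition_of_unity q ->
    (forall j, similar_projections (#|K| * N).+1 (p j) (q j)) -> (forall i j, cnorm (c i j) <= 1) ->
  forall x : A, unit_ball x -> exists2 y : B, unit_ball y &
    `|formula_eval psi (env_cons x (fun i => combination p (c i)))
      - formula_eval psi (env_cons y (fun i => combination q (c i)))| <= eps.
Proof.
move=> d0 g1 net unif close A B mA mB J p q c pp qp pq c1 x xb.
have [[UA _] apA atA] := mA; have [[UB _] apB atB] := mB.
have [e ep xe] := net_approximation (cu_comm UA) apA d0 net xb.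
have pep := product_partition (cu_comm UA) pp ep.
have rP j : exists r : K -> B, [/\ orthogonal_projections r, \sum_k r k = q j &
    forall k, similar_projections N (cmul (p j) (e k)) (r k)].
  apply: (similar_family UA UB atB); last 2 first.
  - exact: qp.1.1.
  - by rewrite -cmul_sumr (ep.2 _).2.
  split=> [k|k l kl]; first exact: (pep.1.1 (j, k)).
  by apply: (pep.1.2 (j, k) (j, l)); rewrite xpair_eqE eqxx.
have [r {}rP] := choice rP.
pose qe (jk : J * K) := r jk.1 jk.2.
have sum_qe w : combination qe (fun jk => w jk.1) = combination q w.
  rewrite /combination -(pair_bigA _ (fun j k => w j *: r j k))/=.
  by apply: eq_bigr => j _; rewrite -scaler_sumr; have [_ ->] := rP j.
have qep : partition_of_unity qe.
  split; last first.
    have E (L : finType) (h : L -> B) : \sum_i h i = combination h (fun=> 1).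
      by apply: eq_bigr => i _; rewrite scale1r.
    by have := qp.2; rewrite !E -sum_qe.
  split=> [[j k]|[j k] [j' k'] jk]; first by have [[rp _] _ _] := rP j; exact: rp.
  have [[rp ro] rq _] := rP j; have [[rp' ro'] rq' _] := rP j'; rewrite /qe/=.
  have [jj|jj] := eqVneq j j'.
    by subst j'; apply: ro; apply: contra jk => /eqP ->.
  have -> : r j k = cmul (r j k) (q j).
    by rewrite -rq cmul_sumr (bigD1 k)//= (rp k).2 big1 ?addr0// => l lk; rewrite ro// eq_sym.
  have -> : r j' k' = cmul (q j') (r j' k').
    by rewrite -rq' cmul_suml (bigD1 k')//= (rp' k').2 big1 ?addr0// => l lk; rewrite ro'.
  by rewrite -cmulA (cmulA (q j)) qp.1.2// cmul0x cmulx0.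
pose c' := env_cons (fun jk : J * K => g jk.2) (fun i jk => c i jk.1).
have c'1 i jk : cnorm (c' i jk) <= 1.
  by apply: (env_consP (P := fun _ f => cnorm (f jk) <= 1)).
pose pe (jk : J * K) := cmul (p jk.1) (e jk.2).
have cons_comb (D : cstarAlgType R) (h : J * K -> D) v :
    (forall i, combination h (fun jk => c i jk.1) = v i) ->
    (fun i => combination h (c' i)) = env_cons (combination h (fun jk => g jk.2)) v.
  move=> hv; apply/funext => i; rewrite /c' /env_cons; case: (unlift ord0 i) => // j.
have := close A B mA mB _ pe qe c' pep qep.
rewrite (cons_comb _ pe _ (fun i => combination_product_l p ep (c i))).
rewrite (cons_comb _ qe _ (fun i => sum_qe (c i))) => ef.
exists (combination qe (fun jk => g jk.2)); first exact: combination_unit_ball qep.1 _.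
apply: (le_trans (ler_distD (formula_eval psi (env_cons (combination e g) (fun i => combination p (c i)))) _ _)).
rewrite [leRHS]splitr lerD//.
  apply: unif.
  - by apply: env_in_ball_cons => // i; exact: combination_unit_ball pp.1 _.
  - by apply: env_in_ball_cons => [i|]; [exact: combination_unit_ball pp.1 _|exact: combination_unit_ball ep.1 _].
  - move=> i; case: (unliftP ord0 i) => [j ->|->]; rewrite ?env_consS ?env_cons0//.
    by rewrite subrr cnorm0 mulr_ge0// ltW.
have <- : combination pe (fun jk => g jk.2) = combination e g := combination_product_r e pp g.
apply: ef => // -[j k]; have [_ _] := rP j; exact.
Qed.

(** For norms 1-similarity suffices, as the norm of a combination is the largest modulus
of a coefficient of a nonzero member.  Quantifiers are handled by [game_respond] in
both directions, with a net chosen from the modulus of continuity of the body. *)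
Theorem game_elimination n (phi : formula n) (eps : R) : 0 < eps -> exists N, game_close phi N eps.
Proof.
have quant k (psi : formula k.+1) e : 0 < e ->
    (forall e', 0 < e' -> exists N, game_close psi N e') ->
    exists N, game_close (FSup psi) N e /\ game_close (FInf psi) N e.
  move=> e0 ih; have e2 : 0 < e / 2%:R by rewrite divr_gt0.
  have [N close] := ih _ e2.
  have [d d0 unif] := formula_unif_continuous psi e2.
  have d3 : 0 < d / 3%:R by rewrite divr_gt0.
  have [K [g [g1 net]]] := unit_disc_net d3.
  have {}unif (A : cstarAlgType R) (v w : 'I_k.+1 -> A) :
      env_in_ball v -> env_in_ball w -> (forall i, cnorm (v i - w i) <= 3%:R * (d / 3%:R)) ->
      `|formula_eval psi v - formula_eval psi w| <= e / 2%:R.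
    have -> : 3%:R * (d / 3%:R) = d by field.
    exact: unif.
  exists (#|K| * N).+1; apply/and_comm.
  have both (A B : cstarAlgType R) : atomic_model A -> atomic_model B ->
    forall (J : finType) (p : J -> A) (q : J -> B) (c : 'I_k -> J -> R[i]),
    partition_of_unity p -> partition_of_unity q ->
    (forall j, similar_projections (#|K| * N).+1 (p j) (q j)) -> (forall i j, cnorm (c i j) <= 1) ->
    `|formula_eval (FSup psi) (fun i => combination p (c i))
      - formula_eval (FSup psi) (fun i => combination q (c i))| <= e /\
    `|formula_eval (FInf psi) (fun i => combination p (c i))
      - formula_eval (FInf psi) (fun i => combination q (c i))| <= e.
    move=> mA mB J p q c pp qp pq c1; apply: formula_quantifier_dist.
    - by move=> i; exact: combination_unit_ball pp.1 _.
    - by move=> i; exact: combination_unit_ball qp.1 _.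
    - by move=> x xb; exact: (game_respond d3 g1 net unif close mA mB pp qp pq c1 xb).
    - move=> y yb.
      have [x xb xy] := game_respond d3 g1 net unif close mB mA qp pp
        (fun j => similar_projections_sym (pq j)) c1 yb.
      by exists x => //; rewrite distrC.
  by split=> A B mA mB J p q c pp qp pq c1; have [] := both A B mA mB J p q c pp qp pq c1.
elim: phi eps => {n} [n P|n m f fc psi ih|n psi ih|n psi ih] eps e0.
- exists 1%N => A B mA mB J p q c pp qp pq c1 /=.
  have [w wP] := star_poly_combination P c.
  rewrite wP; last exact: pp.1.
  rewrite wP; last exact: qp.1.
  suff le (D E : cstarAlgType R) (u : J -> D) (v : J -> E) : atomic_model D -> atomic_model E ->
      partition_of_unity u -> partition_of_unity v ->
      (forall j, similar_projections 1 (u j) (v j)) ->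
      cnorm (combination u w) <= cnorm (combination v w).
    have /le_anti -> : cnorm (combination p w) <= cnorm (combination q w) <= cnorm (combination p w).
      by rewrite !le// => j; exact: similar_projections_sym.
    by rewrite subrr normr0 ltW.
  move=> mD mE up vp uv; apply: cnorm_combination_le => [||j uj]; [exact: up.1|exact: cnorm_ge0|].
  have [[HD _] _ atD] := mD; have [[HE _] _ atE] := mE.
  apply: cnorm_combination_ge vp.1 _ _ _.
  by apply/(has_atoms1 atE (vp.1.1 j))/uv => //; apply/(has_atoms1 atD (up.1.1 j)).
- have [d d0 fd] := formula_connective_unif psi fc e0.
  have [N NP] := choice (fun i => ih i d d0).
  exists (\max_i N i) => A B mA mB J p q c pp qp pq c1; apply: fd.
    by move=> i; exact: combination_unit_ball pp.1 _.
  move=> i; apply: game_close_le (NP i) _ _ mA mB _ _ _ _ pp qp pq c1.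
  exact: leq_bigmax.
- by have [N []] := quant _ psi eps e0 ih; exists N.
- by have [N []] := quant _ psi eps e0 ih; exists N.
Qed.

(** The case of the trivial partition, whose only member is the unit. *)
Theorem sentence_close (phi : sentence R) (eps : R) : 0 < eps -> exists N,
  forall (A B : cstarAlgType R) (e : A) (f : B), atomic_model A -> atomic_model B ->
    is_unit e -> is_unit f -> similar_projections N e f ->
    `|sentence_value A phi - sentence_value B phi| <= eps.
Proof.
move=> e0; have [N close] := game_elimination phi e0; exists N => A B e f mA mB eu fu ef.
have part (D : cstarAlgType R) (u : D) : atomic_model D -> is_unit u -> @partition_of_unity R D unit (fun=> u).
  move=> [[H _] _ _] uu; split; last by rewrite big_const card_unit /= addr0.
  split=> [_|[] []//]; rewrite (is_unit_unique uu (cu_is_unit H)).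
  exact: cu_one_projection.
have emp (D : cstarAlgType R) (v w : 'I_0 -> D) : v = w by apply/funext => -[].
rewrite /sentence_value (emp A (fun _ : 'I_0 => 0) (fun i => combination (fun _ : unit => e) (fun=> 0))).
rewrite (emp B (fun _ : 'I_0 => 0) (fun i => combination (fun _ : unit => f) (fun=> 0))).
apply: (close A B mA mB unit (fun=> e) (fun=> f) (fun _ _ => 0) (part _ _ mA eu) (part _ _ mB fu)) => //.
by move=> _ _; rewrite cnorm0.
Qed.

End Game.

(** * Algebras spanned by orthogonal projections *)

Section Diagonal.
Context {R : realType}.

Definition diagonal_algebra (A : cstarAlgType R) : Prop := exists (n : nat) (p : 'I_n -> A),
  [/\ orthogonal_projections p, forall j, p j != 0 &
      forall x, exists c, x = combination p c].

Lemma diagonal_diag_alg n : diagonal_algebra (diag_alg R n).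
Proof.
exists n, (@diag_atom R n); split.
- exact: diag_atom_orthogonal.
- exact: diag_atom_neq0.
- by move=> x; exists x; exact: diag_atom_combination.
Qed.

Section Spanned.
Context (A : cstarAlgType R) (n : nat) (p : 'I_n -> A).
Hypotheses (po : orthogonal_projections p) (p0 : forall j, p j != 0)
  (pspan : forall x, exists c, x = combination p c).

Lemma spanned_commutative : commutative (@cmul R A).
Proof.
move=> x y; have [c ->] := pspan x; have [d ->] := pspan y.
by rewrite !combinationM//; apply: eq_combination => j _; rewrite mulrC.
Qed.

Lemma spanned_is_unit : is_unit (\sum_j p j).
Proof.
have E : \sum_j p j = combination p (fun=> 1) by apply: eq_bigr => j _; rewrite scale1r.
move=> x; have [c ->] := pspan x.
by rewrite E !combinationM//; split; apply: eq_combination => j _; rewrite ?mul1r ?mulr1.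
Qed.

Lemma spanned_minimal j : minimal_projection (p j).
Proof.
split=> //; first exact: po.1.
move=> q [[_ qq] _ qp]; have [c qc] := pspan q.
have qE : q = c j *: p j by rewrite -qp qc combination_mul_proj.
move: qq; rewrite qE cmulZl cmulZr (po.1 j).2 scalerA => /eqP.
rewrite -subr_eq0 -scalerBl scaler_eq0 (negPf (p0 j)) orbF -{3}[c j]mulr1 -mulrBr mulf_eq0.
by rewrite subr_eq0 => /orP[/eqP ->|/eqP ->]; [left; rewrite scale0r|right; rewrite scale1r].
Qed.

Lemma spanned_approximable : approximable A.
Proof.
move=> x eps e0; have [c ->] := pspan x; exists 'I_n, p, c; split.
  by split=> //; exact: spanned_is_unit.
by rewrite subrr cnorm0 ltW.
Qed.

Context (H : comm_unital A).

Lemma spanned_atomic : atomic_algebra A.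
Proof.
move=> q qp q0; apply: contrapT => h; case/eqP: q0.
rewrite -(spanned_is_unit q).2 cmul_sumr big1// => j _.
have [//|qj] := minimal_subprojection H (spanned_minimal j) qp.
by case: h; exists (p j) => //; exact: spanned_minimal.
Qed.

Lemma spanned_has_atoms k : has_atoms (\sum_j p j) k <-> (k <= n)%N.
Proof.
have -> : \sum_j p j = \sum_(a <- [seq p j | j <- enum 'I_n]) a by rewrite big_map big_enum.
have := @has_atoms_sum _ _ H [seq p j | j <- enum 'I_n] k; rewrite size_map size_enum_ord; apply.
  rewrite map_inj_in_uniq ?enum_uniq// => i j _ _ ij; apply/eqP; apply: contraT => nij.
  by have := po.2 _ _ nij; rewrite ij (po.1 j).2 => /eqP; rewrite (negPf (p0 j)).
by move=> _ /mapP[j _ ->]; exact: spanned_minimal.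
Qed.

End Spanned.

Lemma comm_unital_of (A : cstarAlgType R) (e : A) : nonzero_algebra A -> commutative (@cmul R A) ->
  is_unit e -> comm_unital A.
Proof.
move=> nz cA eu; apply: (@CommUnital R A e eu cA).
have [x x0] := nz; apply: contraNneq x0 => e0.
by rewrite -(eu x).1 e0 cmul0x.
Qed.

Lemma diagonal_atomic_model (A : cstarAlgType R) : nonzero_algebra A -> diagonal_algebra A ->
  atomic_model A.
Proof.
move=> nz [n [p [po p0 pspan]]].
have H := comm_unital_of nz (spanned_commutative po pspan) (spanned_is_unit po pspan).
split; [by exists H| |exact: spanned_atomic po p0 pspan H].
exact: spanned_approximable po pspan.
Qed.

Lemma diag_alg_nonzero n : (0 < n)%N -> nonzero_algebra (diag_alg R n).
Proof. by move=> n0; exists (diag_atom (Ordinal n0)); exact: diag_atom_neq0. Qed.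

Lemma diag_alg_finite_dimensional n : finite_dimensional (diag_alg R n).
Proof. by exists n, (@diag_atom R n) => x; exists x; exact: diag_atom_combination. Qed.

Lemma los_sentence (I : Type) (U : ultrafilter I) (F : I -> cstarAlgType R) (phi : sentence R) :
  sentence_value (F i) phi @[i --> ultrafilter_set U]
    --> sentence_value (ultraproduct U F) phi.
Proof.
have emp (D : cstarAlgType R) (v w : 'I_0 -> D) : v = w by apply/funext => -[].
pose a : 'I_0 -> bounded_family F := fun=> 0.
rewrite /sentence_value (emp _ (fun _ : 'I_0 => 0) (fun j => ultra_pi U (a j) : ultraproduct U F)).
under eq_fun do rewrite (emp _ (fun _ : 'I_0 => 0) (fun j => a j _)).
by apply: los => -[].
Qed.

(** If the unit has exactly n minimal projections below it and n < N, this n will do;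
otherwise N will (or 1, to have a nonzero algebra). *)
Lemma similar_diag_alg (A : cstarAlgType R) (H : comm_unital A) N :
  atomic_algebra A -> exists n, (0 < n)%N /\ similar_projections N (cu_one H) (\sum_j @diag_atom R n j).
Proof.
move=> atA; set u := cu_one H.
have up : is_projection u := cu_one_projection H.
have diagE n : (0 < n)%N -> forall k, has_atoms (\sum_j @diag_atom R n j) k <-> (k <= n)%N.
  move=> n0 k; have sp : forall x : diag_alg R n, exists c, x = combination (@diag_atom R n) c.
    by move=> x; exists x; exact: diag_atom_combination.
  have po := @diag_atom_orthogonal R n; have p0 := @diag_atom_neq0 R n.
  have H' := comm_unital_of (diag_alg_nonzero n0) (spanned_commutative po sp) (spanned_is_unit po sp).
  exact: spanned_has_atoms.
have [uN|nuN] := pselect (has_atoms u N).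
  exists (maxn N 1); rewrite leq_max orbT; split=> // k kN; rewrite diagE ?leq_max ?orbT// kN.
  by split=> // _; exact: has_atoms_le kN uN.
have ex : exists k, `[< has_atoms u k >] by exists 0%N; apply/asboolP; exact: has_atoms0.
have bd k : `[< has_atoms u k >] -> (k <= N)%N.
  move=> /asboolP h; rewrite leqNgt; apply/negP => /ltnW kM.
  by apply: nuN; exact: has_atoms_le kM h.
case: (ex_maxnP ex bd) => n /asboolP un nmax.
have n0 : (0 < n)%N by apply: nmax; apply/asboolP/(has_atoms1 atA up); exact: cu_neq0.
exists n; split=> // k _; rewrite diagE//; split=> [h|kn]; last exact: has_atoms_le kn un.
by apply: nmax; apply/asboolP.
Qed.

(** The N-th factor agrees with A on each sentence up to errors that tend to 0, by
[sentence_close]; the ultrafilter contains the cofinite sets. *)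
Theorem atomic_model_pseudocompact (A : cstarAlgType R) : atomic_model A -> pseudocompact A.
Proof.
move=> mA; have [[H _] apA atA] := mA.
have [n nP] := choice (fun N => similar_diag_alg H N atA).
have [U [Uu oU]] := @ultraFilterLemma nat \oo _.
pose V := Ultrafilter Uu.
exists nat, V, (fun N => diag_alg R (n N)); split=> [N|phi].
  by split; [exact: diag_alg_nonzero (nP N).1|exact: diag_alg_finite_dimensional].
have := @los_sentence nat V (fun N => diag_alg R (n N)) phi.
apply: cvg_unique => //; apply/cvgrPdist_le => e e0.
have [N NP] := sentence_close phi e0.
apply: oU; exists N => // M /= NM.
have [n0 sim] := nP M.
apply: NP mA _ (cu_is_unit H) _ (similar_projections_le NM sim).
  exact: diagonal_atomic_model (diag_alg_nonzero n0) (diagonal_diag_alg _).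
apply: spanned_is_unit; first exact: diag_atom_orthogonal.
by move=> x; exists x; exact: diag_atom_combination.
Qed.

(** A minimal projection a norming p up to 1 satisfies pa <> 0, hence pa = a. *)
Lemma atomic_of_normed (A : cstarAlgType R) (H : comm_unital A) :
  normed_by_minimal_projections A -> atomic_algebra A.
Proof.
move=> nm p pp p0; have p1 := cnorm_projection pp p0.
have [a [am _ ap]] := nm p 1 ltr01.
exists a => //; have [pa|//] := minimal_subprojection H am pp.
by move: ap; rewrite pa cnorm0 p1 subr0 normr1 ltxx.
Qed.

Theorem unital_rr0_normed_pseudocompact (A : cstarAlgType R) : nonzero_algebra A ->
  commutative (@cmul R A) -> unital A -> real_rank_zero A -> normed_by_minimal_projections A ->
  pseudocompact A.
Proof.
move=> nz cA [e eu] rr nm; have H := comm_unital_of nz cA eu.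
apply: atomic_model_pseudocompact; split; first by exists H.
  exact: real_rank_zero_approximable H rr.
exact: atomic_of_normed H nm.
Qed.

End Diagonal.

(** * Finite-dimensional algebras *)

Section FiniteDimensional.
Context {R : realType} (A : cstarAlgType R).

Lemma finite_dimensional_dependent : finite_dimensional A -> exists n,
  forall v : nat -> A, exists c : 'I_n.+1 -> R[i],
    (exists i, c i != 0) /\ \sum_i c i *: v i = 0.
Proof.
move=> [n [b bspan]]; exists n => v.
have [m mP] := choice (fun i : 'I_n.+1 => bspan (v i)).
pose M : 'M[R[i]]_(n.+1, n) := \matrix_(i, j) m i j.
pose u := nz_row (kermx M).
have u0 : u != 0.
  rewrite nz_row_eq0 kermx_eq0; apply/negP => /eqP Mr.
  by have := rank_leq_col M; rewrite Mr ltnn.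
have uM : u *m M = 0 by apply/sub_kermxP; exact: nz_row_sub.
exists (u 0); split.
  exact/rV0Pn.
transitivity (\sum_j (u *m M) 0 j *: b j); last first.
  by rewrite uM big1// => j _; rewrite mxE scale0r.
under eq_bigr do rewrite mP scaler_sumr.
rewrite exchange_big/=; apply: eq_bigr => j _; rewrite mxE scaler_suml.
by apply: eq_bigr => i _; rewrite scalerA mxE.
Qed.

Lemma finite_dimensional_algebraic (a : A) : finite_dimensional A ->
  exists2 q : {poly R[i]}, q != 0 & poly_ev a q = 0.
Proof.
move=> /finite_dimensional_dependent[n /(_ (fun k => iter k (cmul a) a))[c [[i ci] c0]]].
exists (\poly_(k < n.+1) c (inord k)).
  apply/eqP => /(congr1 (fun q : {poly _} => q`_i)); rewrite coef_poly coef0 ltn_ord inord_val.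
  by apply/eqP.
rewrite (poly_evE a (size_poly _ _)) -[RHS]c0; apply: eq_bigr => k _.
by rewrite coef_poly ltn_ord inord_val.
Qed.

Hypothesis A_fd : finite_dimensional A.

(** The projections span, as every self-adjoint element is algebraic. *)
Lemma finite_dimensional_ind (P : A -> Prop) :
  P 0 -> (forall x y, P x -> P y -> P (x + y)) -> (forall l x, P x -> P (l *: x)) ->
  (forall p, is_projection p -> P p) -> forall x, P x.
Proof.
move=> P0 PD PZ Pp.
have sa a : cstar a = a -> P a.
  move=> as_; have [q q0 aq] := finite_dimensional_algebraic a A_fd.
  have [T [p [_ pp _ ->]]] := self_adjoint_algebraic_diagonal as_ q0 aq.
  by rewrite big_seq; apply: big_ind => // l lT; apply/PZ/Pp/pp.
move=> x; have [u [v [us vs ->]]] := cartesian_decomposition x.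
by apply: PD; [exact: sa|apply/PZ/sa].
Qed.

(** If y = px - pxp, normalized to z, is nonzero, then z^2 = 0 and z [z^*, z] = z z^* z, which
has norm 1; but the commutator has norm less than 1. *)
Lemma nearly_commutative_projection_central (p : A) :
  (forall x y : A, unit_ball x -> unit_ball y -> cnorm (cmul x y - cmul y x) < 1) ->
  is_projection p -> forall x, cmul p x = cmul x p.
Proof.
move=> nc [ps pp].
have pxp x : cmul p x = cmul (cmul p x) p.
  apply/eqP; rewrite -subr_eq0; apply: contraT => y0.
  set y := _ - _ in y0; pose z := (cnorm y)^-1%:C *: y.
  have ny : 0 < cnorm y by rewrite cnorm_gt0.
  have z1 : cnorm z = 1.
    by rewrite cnormZ cnorm_real ger0_norm ?mulVf ?gt_eqF ?invr_ge0 ?ltW.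
  have yy : cmul y y = 0.
    have py : cmul p y = y by rewrite /y cmulBr !cmulA pp.
    have yp : cmul y p = 0 by rewrite /y cmulBl -!cmulA pp subrr.
    by rewrite -[X in cmul _ X]py cmulA yp cmul0x.
  have zz : cmul z z = 0 by rewrite cmulZl cmulZr yy !scaler0.
  have b1 : unit_ball z by rewrite /unit_ball/= z1.
  have b2 : unit_ball (cstar z) by rewrite /unit_ball/= cnorm_cstar z1.
  have := nc _ _ b2 b1; set w := _ - _ => w1.
  have wE : cmul z w = cmul z (cmul (cstar z) z) by rewrite cmulBr (cmulA z z) zz cmul0x subr0.
  have : 1 <= cnorm (cmul z w).
    rewrite wE; have := cnormM (cstar z) (cmul z (cmul (cstar z) z)).
    rewrite cnorm_cstar z1 mul1r; apply: le_trans.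
    have -> : cmul (cstar z) (cmul z (cmul (cstar z) z)) = cmul (cmul (cstar z) z) (cmul (cstar z) z).
      by rewrite -!cmulA.
    by rewrite cnorm_self_adjoint_sqr ?cnorm_cstar_cmul ?z1 ?expr1n// cstarM cstarK.
  by move=> /le_trans/(_ (cnormM _ _)); rewrite z1 mul1r leNgt w1.
move=> x; rewrite pxp; have := congr1 cstar (pxp (cstar x)).
by rewrite !cstarM cstarK ps => ->; rewrite cmulA.
Qed.

Lemma nearly_commutative_commutative :
  (forall x y : A, unit_ball x -> unit_ball y -> cnorm (cmul x y - cmul y x) < 1) ->
  commutative (@cmul R A).
Proof.
move=> nc x y; move: x; apply: finite_dimensional_ind.
- by rewrite cmul0x cmulx0.
- by move=> x z xy zy; rewrite cmulDl cmulDr xy zy.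
- by move=> l x xy; rewrite cmulZl cmulZr xy.
- by move=> p pp; exact: nearly_commutative_projection_central.
Qed.

Lemma orthogonal_nonzero_bound : exists n, forall m (p : 'I_m -> A),
  orthogonal_projections p -> (forall j, p j != 0) -> (m <= n)%N.
Proof.
have [n dep] := finite_dimensional_dependent A_fd.
exists n => m p po p0; rewrite leqNgt; apply/negP => nm.
have [c [[i ci] c0]] := dep (fun k => if insub k is Some j then p j else 0).
pose f (i : 'I_n.+1) := p (widen_ord nm i).
have fo : orthogonal_projections f.
  by split=> [j|j k jk]; [exact: po.1|apply: po.2; apply: contra jk => /eqP/(congr1 val)/= jk; exact/eqP/val_inj].
have : combination f c = 0.
  rewrite -[RHS]c0; apply: eq_bigr => j _; congr (_ *: _).
  rewrite insubT; first exact: leq_trans (ltn_ord j) nm.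
  by move=> lt; congr p; apply: val_inj.
move=> /(congr1 (fun x => cmul x (f i))); rewrite combination_mul_proj// cmul0x => /eqP.
by rewrite scaler_eq0 (negPf ci) (negPf (p0 _)).
Qed.

Lemma env_cons_orthogonal m (p : 'I_m -> A) (q : A) : is_projection q ->
  orthogonal_projections p -> (forall j, cmul q (p j) = 0) -> (forall j, cmul (p j) q = 0) ->
  orthogonal_projections (env_cons q p).
Proof.
move=> qp po qj jq; split; first by apply: (env_consP (P := fun _ x => is_projection x)) => // j; exact: po.1.
move=> i j; case: (unliftP ord0 i) => [i' ->|->]; case: (unliftP ord0 j) => [j' ->|->]; rewrite ?env_consS ?env_cons0//.
by rewrite (inj_eq lift_inj); exact: po.2.
Qed.

(** A family of orthogonal nonzero projections is linearly independent.  One of maximal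
size can neither be extended, so that its sum acts as a unit on projections, nor
refined, so that each of its members is minimal. *)
Theorem finite_dimensional_commutative_diagonal : commutative (@cmul R A) -> diagonal_algebra A.
Proof.
move=> cA; have [n bound] := orthogonal_nonzero_bound.
pose Q m := `[< exists p : 'I_m -> A, orthogonal_projections p /\ forall j, p j != 0 >].
have ex : exists m, Q m by exists 0%N; apply/asboolP; exists (fun=> 0); split; [split=> -[]|case].
have bd m : Q m -> (m <= n)%N by move=> /asboolP[p [po p0]]; exact: bound po p0.
case: (ex_maxnP ex bd) => m /asboolP[p [po p0]] mmax.
have stop (p' : 'I_m -> A) (q : A) : is_projection q -> orthogonal_projections p' ->
    (forall j, p' j != 0) -> (forall j, cmul q (p' j) = 0) -> q = 0.
  move=> qp po' p0' qj; apply/eqP; apply: contraT => q0.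
  have := mmax m.+1; rewrite ltnn; apply; apply/asboolP; exists (env_cons q p'); split.
    by apply: env_cons_orthogonal => // j; rewrite cA.
  exact: (env_consP (P := fun _ x => x != 0)).
exists m, p; split=> //; apply: finite_dimensional_ind.
- by exists (fun=> 0); rewrite /combination big1// => j _; rewrite scale0r.
- by move=> x y [c ->] [d ->]; exists (fun j => c j + d j); rewrite combinationD.
- by move=> l x [c ->]; exists (fun j => l * c j); rewrite combinationZ.
move=> q qp.
have qj j : cmul q (p j) = 0 \/ cmul q (p j) = p j.
  have [->|q0] := eqVneq (cmul q (p j)) 0; [by left|right].
  have rp := projectionM cA qp (po.1 j).
  have pr : cmul (p j) (cmul q (p j)) = cmul q (p j) by rewrite cA -cmulA (po.1 j).2.
  apply/eqP; rewrite eq_sym -subr_eq0; apply/eqP.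
  apply: (stop (fun i => if i == j then cmul q (p j) else p i)).
  - by apply: projectionB => //; exact: po.1.
  - split=> [i|i k]; first by case: eqP => // _; exact: po.1.
    case: (eqVneq i j) => [->|ij]; case: (eqVneq k j) => [_|kj] //.
    + by move=> _; rewrite -cmulA po.2 ?cmulx0// eq_sym.
    + by move=> _; rewrite cA -cmulA po.2 ?cmulx0// eq_sym.
    + exact: po.2.
  - by move=> i; case: ifP => _; [exact: q0|exact: p0].
  - move=> i; case: eqP => [_|/eqP ij].
      by rewrite cmulBl pr rp.2 subrr.
    by rewrite cmulBl -cmulA po.2 1?eq_sym// cmulx0 subr0.
pose e := \sum_j p j.
have ep : is_projection e by exact: projection_sum.
have epj j : cmul e (p j) = p j.
  by rewrite cmul_suml (bigD1 j)//= (po.1 j).2 big1 ?addr0// => i ij; rewrite po.2.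
have /eqP : q - cmul q e = 0.
  apply: (stop p) => //.
    apply: projectionB => //; first exact: projectionM.
    by rewrite cmulA qp.2.
  by move=> j; rewrite cmulBl -cmulA epj subrr.
rewrite subr_eq0 => /eqP ->; exists (fun j => if cmul q (p j) == 0 then 0 else 1).
rewrite cmul_sumr; apply: eq_bigr => j _.
by case: eqP => [->|]; rewrite ?scale0r ?scale1r//; case: (qj j).
Qed.

End FiniteDimensional.

(** * Transfer of sentences *)

Section Quantifiers.
Context {R : realType} (A : cstarAlgType R) (n : nat) (psi : @formula R n.+1) (v : 'I_n -> A).
Hypothesis vb : env_in_ball v.

Lemma FSup_leP (c : R) : formula_eval (FSup psi) v <= c <->
  forall x, unit_ball x -> formula_eval psi (env_cons x v) <= c.
Proof.
have [M vM] := formula_upper_bound psi vb.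
split=> [vc x xb|h]; last first.
  apply: ge_sup => [|_ [x xb <-]]; last exact: h.
  by have [x xb] := unit_ball_nonempty A; exists (formula_eval psi (env_cons x v)), x.
apply: le_trans vc; apply: (@sup_image_ge _ _ _ (fun x => formula_eval psi (env_cons x v)) M) => //.
by move=> y /vM/andP[].
Qed.

Lemma FInf_ltP (c : R) : formula_eval (FInf psi) v < c <->
  exists2 x, unit_ball x & formula_eval psi (env_cons x v) < c.
Proof.
have [M vM] := formula_upper_bound psi vb.
have lbM : has_lbound [set formula_eval psi (env_cons x v) | x in @unit_ball R A].
  by exists (- M) => _ [x /vM/andP[h _] <-].
split=> [vc|[x xb]]; last by apply: le_lt_trans; apply: ge_inf => //; exists x.
have hi : has_inf [set formula_eval psi (env_cons x v) | x in @unit_ball R A].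
  by split=> //; have [x xb] := unit_ball_nonempty A; exists (formula_eval psi (env_cons x v)), x.
have [|_ [x xb <-] h] := @inf_adherent R _ (c - formula_eval (FInf psi) v) _ hi.
  by rewrite subr_gt0.
by exists x => //; move: h; rewrite /= addrC subrK.
Qed.

End Quantifiers.

Section Transfer.
Context {R : realType}.

Definition commutator_sentence : sentence R :=
  FSup (FSup (FNorm (PAdd (PMul (PVar (lift ord0 ord0)) (PVar ord0))
    (PScale (-1) (PMul (PVar ord0) (PVar (lift ord0 ord0))))))).

Lemma commutator_sentenceP (A : cstarAlgType R) (c : R) : sentence_value A commutator_sentence <= c <->
  forall x y : A, unit_ball x -> unit_ball y -> cnorm (cmul x y - cmul y x) <= c.
Proof.
have e0 : env_in_ball (fun _ : 'I_0 => 0 : A) by case.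
rewrite /sentence_value FSup_leP//; split=> h x.
  move=> y xb yb; have /FSup_leP := h x xb; move=> /(_ (env_in_ball_cons e0 xb) y yb).
  by rewrite /= !env_consS !env_cons0 scaleN1r.
move=> xb; apply/FSup_leP; first exact: env_in_ball_cons.
by move=> y yb; rewrite /= !env_consS !env_cons0 scaleN1r; exact: h.
Qed.

(** The commutator sentence has value 0 in A, so that almost all factors have small
commutators and are commutative; the value of phi in A is a limit of its values in
those. *)
Theorem pseudocompact_transfer (A : cstarAlgType R) : commutative (@cmul R A) -> pseudocompact A ->
  forall (phi : sentence R) (c : R),
    (forall D : cstarAlgType R, nonzero_algebra D -> diagonal_algebra D -> sentence_value D phi <= c) ->
    sentence_value A phi <= c.
Proof.
move=> cA [I [U [F [Ffd AU]]]] phi c Dc.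
have comm0 : sentence_value A commutator_sentence <= 0.
  by apply/commutator_sentenceP => x y _ _; rewrite cA subrr cnorm0.
have Uc : \forall i \near ultrafilter_set U, sentence_value (F i) commutator_sentence < 1.
  apply: (cvgr_lt _ (@los_sentence R I U F commutator_sentence)).
  by rewrite -AU (le_lt_trans comm0).
rewrite AU; rewrite leNgt; apply/negP => /(cvgr_gt _ (@los_sentence R I U F phi)) Uphi.
have /filter_ex[i [h1 h2]] : \forall i \near ultrafilter_set U, sentence_value (F i) commutator_sentence < 1 /\ c < sentence_value (F i) phi by exact: filterI.
have [nz fd] := Ffd i; move: h2; apply/negP; rewrite -leNgt; apply: Dc => //.
apply: finite_dimensional_commutative_diagonal => //.
apply: nearly_commutative_commutative => // x y xb yb; apply: le_lt_trans h1.
exact: (commutator_sentenceP _ _).1.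
Qed.

End Transfer.

(** * Units *)

Section UnitSentence.
Context {R : realType}.

Definition unit_sentence : sentence R :=
  FInf (FSup (FNorm (PAdd (PMul (PVar (lift ord0 ord0)) (PVar ord0)) (PScale (-1) (PVar ord0))))).

Lemma unit_sentenceE (A : cstarAlgType R) : sentence_value A unit_sentence =
  inf [set sup [set cnorm (cmul e x - x) | x in @unit_ball R A] | e in @unit_ball R A].
Proof.
rewrite /sentence_value/=; congr inf; apply: eq_imagel => e _; congr sup; apply: eq_imagel => x _.
by rewrite env_consS !env_cons0 scaleN1r.
Qed.

Lemma scale_into_ball (V : normedModType R[i]) (x : V) : exists2 m : R, 0 < m & cnorm (m^-1%:C *: x) <= 1.
Proof.
exists (cnorm x + 1); first by rewrite ltr_wpDl// cnorm_ge0.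
have m0 : 0 < cnorm x + 1 by rewrite ltr_wpDl// cnorm_ge0.
rewrite cnormZ cnorm_real ger0_norm; last by rewrite invr_ge0 ltW.
by rewrite mulrC ler_pdivrMr// mul1r lerDl.
Qed.

Lemma small_eq0 (V : normedZmodType R[i]) (x : V) (K : R) :
  (forall n, cnorm x <= K * 2%:R^-1 ^+ n) -> x = 0.
Proof.
move=> xK; apply/cnorm_eq0/le_anti; rewrite cnorm_ge0 andbT.
apply/ler_addgt0Pr => e e0; rewrite add0r.
by have [n /ltW] := @geometric_small R K _ e0; apply: le_trans.
Qed.

(** By commutativity ||e n - e m|| <= ||e n - e m e n|| + ||e n e m - e m||, so approximate
units form a Cauchy sequence. *)
Lemma approximate_unit_unital (A : cstarAlgType R) : commutative (@cmul R A) ->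
  sentence_value A unit_sentence <= 0 -> unital A.
Proof.
move=> cA A0; have e0 : env_in_ball (fun _ : 'I_0 => 0 : A) by case.
have /choice[e eP] n : exists e : A, unit_ball e /\
    forall x, unit_ball x -> cnorm (cmul e x - x) <= 2%:R^-1 ^+ n.
  have /(le_lt_trans A0) : 0 < (2%:R^-1 : R) ^+ n by rewrite exprn_gt0// invr_gt0.
  rewrite /sentence_value => /FInf_ltP[//|e eb h]; exists e; split=> // x xb.
  move/ltW/FSup_leP: h => /(_ (env_in_ball_cons e0 eb) x xb).
  by rewrite /= env_consS !env_cons0 scaleN1r.
have h2 n : 2%:R^-1 ^+ n.+1 <= 2%:R^-1 ^+ n :> R.
  rewrite exprS ger_pMl ?exprn_gt0 ?invr_gt0//.
  have : (2%:R^-1 : R) <= 1 by rewrite invf_le1 ?ler1n ?ltr0n.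
  exact.
have [|l lP] := @geometric_cvg _ A e 2%:R.
  move=> n; apply: le_trans (cnorm_triangle _ (cmul (e n) (e n.+1)) _) _.
  rewrite mulr_natl mulr2n lerD//.
    by rewrite cnormB; exact: (eP n).2 _ (eP n.+1).1.
  by rewrite cA; apply: le_trans (h2 n); exact: (eP n.+1).2 _ (eP n).1.
have lb x : unit_ball x -> cmul l x = x.
  move=> xb; apply/eqP; rewrite -subr_eq0; apply/eqP.
  apply: (@small_eq0 _ _ 5%:R) => n.
  apply: le_trans (cnorm_triangle _ (cmul (e n) x) _) _.
  have -> : 5%:R * 2%:R^-1 ^+ n = 2%:R *+ 2 * 2%:R^-1 ^+ n + 2%:R^-1 ^+ n :> R by ring.
  rewrite lerD//; last exact: (eP n).2.
  rewrite -cmulBl (le_trans (cnormM _ _))// (le_trans _ (lP n))//.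
  by rewrite -[leRHS]mulr1 ler_wpM2l ?cnorm_ge0.
have lx x : cmul l x = x.
  have [m m0 mx] := scale_into_ball x.
  have mC : m%:C != 0 :> R[i] by apply/eqP => /complexI m00; rewrite m00 ltxx in m0.
  have -> : x = m%:C *: (m^-1%:C *: x) by rewrite scalerA -rmorphM/= divff ?gt_eqF// scale1r.
  by rewrite cmulZr lb.
by exists l => x; split=> //; rewrite cA.
Qed.

Lemma projection_in_ball (A : cstarAlgType R) (p : A) : is_projection p -> unit_ball p.
Proof. exact: cnorm_projection_le1. Qed.

Lemma unital_unit_sentence (A : cstarAlgType R) (e : A) : is_unit e -> unit_ball e ->
  sentence_value A unit_sentence <= 0.
Proof.
move=> eu eb; have e0 : env_in_ball (fun _ : 'I_0 => 0 : A) by case.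
apply/ler_addgt0Pr => d d0; rewrite add0r; apply/ltW/FInf_ltP => //; exists e => //.
apply: le_lt_trans (d0); apply/FSup_leP; first exact: env_in_ball_cons.
by move=> x xb; rewrite /= env_consS !env_cons0 scaleN1r (eu x).1 subrr cnorm0.
Qed.

End UnitSentence.

(** * Almost idempotent elements *)

Section Newton.
Context {R : realType} (A : cstarAlgType R) (H : comm_unital A).

(** Newton's iteration x |-> 3 x^2 - 2 x^3 for the equation x^2 = x.  With t = x^2 - x, one
step moves x by -t (2 x - 1) and replaces t by t^2 (4 t - 3): the defect at least
halves, and x moves in total by at most 10 times the initial defect.  The bound 1/20
keeps the iterates in the ball of radius 2, where these estimates hold. *)
Lemma projection_near_almost_idempotent (p : A) : unit_ball p ->
  cnorm (cmul p p - p) <= 20%:R^-1 ->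
  exists2 q, is_projection q & cnorm (q - p) <= 10%:R * cnorm (cmul p p - p).
Proof.
move=> pb; set r := cnorm _ => r20.
have r0 : 0 <= r by exact: cnorm_ge0.
pose F (x : cring H) : cring H := 3%:R * x ^+ 2 - 2%:R * x ^+ 3.
pose s n : cring H := iter n F p.
pose t n : cring H := s n ^+ 2 - s n.
have natn := @cring_norm_natM _ _ H.
have st n : s n.+1 - s n = - t n * (2%:R * s n - 1) by rewrite /t /s iterS /F; ring.
have tt n : t n.+1 = t n ^+ 2 * (4%:R * t n - 3%:R) by rewrite /t /s iterS /F; ring.
have h01 n : 0 < (2%:R^-1 : R) ^+ n <= 1.
  rewrite exprn_gt0 ?invr_gt0//= exprn_ile1// ?invr_ge0//.
  have : (2%:R^-1 : R) <= 1 by rewrite invf_le1 ?ler1n ?ltr0n.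
  exact.
have norm1 : cnorm (1 : cring H) = 1 := cring_norm1 H.
have step n : cnorm (s n) <= 2%:R -> cnorm (s n.+1 - s n) <= 5%:R * cnorm (t n).
  move=> sn; rewrite st (le_trans (cring_normM _ _))// cnormN mulrC ler_wpM2r ?cnorm_ge0//.
  by rewrite (le_trans (cnormD _ _))// cnormN norm1 natn; lra.
have inv n : cnorm (s n - p) <= 10%:R * r * (1 - 2%:R^-1 ^+ n) /\ cnorm (t n) <= r * 2%:R^-1 ^+ n.
  elim: n => [|n [ih1 ih2]].
    by rewrite /t /s /= expr0 subrr subrr cnorm0 mulr0 mulr1; split.
  have /andP[h0 h1] := h01 n.
  have sn : cnorm (s n) <= 2%:R.
    rewrite (le_trans (cnorm_subl _ p))//; move: pb; rewrite /unit_ball/= => pb.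
    have : 10%:R * r * (1 - 2%:R^-1 ^+ n) <= 10%:R * r by nra.
    by lra.
  rewrite exprS; split.
    rewrite (le_trans (cnorm_triangle _ (s n) _))//.
    have := step n sn; lra.
  have tn : cnorm (t n) <= 20%:R^-1 by rewrite (le_trans ih2)//; nra.
  have t0 := cnorm_ge0 (t n).
  rewrite tt (le_trans (cring_normM _ _))// cring_norm_sqr.
  have : cnorm (4%:R * t n - 3%:R) <= 4%:R.
    rewrite (le_trans (cnormD _ _))// cnormN natn -[3%:R](mulr1 (3%:R : cring H)) natn norm1; lra.
  have := cnorm_ge0 (4%:R * t n - 3%:R); nra.
have [|l lP] := @geometric_cvg _ (cring H) s (5%:R * r).
  move=> n; have [h1 h2] := inv n; have /andP[h3 h4] := h01 n.
  rewrite (le_trans (step n _))//; last by rewrite -mulrA ler_pM2l.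
  rewrite (le_trans (cnorm_subl _ p))//; move: pb; rewrite /unit_ball/= => pb.
  have : 10%:R * r * (1 - 2%:R^-1 ^+ n) <= 10%:R * r by nra.
  by lra.
have lp : cnorm (l - p) <= 10%:R * r.
  have := lP 0%N; rewrite expr0 mulr1 (_ : (5%:R * r) *+ 2 = 10%:R * r) //; ring.
exists l => //; apply: normal_idempotent_projection; last exact: (cu_comm H).
apply/eqP; rewrite -subr_eq0; apply/eqP; apply: (@small_eq0 _ _ _ (10%:R * r * (cnorm l + 3%:R) + r)) => n.
have lE : l * l - l = (l - s n) * (l + s n - 1) + t n by rewrite /t; ring.
rewrite -[leLHS]/(cnorm (l * l - l)) lE.
have [h1 h2] := inv n; have /andP[h3 h4] := h01 n.
rewrite (le_trans (cnormD _ _))// [leRHS]mulrDl lerD// (le_trans (cring_normM _ _))//.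
have sl : cnorm (l + s n - 1) <= cnorm l + 3%:R.
  rewrite (le_trans (cnormD _ _))// cnormN norm1 (le_trans (lerD (cnormD _ _) (lexx _)))//.
  have sn : cnorm (s n) <= 2%:R.
    rewrite (le_trans (cnorm_subl _ p))//; move: pb; rewrite /unit_ball/= => pb.
    have : 10%:R * r * (1 - 2%:R^-1 ^+ n) <= 10%:R * r by nra.
    by lra.
  by lra.
rewrite mulrAC ler_pM ?cnorm_ge0//.
by move: (lP n); rewrite (_ : (5%:R * r) *+ 2 = 10%:R * r)//; ring.
Qed.

End Newton.

(** * Sentences for real rank zero and for minimal projections *)

Section Sentences.
Context {R : realType}.

(** Twice the positive part; written so as to be visibly continuous. *)
Definition excess (t : R) : R := t + `|t|.
Definition twice_min (a b : R) : R := a + b - `|a - b|.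

Lemma excess_ge0 t : 0 <= excess t.
Proof. by rewrite /excess; have := ler_norm (- t); rewrite normrN; lra. Qed.

Lemma excess_ge t : t <= excess t / 2%:R.
Proof. by rewrite /excess; have := ler_norm t; lra. Qed.

Lemma excess_eq0 t : t <= 0 -> excess t = 0.
Proof. by move=> t0; rewrite /excess ler0_norm// subrr. Qed.

Lemma twice_min_le (a b c : R) : a <= c \/ b <= c -> twice_min a b <= 2%:R * c.
Proof.
rewrite /twice_min; have := ler_norm (a - b); have := ler_norm (b - a); rewrite distrC.
by move=> h1 h2 [h|h]; lra.
Qed.

Lemma twice_min_lt (a b c : R) : twice_min a b < 2%:R * c -> a < c \/ b < c.
Proof.
move=> h; have [ac|ac] := ltP a c; [by left|right].
have [bc//|bc] := ltP b c; move: h; rewrite /twice_min.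
have [ab|ab] := leP a b.
  by rewrite ler0_norm ?subr_le0//; lra.
by rewrite gtr0_norm ?subr_gt0//; lra.
Qed.

Lemma coordinate_cvg m (i : 'I_m) (r : 'rV[R]_m) : (fun u : 'rV[R]_m => u 0 i) @ r --> r 0 i.
Proof. exact: coord_continuous. Qed.

Lemma excess_cvg (T : Type) (F : set_system T) {FF : Filter F} (f : T -> R) (a : R) : f @ F --> a ->
  (fun t => excess (f t)) @ F --> excess a.
Proof. by move=> fa; apply: cvgD => //; exact: cvg_norm. Qed.

Definition PSub n (P Q : @star_poly R n) := PAdd P (PScale (-1) Q).

Definition norms_formula n (s : seq (@star_poly R n)) (f : 'rV[R]_(size s) -> R) (fc : continuous f) :
  @formula R n := FConn fc (fun i => FNorm (nth (@PZero R n) s i)).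

Local Notation var0 := (PVar ord0).
Local Notation var1 := (PVar (lift ord0 ord0)).
Local Notation var2 := (PVar (lift ord0 (lift ord0 ord0))).
Local Notation coor m r k := (r ord0 (@Ordinal m k isT)).

Definition rr_connective (r : 'rV[R]_3) : R :=
  excess (coor 3 r 0%N - 2%:R^-1) + coor 3 r 1%N + coor 3 r 2%N.

Lemma rr_connective_continuous : continuous rr_connective.
Proof.
move=> r; have c (i : 'I_3) := @coordinate_cvg 3 i r.
have h := cvgD (cvgD (excess_cvg (cvgB (c (@Ordinal 3 0 isT)) (cvg_cst (2%:R^-1 : R))))
  (c (@Ordinal 3 1 isT))) (c (@Ordinal 3 2 isT)).
exact: h.
Qed.

(** Self-adjoint x in the ball is within 1/2 of (p - q) / 2 for p and q the spectral
projections on the positive and negative parts of the spectrum; x is replaced by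
its real part, and p, q are asked to be idempotent. *)
Definition rr_polys : seq (@star_poly R 3) :=
  [:: PSub (PScale 2%:R^-1 (PAdd var2 (PStar var2))) (PScale 2%:R^-1 (PSub var1 var0));
      PSub (PMul var1 var1) var1; PSub (PMul var0 var0) var0].

Definition rr_sentence : sentence R :=
  FSup (FInf (FInf (@norms_formula 3 rr_polys _ rr_connective_continuous))).

Definition rr_defect (A : cstarAlgType R) (x p q : A) : R :=
  excess (cnorm (2%:R^-1 *: (x + cstar x) - 2%:R^-1 *: (p - q)) - 2%:R^-1)
  + cnorm (cmul p p - p) + cnorm (cmul q q - q).

Lemma rr_sentenceP (A : cstarAlgType R) : sentence_value A rr_sentence <= 0 <->
  forall (x : A) (eps : R), unit_ball x -> 0 < eps ->
    exists p q : A, [/\ unit_ball p, unit_ball q & rr_defect x p q < eps].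
Proof.
have e0 : env_in_ball (fun _ : 'I_0 => 0 : A) by case.
have ev x p q : formula_eval (@norms_formula 3 rr_polys _ rr_connective_continuous)
    (env_cons q (env_cons p (env_cons x (fun _ : 'I_0 => 0 : A)))) = rr_defect x p q.
  by rewrite /= /rr_connective !mxE /= !env_consS !env_cons0 !scaleN1r.
rewrite /sentence_value FSup_leP//; split=> h x.
  move=> eps xb eps0; have := h x xb => /le_lt_trans/(_ eps0)/FInf_ltP.
  move=> /(_ (env_in_ball_cons e0 xb))[p pb] /FInf_ltP.
  move=> /(_ (env_in_ball_cons (env_in_ball_cons e0 xb) pb))[q qb].
  by rewrite ev => d; exists p, q.
move=> xb; apply/ler_addgt0Pr => eps eps0; rewrite add0r; apply/ltW/FInf_ltP; first exact: env_in_ball_cons.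
have [p [q [pb qb d]]] := h x eps xb eps0; exists p => //; apply/FInf_ltP; first exact: (env_in_ball_cons (env_in_ball_cons e0 xb) pb).
by exists q => //; rewrite ev.
Qed.

Definition atom_connective (r : 'rV[R]_7) : R :=
  `|coor 7 r 0%N - coor 7 r 1%N| + excess (1 - coor 7 r 2%N) + coor 7 r 3%N
  + excess (twice_min (coor 7 r 4%N) (coor 7 r 5%N) - 4%:R * coor 7 r 6%N).

Lemma atom_connective_continuous : continuous atom_connective.
Proof.
move=> r; have c (i : 'I_7) := @coordinate_cvg 7 i r.
have c4 := c (@Ordinal 7 4 isT); have c5 := c (@Ordinal 7 5 isT).
have h1 := cvg_norm (cvgB (c (@Ordinal 7 0 isT)) (c (@Ordinal 7 1 isT))).
have h2 := excess_cvg (cvgB (cvg_cst (1 : R)) (c (@Ordinal 7 2 isT))).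
have h3 := excess_cvg (cvgB (cvgB (cvgD c4 c5) (cvg_norm (cvgB c4 c5)))
  (cvgM (cvg_cst (4%:R : R)) (c (@Ordinal 7 6 isT)))).
have h := cvgD (cvgD (cvgD (h1 _ _) (h2 _ _ _)) (c (@Ordinal 7 3 isT))) (h3 _ _ _ _ _ _ _ _).
exact: h.
Qed.

(** For p minimal, qp is a multiple d p of p, and one of
|d|, |1 - d| is at most 2 |d^2 - d|.
For q a projection this forces qp to be 0 or p, so that minimality of p is expressed
by quantifying over all of the ball, and not over projections only. *)
Definition atom_polys : seq (@star_poly R 3) :=
  [:: var2; PMul var2 var1; var1; PSub (PMul var1 var1) var1;
      PMul var0 var1; PSub var1 (PMul var0 var1);
      PSub (PMul (PMul var0 var0) var1) (PMul var0 var1)].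

Definition atom_sentence : sentence R :=
  FSup (FInf (FSup (@norms_formula 3 atom_polys _ atom_connective_continuous))).

Definition atom_defect (A : cstarAlgType R) (x p q : A) : R :=
  `|cnorm x - cnorm (cmul x p)| + excess (1 - cnorm p) + cnorm (cmul p p - p)
  + excess (twice_min (cnorm (cmul q p)) (cnorm (p - cmul q p))
            - 4%:R * cnorm (cmul (cmul q q) p - cmul q p)).

Lemma atom_sentenceP (A : cstarAlgType R) : sentence_value A atom_sentence <= 0 <->
  forall (x : A) (eps : R), unit_ball x -> 0 < eps ->
    exists2 p : A, unit_ball p & forall q, unit_ball q -> atom_defect x p q < eps.
Proof.
have e0 : env_in_ball (fun _ : 'I_0 => 0 : A) by case.
have ev x p q : formula_eval (@norms_formula 3 atom_polys _ atom_connective_continuous)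
    (env_cons q (env_cons p (env_cons x (fun _ : 'I_0 => 0 : A)))) = atom_defect x p q.
  by rewrite /= /atom_connective !mxE /= !env_consS !env_cons0 !scaleN1r.
rewrite /sentence_value FSup_leP//; split=> h x.
  move=> eps xb eps0; have := h x xb => /le_lt_trans/(_ eps0)/FInf_ltP.
  move=> /(_ (env_in_ball_cons e0 xb))[p pb s]; exists p => // q qb.
  apply: le_lt_trans s; rewrite -ev.
  have := (iffLR (FSup_leP (@norms_formula 3 atom_polys _ atom_connective_continuous)
     (env_in_ball_cons (env_in_ball_cons e0 xb) pb) _)) (lexx _).
  exact.
move=> xb; apply/ler_addgt0Pr => eps eps0; rewrite add0r; apply/ltW/FInf_ltP; first exact: env_in_ball_cons.
have eps2 : 0 < eps / 2%:R by rewrite divr_gt0.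
have [p pb d] := h x _ xb eps2; exists p => //; apply: (@le_lt_trans _ _ (eps / 2%:R)).
  apply/FSup_leP; first exact: (env_in_ball_cons (env_in_ball_cons e0 xb) pb).
  by move=> q qb; rewrite ev ltW// d.
by rewrite ltr_pdivrMr// ltr_pMr// ltr1n.
Qed.

End Sentences.

(** * Validity of the sentences in spanned algebras *)

Section DiagonalSentences.
Context {R : realType} (D : cstarAlgType R) (n : nat) (p : 'I_n -> D).
Hypotheses (D0 : nonzero_algebra D) (po : orthogonal_projections p) (p0 : forall j, p j != 0)
  (pspan : forall x, exists c, x = combination p c).

Lemma spanned_unit_sentence : sentence_value D unit_sentence <= 0.
Proof.
apply: unital_unit_sentence (spanned_is_unit po pspan) _.
by apply: projection_in_ball; exact: projection_sum.
Qed.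

Lemma spanned_rr_sentence : sentence_value D rr_sentence <= 0.
Proof.
apply/rr_sentenceP => x eps xb eps0; have [c xE] := pspan x.
have c1 j : cnorm (c j) <= 1.
  by rewrite (le_trans (cnorm_combination_ge po c (p0 j)))// -xE.
pose P := \sum_(j | 0 < complex.Re (c j)) p j; pose Q := \sum_(j | complex.Re (c j) < 0) p j.
have Pp : is_projection P by exact: projection_sum.
have Qp : is_projection Q by exact: projection_sum.
exists P, Q; split; try exact: projection_in_ball.
rewrite /rr_defect Pp.2 Qp.2 !subrr cnorm0 !addr0 excess_eq0// subr_le0.
have PE (S : pred 'I_n) : \sum_(j | S j) p j = combination p (fun j => (S j)%:R).
  by rewrite /combination big_mkcond; apply: eq_bigr => j _; case: ifP; rewrite ?scale1r ?scale0r.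
rewrite xE (combination_star po) combinationD combinationZ /P /Q !PE combinationB combinationZ combinationB.
apply: cnorm_combination_le => [||j _]; [exact: po|by rewrite invr_ge0|].
have -> : 2%:R^-1 * (c j + Num.conj (c j)) = (complex.Re (c j))%:C.
  have -> : c j + Num.conj (c j) = 2%:R * (complex.Re (c j))%:C by exact: addcJ.
  by rewrite mulKf// pnatr_eq0.
set t := complex.Re (c j).
have t1 : `|t| <= 1 := le_trans (normr_Re_le _) (c1 j).
have hE (r : R) : 2%:R^-1 * r%:C = (2%:R^-1 * r)%:C :> R[i] by rewrite rmorphM/= fmorphV rmorph_nat.
have bE (b : bool) : b%:R = (b%:R : R)%:C :> R[i] by rewrite rmorph_nat.
rewrite !bE -rmorphB/= hE -rmorphB/= cnorm_real.
move: t1; rewrite !ler_norml => /andP[t1 t2].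
case: (ltgtP t 0) => [tn|tp|->] /=; rewrite ?(subr0, sub0r, mulr1, mulr0).
- by rewrite mulrN mulr1 opprK; apply/andP; split; lra.
- by apply/andP; split; lra.
- by apply/andP; split; lra.
Qed.

Lemma spanned_atom_sentence : sentence_value D atom_sentence <= 0.
Proof.
apply/atom_sentenceP => x eps xb eps0; have [c xE] := pspan x.
have [j0 _] : exists j : 'I_n, True.
  have [y y0] := D0; apply: contrapT => h; case/eqP: y0; have [d ->] := pspan y.
  by rewrite /combination big1// => j _; case: h; exists j.
pose j := [arg max_(i > j0) cnorm (c i)]%O.
have jmax i : cnorm (c i) <= cnorm (c j).
  by rewrite /j; case: arg_maxP => // k _; apply.
have pj1 : cnorm (p j) = 1 := cnorm_projection (po.1 j) (p0 j).
exists (p j); first exact/projection_in_ball/po.1.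
move=> q qb; have [d qE] := pspan q.
rewrite /atom_defect xE qE (combinationM po) !(combination_mul_proj po) (po.1 j).2 subrr cnorm0 addr0.
have -> : cnorm (combination p c) = cnorm (c j).
  apply/le_anti; rewrite (cnorm_combination_ge po)// andbT.
  by apply: cnorm_combination_le => //; exact: cnorm_ge0.
rewrite cnormZ pj1 mulr1 subrr normr0 add0r subrr excess_eq0// add0r.
rewrite -scalerBl -{2}[p j]scale1r -scalerBl !cnormZ pj1 !mulr1 excess_eq0// subr_le0.
have -> : d j * d j - d j = - (d j * (1 - d j)) by ring.
rewrite cnormN cnormMC; set a := cnorm (d j); set b := cnorm (1 - d j).
have a0 : 0 <= a by exact: cnorm_ge0.
have b0 : 0 <= b by exact: cnorm_ge0.
have ab : 1 <= a + b.
  have -> : 1 = cnorm (1 : R[i]) by rewrite -[1 in RHS](rmorph1 (real_complex R)) cnorm_real normr1.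
  by have := cnormD (d j) (1 - d j); rewrite addrCA subrr addr0.
have -> : 4%:R * (a * b) = 2%:R * (2%:R * (a * b)) by ring.
apply: twice_min_le; have [le|le] := leP a b; [left|right]; nra.
Qed.

End DiagonalSentences.

(** * Consequences of the sentences *)

Section Consequences.
Context {R : realType} (A : cstarAlgType R) (H : comm_unital A).

(** The bound 1/2 of the sentence worsens slightly when the approximate projections
are replaced by projections; any bound less than 1 can be iterated. *)
Lemma rr_sentence_halving (x : A) : sentence_value A rr_sentence <= 0 ->
  cstar x = x -> unit_ball x -> exists p q : A, [/\ is_projection p, is_projection q &
    cnorm (x - (2%:R^-1 : R)%:C *: (p - q)) <= 2%:R / 3%:R].
Proof.
move=> /rr_sentenceP rrA xs xb.
(* Correcting p0 and q0 costs ten times the defect: 1/2 + 11/100 < 2/3. *)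
have [p0 [q0 [p0b q0b]]] := rrA x 100%:R^-1 xb (ltac:(by rewrite invr_gt0)).
have hC : (2%:R^-1 : R)%:C = 2%:R^-1 :> R[i] by rewrite fmorphV rmorph_nat.
rewrite /rr_defect.
have -> : 2%:R^-1 *: (x + cstar x) = x.
  by rewrite xs scalerDr -scalerDl (_ : 2%:R^-1 + 2%:R^-1 = 1) ?scale1r//; field.
set d := cnorm (x - _) => defect.
have := excess_ge (d - 2%:R^-1); have := excess_ge0 (d - 2%:R^-1).
have := cnorm_ge0 (cmul p0 p0 - p0); have := cnorm_ge0 (cmul q0 q0 - q0) => n1 n2 e1 e2.
have [|p pp pd] := projection_near_almost_idempotent H p0b; first by move: defect; lra.
have [|q qp qd] := projection_near_almost_idempotent H q0b; first by move: defect; lra.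
exists p, q; split=> //.
have -> : x - (2%:R^-1 : R)%:C *: (p - q) =
    (x - 2%:R^-1 *: (p0 - q0)) + (2%:R^-1 : R)%:C *: ((p0 - p) - (q0 - q)).
  rewrite hC -addrA; congr (_ + _); rewrite -!scalerN -scalerDr; congr (_ *: _).
  have E (a b c e : cring H) : - (a - b) = - (c - e) + ((c - a) - (e - b)) by ring.
  exact: E.
apply: le_trans (cnormD _ _) _; rewrite -/d cnormZ cnorm_real ger0_norm ?invr_ge0//.
have := cnormD (p0 - p) (- (q0 - q)); rewrite cnormN (cnormB p0) (cnormB q0).
move: defect; lra.
Qed.

(** Rescaling the remainder to the unit ball and iterating [rr_sentence_halving]
approximates x by real combinations of projections with errors (2/3)^n. *)
Theorem rr_sentence_real_rank_zero : sentence_value A rr_sentence <= 0 -> real_rank_zero A.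
Proof.
move=> rrA; apply: (dense_combinations_real_rank_zero H) => a eps as_ eps0.
have key n : forall x : A, cstar x = x -> unit_ball x -> exists r : seq (R * A),
     (forall lp, lp \in r -> is_projection lp.2) /\
     cnorm (x - \sum_(lp <- r) lp.1%:C *: lp.2) <= (2%:R / 3%:R) ^+ n.
  elim: n => [|n ih] x xs xb.
    by exists [::]; split=> //; rewrite big_nil subr0 expr0.
  have [p [q [pp qp xpq]]] := rr_sentence_halving rrA xs xb.
  set z := x - _ in xpq.
  have zs : cstar z = z.
    rewrite /z cstarB xs cstarZ cstarB pp.1 qp.1; congr (_ - _ *: _); exact: conjc_real.
  pose y := (3%:R / 2%:R : R)%:C *: z.
  have ys : cstar y = y by rewrite /y cstarZ zs; congr (_ *: _); exact: conjc_real.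
  have yb : unit_ball y.
    by rewrite /unit_ball/= cnormZ cnorm_real ger0_norm//; lra.
  have [r [rp yr]] := ih y ys yb.
  exists [:: (2%:R^-1, p), (- 2%:R^-1, q) & [seq (2%:R / 3%:R * lp.1, lp.2) | lp <- r]]; split.
    move=> lp; rewrite !inE => /or3P[/eqP ->|/eqP ->|/mapP[lp' lpr ->]] //=; exact: rp.
  rewrite !big_cons big_map/=.
  have zy : z = (2%:R / 3%:R : R)%:C *: y.
    by rewrite /y scalerA -rmorphM/= (_ : 2%:R / 3%:R * (3%:R / 2%:R) = 1 :> R) ?scale1r//; field.
  have -> : \sum_(j <- r) (2%:R / 3%:R * j.1)%:C *: j.2 = (2%:R / 3%:R : R)%:C *: \sum_(j <- r) j.1%:C *: j.2.
    by rewrite scaler_sumr; apply: eq_bigr => j _; rewrite scalerA -rmorphM.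
  have -> : x - ((2%:R^-1)%:C *: p + ((- 2%:R^-1)%:C *: q + (2%:R / 3%:R : R)%:C *: \sum_(j <- r) j.1%:C *: j.2))
      = z - (2%:R / 3%:R : R)%:C *: \sum_(j <- r) j.1%:C *: j.2.
    by rewrite /z rmorphN/= scaleNr scalerBr !opprD !addrA.
  by rewrite zy -scalerBr cnormZ cnorm_real ger0_norm// exprS ler_wpM2l.
have [m m0 ma] := scale_into_ball a.
have mC : m%:C != 0 :> R[i] by apply/eqP => /complexI m00; rewrite m00 ltxx in m0.
pose x : A := m^-1%:C *: a.
have ax : a = m%:C *: x by rewrite /x scalerA -rmorphM/= divff ?gt_eqF// scale1r.
have xs : cstar x = x by rewrite /x cstarZ as_; congr (_ *: _); exact: conjc_real.
have [n nm] := @geometric_small R m _ eps0.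
(* The exponent is doubled since (2/3)^2 < 1/2. *)
have [r [rp xr]] := key (n * 2)%N x xs ma.
exists [seq (m * lp.1, lp.2) | lp <- r]; split.
  by move=> _ /mapP[lp lpr ->]; exact: (rp lp lpr).
rewrite big_map/=.
have -> : \sum_(j <- r) (m * j.1)%:C *: j.2 = m%:C *: \sum_(j <- r) j.1%:C *: j.2.
  by rewrite scaler_sumr; apply: eq_bigr => j _; rewrite scalerA -rmorphM.
rewrite ax -scalerBr cnormZ cnorm_real gtr0_norm//; apply: le_lt_trans nm.
rewrite ler_wpM2l ?(ltW m0)// (le_trans xr)// mulnC exprM lerXn2r ?nnegrE ?exprn_ge0 ?divr_ge0 ?invr_ge0//.
by lra.
Qed.

Lemma minimal_of_small_defect (p : A) : is_projection p -> p != 0 ->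
  (forall q, is_projection q -> cnorm (cmul q p) < 1 \/ cnorm (p - cmul q p) < 1) ->
  minimal_projection p.
Proof.
move=> pp pn0 small; split=> // q [qp pq qpq].
have pq' : is_projection (p - q) by apply: projectionB => //; exact: (cu_comm H).
have [|] := small q qp; rewrite qpq => lt1; [left|right]; apply/eqP; apply: contraT => n0.
  by rewrite (cnorm_projection qp n0) ltxx in lt1.
by rewrite (cnorm_projection pq') ?ltxx// in lt1; rewrite subr_eq0 eq_sym.
Qed.

(** A projection p close to one given by the sentence is nonzero, and each projection q
has ||qp|| or ||p - qp|| less than 1.  These are norms of projections when q is below
p, so one of them vanishes. *)
Lemma atom_sentence_minimal : sentence_value A atom_sentence <= 0 ->
  forall (x : A) (eps : R), unit_ball x -> 0 < eps ->
    exists2 p, minimal_projection p & `|cnorm x - cnorm (cmul x p)| < eps.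
Proof.
move=> /atom_sentenceP atA x eps xb eps0.
(* The defect d moves p by 10 d, which with d itself makes an error of 11 d. *)
pose d := Num.min (eps / 11%:R) 100%:R^-1.
have d0 : 0 < d by rewrite lt_min divr_gt0//= invr_gt0.
have de : 11%:R * d <= eps by rewrite mulrC -ler_pdivlMr// ge_min lexx.
have d1 : d <= 100%:R^-1 by rewrite ge_min lexx orbT.
have [p0 p0b dP] := atA x d xb d0.
have := dP 0; rewrite {1}/unit_ball/= cnorm0 ler01 => /(_ isT); rewrite /atom_defect.
set t := twice_min _ _ - _; have := excess_ge0 t => t0.
have := excess_ge (1 - cnorm p0); have := excess_ge0 (1 - cnorm p0).
have := normr_ge0 (cnorm x - cnorm (cmul x p0)); have := cnorm_ge0 (cmul p0 p0 - p0).
move=> n1 n2 e1 e2 lt.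
have [|p pp pd] := projection_near_almost_idempotent H p0b; first by lra.
have pn0 : p != 0.
  have := cnorm_subl p0 p; rewrite cnormB -cnorm_gt0; lra.
exists p.
  apply: minimal_of_small_defect => // q qp; have qb := projection_in_ball qp.
  have := dP q qb; rewrite /atom_defect qp.2 subrr cnorm0 mulr0 subr0.
  set s := twice_min _ _; have := excess_ge s; have := excess_ge0 s => s0 s1 lt'.
  have : s < 2%:R * (2%:R * d) by lra.
  have qpd : cnorm (cmul q (p - p0)) <= cnorm (p - p0).
    by rewrite (le_trans (cnormM _ _))// ler_piMl ?cnorm_ge0.
  move=> /twice_min_lt[h|h]; [left|right].
    have -> : cmul q p = cmul q p0 + cmul q (p - p0) by rewrite -cmulDr addrCA subrr addr0.
    by rewrite (le_lt_trans (cnormD _ _))//; lra.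
  have -> : p - cmul q p = (p0 - cmul q p0) + ((p - p0) - cmul q (p - p0)).
    have E (a b c : cring H) : a - c * a = (b - c * b) + ((a - b) - c * (a - b)) by ring.
    exact: E.
  rewrite (le_lt_trans (cnormD _ _))//; have := cnormD (p - p0) (- cmul q (p - p0)); rewrite cnormN; lra.
have := cnorm_dist (cmul x p0) (cmul x p); rewrite -cmulBr.
have : cnorm (cmul x (p0 - p)) <= cnorm (p - p0).
  by rewrite (cnormB p) (le_trans (cnormM _ _))// ler_piMl ?cnorm_ge0.
have := ler_distD (cnorm (cmul x p0)) (cnorm x) (cnorm (cmul x p)).
lra.
Qed.

Lemma normed_of_ball : approximable A ->
  (forall (x : A) (eps : R), unit_ball x -> 0 < eps ->
    exists2 p, minimal_projection p & `|cnorm x - cnorm (cmul x p)| < eps) ->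
  normed_by_minimal_projections A.
Proof.
move=> ap nb x eps eps0; have [m m0 mx] := scale_into_ball x.
have [p pm px] := nb (m^-1%:C *: x) (eps / m) mx (divr_gt0 eps0 m0).
exists p; split=> //; first exact: minimal_projection_scalar_corner.
have mV : `|m^-1| = m^-1 by rewrite gtr0_norm ?invr_gt0.
move: px; rewrite cmulZl !cnormZ cnorm_real mV -mulrBr normrM mV.
by rewrite mulrC ltr_pM2r ?invr_gt0.
Qed.

End Consequences.

(** The three sentences hold in algebras spanned by orthogonal projections, hence in
A. *)
Theorem pseudocompact_unital_rr0_normed (R : realType) (A : cstarAlgType R) :
  nonzero_algebra A -> commutative (@cmul R A) -> pseudocompact A ->
  [/\ unital A, real_rank_zero A & normed_by_minimal_projections A].
Proof.
move=> nz cA pA; have tr := pseudocompact_transfer cA pA.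
have u : unital A.
  apply: approximate_unit_unital => //; apply: tr => D D0 [n [p [po p0 pspan]]].
  exact: spanned_unit_sentence po pspan.
have [e eu] := u; have H := comm_unital_of nz cA eu.
have rr : real_rank_zero A.
  apply: (rr_sentence_real_rank_zero H); apply: tr => D D0 [n [p [po p0 pspan]]].
  exact: spanned_rr_sentence po p0 pspan.
split=> //; apply: (normed_of_ball H); first exact: real_rank_zero_approximable.
apply: (atom_sentence_minimal H); apply: tr => D D0 [n [p [po p0 pspan]]].
exact: spanned_atom_sentence D0 po p0 pspan.
Qed.

(** * The explicit axioms *)

Section ExplicitConditions.
Context {R : realType} (A : cstarAlgType R).

Lemma inf_image_le (T : Type) (D : set T) (f : T -> R) x :
  (forall y, D y -> 0 <= f y) -> D x -> inf [set f y | y in D] <= f x.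
Proof.
by move=> f0 Dx; apply: ge_inf; [exists 0 => _ [y /f0 h <-]|exists x].
Qed.

Lemma inf_image_ge0 (T : Type) (D : set T) (f : T -> R) :
  D !=set0 -> (forall y, D y -> 0 <= f y) -> 0 <= inf [set f y | y in D].
Proof.
move=> [x Dx] f0; apply: lb_le_inf; first by exists (f x), x.
by move=> _ [y /f0 h <-].
Qed.

Lemma inf_image_lt (T : Type) (D : set T) (f : T -> R) (c : R) :
  D !=set0 -> (forall y, D y -> 0 <= f y) -> inf [set f y | y in D] < c ->
  exists2 x, D x & f x < c.
Proof.
move=> [x Dx] f0 lt.
have hi : has_inf [set f y | y in D].
  by split; [exists (f x), x|exists 0 => _ [y /f0 h <-]].
have [|_ [y Dy <-] h] := @inf_adherent R _ (c - inf [set f y | y in D]) _ hi; first by rewrite subr_gt0.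
by exists y => //; move: h; rewrite addrC subrK.
Qed.

Lemma sup_image_ge0 (T : Type) (D : set T) (f : T -> R) (M : R) :
  D !=set0 -> (forall y, D y -> 0 <= f y <= M) -> 0 <= sup [set f y | y in D].
Proof.
move=> [x Dx] f0; have /andP[h _] := f0 x Dx; apply: le_trans h _.
by apply: (@sup_image_ge _ _ _ _ M) => // y /f0/andP[].
Qed.

Lemma axiom_commutativeP : axiom_commutative A <-> commutative (@cmul R A).
Proof.
rewrite /axiom_commutative; set S := (X in sup X); split=> [S0 x y|cA]; last first.
  have S0 : S = [set 0].
    apply/seteqP; split=> [_ [x _ [y _ <-]]|_ ->]; first by rewrite /= cA subrr cnorm0.
    exists 0; first by rewrite /unit_ball/= cnorm0.
    by exists 0; rewrite ?cmul0x ?subrr ?cnorm0// /unit_ball/= cnorm0.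
  by rewrite S0 sup1.
have ball (a b : A) : unit_ball a -> unit_ball b -> cmul a b = cmul b a.
  move=> ab bb; apply/eqP; rewrite -subr_eq0; apply/eqP/cnorm_eq0/le_anti.
  rewrite cnorm_ge0 andbT -S0; apply: ub_le_sup; last by exists a => //; exists b.
  exists 2%:R => _ [c cb [d db <-]]; rewrite (le_trans (cnormD _ _))// cnormN.
  have le1 (u v : A) : unit_ball u -> unit_ball v -> cnorm (cmul u v) <= 1.
    move=> ub vb; rewrite (le_trans (cnormM _ _))// -[leRHS]mulr1 ler_pM ?cnorm_ge0//.
  by have := le1 c d cb db; have := le1 d c db cb; lra.
have unscale (a : A) : exists2 m : R[i], m != 0 & unit_ball (m *: a).
  have [m m0 ma] := scale_into_ball a; exists m^-1%:C => //.
  by apply/eqP => /complexI/eqP; rewrite invr_eq0 gt_eqF.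
have [k k0 kx] := unscale x; have [l l0 ly] := unscale y.
have := ball _ _ kx ly; rewrite !cmulZl !cmulZr !scalerA (mulrC l) => /eqP.
by rewrite -subr_eq0 -scalerBr scaler_eq0 mulf_eq0 (negPf k0) (negPf l0) subr_eq0 => /eqP.
Qed.

Lemma axiom_unitalP : nonzero_algebra A -> commutative (@cmul R A) ->
  axiom_unital A <-> unital A.
Proof.
move=> nz cA; rewrite /axiom_unital -unit_sentenceE; split=> [A0|[e eu]].
  by apply: approximate_unit_unital; rewrite ?A0.
have H := comm_unital_of nz cA eu.
have ep : is_projection e.
  by rewrite (is_unit_unique eu (cu_is_unit H)); exact: cu_one_projection.
apply/le_anti/andP; split; first exact: unital_unit_sentence eu (projection_in_ball ep).
rewrite unit_sentenceE; apply: inf_image_ge0; first exact: unit_ball_nonempty.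
move=> f fb; apply: (@sup_image_ge0 _ _ _ 2%:R); first exact: unit_ball_nonempty.
move=> x xb; rewrite cnorm_ge0/= (le_trans (cnormD _ _))// cnormN.
have := cnormM f x; have := ler_pM (cnorm_ge0 f) (cnorm_ge0 x) fb xb; rewrite mulr1.
by move: xb; rewrite /unit_ball/=; lra.
Qed.

(** The quantity inside the four quantifiers of the last axiom. *)
Definition corner_defect (x p y : A) (l : R[i]) : R :=
  cnorm (cmul (cmul p y) p - l *: p) + `| cnorm x - cnorm (cmul x p) |.

Lemma corner_defect_bound (x p y : A) (l : R[i]) : unit_ball x -> is_projection p -> unit_ball y ->
  cnorm l <= 1 -> 0 <= corner_defect x p y l <= 3%:R.
Proof.
move=> xb pp yb l1; have pb := projection_in_ball pp.
have le1 (u v : A) : unit_ball u -> unit_ball v -> unit_ball (cmul u v).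
  by move=> ub vb; rewrite /unit_ball/= (le_trans (cnormM _ _))// -[leRHS]mulr1 ler_pM ?cnorm_ge0.
rewrite /corner_defect addr_ge0 ?cnorm_ge0//=.
have h1 := le1 _ _ (le1 _ _ pb yb) pb.
have h2 : cnorm (l *: p) <= 1 by rewrite cnormZ -[leRHS]mulr1 ler_pM ?cnorm_ge0.
have h3 : `| cnorm x - cnorm (cmul x p) | <= 1.
  have := le1 _ _ xb pb; have := cnorm_ge0 (cmul x p); have := cnorm_ge0 x; move: xb.
  by rewrite /unit_ball/= ler_norml; lra.
have := cnormD (cmul (cmul p y) p) (- (l *: p)); rewrite cnormN.
by move: h1; rewrite /unit_ball/=; lra.
Qed.

Let disc : set R[i] := [set l | cnorm l <= 1].
(** The last axiom states that the supremum of level1 is 0; the levels peel off its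
quantifiers. *)
Let level3 x p y := inf [set corner_defect x p y l | l in disc].
Let level2 x p := sup [set level3 x p y | y in @unit_ball R A].
Let level1 x := inf [set level2 x p | p in [set p | is_projection p]].

Let disc0 : disc !=set0.
Proof. by exists 0; rewrite /disc/= cnorm0. Qed.

Let proj0 : [set p : A | is_projection p] !=set0.
Proof. by exists 0; split; rewrite ?cstar0 ?cmul0x. Qed.

Let level3_bound x p y : unit_ball x -> is_projection p -> unit_ball y -> 0 <= level3 x p y <= 3%:R.
Proof.
move=> xb pp yb; apply/andP; split.
  by apply: inf_image_ge0 => // l l1; have /andP[] := corner_defect_bound xb pp yb l1.
have l0 : disc 0 by rewrite /disc/= cnorm0.
have /andP[_] := corner_defect_bound xb pp yb l0; apply: le_trans.
by apply: inf_image_le => // l l1; have /andP[] := corner_defect_bound xb pp yb l1.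
Qed.

Let level2_bound x p : unit_ball x -> is_projection p -> 0 <= level2 x p <= 3%:R.
Proof.
move=> xb pp; have B0 := unit_ball_nonempty A; apply/andP; split.
  by apply: (@sup_image_ge0 _ _ _ 3%:R) => // y; exact: level3_bound.
have [y yb] := B0; apply: ge_sup => [|_ [z zb <-]]; first by exists (level3 x p y), y.
by have /andP[] := level3_bound xb pp zb.
Qed.

Let level1_bound x : unit_ball x -> 0 <= level1 x <= 3%:R.
Proof.
move=> xb; apply/andP; split.
  by apply: inf_image_ge0 => // p pp; have /andP[] := level2_bound xb pp.
have [p pp] := proj0; have /andP[_] := level2_bound xb pp; apply: le_trans.
by apply: inf_image_le => // q qp; have /andP[] := level2_bound xb qp.
Qed.

(** For x <> 0 take p with error less than ||x|| and 1/2, which excludes p = 0.  If r = qp is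
neither 0 nor p, then r - l *: p restricts to 1 - l on r and to - l on p - r, and both
cannot be less than 1/2 in modulus.  For x = 0 any minimal projection will do, and
the unit provides one. *)
Lemma axiom_normed_ball (H : comm_unital A) : axiom_normed_by_minimal_projections A ->
  forall (x : A) (eps : R), unit_ball x -> 0 < eps ->
    exists2 p, minimal_projection p & `|cnorm x - cnorm (cmul x p)| < eps.
Proof.
move=> ax.
have key (x : A) (eps : R) : unit_ball x -> 0 < eps -> x != 0 ->
    exists2 p, minimal_projection p & `|cnorm x - cnorm (cmul x p)| < eps.
  move=> xb eps0 x0.
  have x1 : level1 x <= 0.
    rewrite -ax; apply: (@sup_image_ge _ _ _ level1 3%:R) => // y yb.
    by have /andP[] := level1_bound yb.
  pose d := Num.min eps (Num.min (cnorm x) 2%:R^-1).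
  have d0 : 0 < d by rewrite !lt_min eps0 cnorm_gt0 x0 invr_gt0 ltr0n.
  have de : d <= eps by rewrite ge_min lexx.
  have dx : d <= cnorm x by rewrite !ge_min lexx /= ?orbT.
  have dh : d <= 2%:R^-1 by rewrite !ge_min lexx /= ?orbT.
  have [p pp p2] : exists2 p, is_projection p & level2 x p < d.
    apply: inf_image_lt => // [q qp|]; last exact: le_lt_trans x1 d0.
    by have /andP[] := level2_bound xb qp.
  have lam y : unit_ball y -> exists2 l, cnorm l <= 1 & corner_defect x p y l < d.
    move=> yb; apply: inf_image_lt => // [l l1|].
      by have /andP[] := corner_defect_bound xb pp yb l1.
    apply: le_lt_trans p2; apply: (@sup_image_ge _ _ _ (level3 x p) 3%:R) => // z zb.
    by have /andP[] := level3_bound xb pp zb.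
  have xp : `|cnorm x - cnorm (cmul x p)| < d.
    have [|l _] := lam 0; first by rewrite /unit_ball/= cnorm0.
    by rewrite /corner_defect; have := cnorm_ge0 (cmul (cmul p 0) p - l *: p); lra.
  have pn0 : p != 0.
    apply: contraTneq xp => ->.
    by rewrite cmulx0 cnorm0 subr0 ger0_norm ?cnorm_ge0// -leNgt.
  exists p; last exact: lt_le_trans xp de.
  apply: (minimal_of_small_defect H) => // q qp.
  set r := cmul q p.
  have rp : is_projection r := projectionM (cu_comm H) qp pp.
  have pr : cmul p r = r by rewrite /r (cu_comm H) -cmulA pp.2.
  have rp' : cmul r p = r by rewrite (cu_comm H).
  have [r0|r0] := eqVneq r 0; first by left; rewrite r0 cnorm0.
  have [s0|s0] := eqVneq (p - r) 0; first by right; rewrite s0 cnorm0.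
  have sp : is_projection (p - r) := projectionB (cu_comm H) pp rp pr.
  have [l l1] := lam q (projection_in_ball qp); rewrite /corner_defect.
  have -> : cmul (cmul p q) p = r by rewrite (cu_comm H p) rp'.
  have := normr_ge0 (cnorm x - cnorm (cmul x p)) => n0 lt.
  have h1 : cnorm (1 - l) <= cnorm (r - l *: p).
    have := cnormM r (r - l *: p).
    by rewrite cmulBr cmulZr rp' rp.2 -{1}[r]scale1r -scalerBl cnormZ (cnorm_projection rp r0) mulr1 mul1r.
  have h2 : cnorm l <= cnorm (r - l *: p).
    have := cnormM (p - r) (r - l *: p).
    rewrite cmulBr cmulZr cmulBl pr rp.2 subrr cmulBl pp.2 rp' sub0r cnormN cnormZ.
    by rewrite (cnorm_projection sp s0) mulr1 mul1r.
  have h3 : 1 <= cnorm (1 - l) + cnorm l.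
    have -> : 1 = cnorm (1 : R[i]) by rewrite -[1 in RHS](rmorph1 (real_complex R)) cnorm_real normr1.
    by have := cnorm_subl 1 l.
  by exfalso; lra.
move=> x eps xb eps0; have [->|x0] := eqVneq x 0; last exact: key.
have ub : unit_ball (cu_one H) by rewrite /unit_ball/= (cring_norm1 H).
have [p pm _] := key (cu_one H) eps ub eps0 (cu_neq0 H).
by exists p => //; rewrite cmul0x cnorm0 subrr normr0.
Qed.

(** A scalar l with pyp = l *: p has modulus at most 1 when p is a nonzero projection. *)
Lemma normed_axiom : normed_by_minimal_projections A -> axiom_normed_by_minimal_projections A.
Proof.
move=> nm; have B0 := unit_ball_nonempty A.
have level10 x : unit_ball x -> level1 x = 0.
  move=> xb; apply/le_anti/andP; split; last by have /andP[] := level1_bound xb.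
  apply/ler_addgt0Pr => eps eps0; rewrite add0r.
  have [p [[pp p0 _] pc px]] := nm x eps eps0.
  apply: (@le_trans _ _ (level2 x p)).
    by apply: inf_image_le => // q qp; have /andP[] := level2_bound xb qp.
  have [y0 y0b] := B0; apply: ge_sup; first by exists (level3 x p y0), y0.
  move=> _ [y yb <-].
  have : [set cmul (cmul p y) p | y in [set: A]] (cmul (cmul p y) p) by exists y.
  rewrite pc => -[l _ lE].
  have p1 := cnorm_projection pp p0.
  have l1 : cnorm l <= 1.
    rewrite -[leLHS]mulr1 -p1 -cnormZ lE (le_trans (cnormM _ _))// p1 mulr1.
    by rewrite (le_trans (cnormM _ _))// p1 mul1r.
  apply: (@le_trans _ _ (corner_defect x p y l)).
    by apply: inf_image_le => // k k1; have /andP[] := corner_defect_bound xb pp yb k1.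
  by rewrite /corner_defect -lE subrr cnorm0 add0r ltW.
rewrite /axiom_normed_by_minimal_projections -[X in sup X]/[set level1 x | x in @unit_ball R A].
have -> : [set level1 x | x in @unit_ball R A] = [set 0].
  apply/seteqP; split=> [_ [x xb <-]|_ ->]; first exact: level10.
  by have [x xb] := B0; exists x => //; exact: level10.
exact: sup1.
Qed.

End ExplicitConditions.

Theorem proposition4p2 (R : realType) (A : cstarAlgType R)
    (A_nonzero : nonzero_algebra A) :
  ((commutative (@cmul R A) /\ pseudocompact A) <->
   [/\ commutative (@cmul R A), unital A, real_rank_zero A &
       normed_by_minimal_projections A]) /\
  (forall phi_rr0 : sentence R, axiomatizes_real_rank_zero phi_rr0 ->
    ((commutative (@cmul R A) /\ pseudocompact A) <->
     [/\ axiom_commutative A, axiom_unital A,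
         sentence_value A phi_rr0 = 0%R &
         axiom_normed_by_minimal_projections A])).
Proof.
have char : (commutative (@cmul R A) /\ pseudocompact A) <->
    [/\ commutative (@cmul R A), unital A, real_rank_zero A & normed_by_minimal_projections A].
  split=> [[cA pA]|[cA uA rrA nmA]].
    by have [] := pseudocompact_unital_rr0_normed A_nonzero cA pA.
  by split=> //; exact: unital_rr0_normed_pseudocompact.
split=> // phi phi_rr0; rewrite char; split=> [[cA uA rrA nmA]|[acA auA /phi_rr0 rrA anA]].
  split; [exact/axiom_commutativeP|exact/axiom_unitalP|exact/phi_rr0|exact: normed_axiom].
have cA : commutative (@cmul R A) by exact/axiom_commutativeP.
have uA : unital A by exact/axiom_unitalP.
have [e eu] := uA; have H := comm_unital_of A_nonzero cA eu.
split=> //; apply: (normed_of_ball H (real_rank_zero_approximable H rrA)).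
exact: axiom_normed_ball.
Qed.
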